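(* Let $p\ge 1$, $\gamma>p$, let $V,U$ be Banach spaces, let $X:[0,1]\to G(V)$ be a geometric $p$-rough path with $x_t:=\pi_1(X_t)\in V$, and let $\theta:V\to L(V,U)$ be a $\mathrm{Lip}(\gamma-1)$ one-form with associated family $(\theta^k)_k$, $\theta^0=\theta$. For $s\in[0,1]$ let $q_{x_s}:V\to L(V,U)$ be the polynomial one-form $$q_{x_s}(v)(w)=\sum_{k=0}^{[p]-1}\theta^k(x_s)\frac{(v-x_s)^{\otimes k}}{k!}(w),\qquad v,w\in V,$$ and let $F_{q_{x_s}}:G(V)\to G(U)$ be its lift (defined in the context). Let $\int_{r=0}^1\theta(x_r)\,dX_r$ denote Lyons' integral of $\theta$ along $X$ (defined in the context). Then, in $T^{([p])}(U)$ (i.e. after truncating all elements of $G(U)$ to tensor degrees $\le [p]$), $$\int_{r=0}^1\theta(x_r)\,dX_r=\lim_{|D|\to 0}\Big(F_{q_{x_{t_0}}}(X_{t_0})^{-1}F_{q_{x_{t_0}}}(X_{t_1})\Big)\Big(F_{q_{x_{t_1}}}(X_{t_1})^{-1}F_{q_{x_{t_1}}}(X_{t_2})\Big)\cdots\Big(F_{q_{x_{t_{n-1}}}}(X_{t_{n-1}})^{-1}F_{q_{x_{t_{n-1}}}}(X_{t_n})\Big),$$ where the limit (which exists) is over finite partitions $D=\{t_k\}_{k=0}^n$, $0=t_0<\cdots<t_n=1$, $n\ge1$, with $|D|:=\max_k|t_{k+1}-t_k|$.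
   Context: $[p]$ is the integer part of $p$. $L(E,F)$ denotes continuous linear maps between Banach spaces. **Tensor norms.** The tensor powers $V^{\otimes n}$, $U^{\otimes n}$ are completed under admissible norms: permutations of tensor factors are isometries and $\|v\otimes w\|\le\|v\|\|w\|$. Tensor products $\phi_1\otimes\cdots\otimes\phi_l$ of operators $\phi_i\in L(V^{\otimes k_i},U)$ are understood as bounded operators $V^{\otimes(k_1+\cdots+k_l)}\to U^{\otimes l}$ with norm at most $\prod\|\phi_i\|$. Put $T((V))=\prod_{n\ge0}V^{\otimes n}$ with the tensor product as multiplication, write $s=\sum_n s^n$ with $s^n=\pi_n(s)\in V^{\otimes n}$, and let $T^{([p])}(U)=\bigoplus_{i=0}^{[p]}U^{\otimes i}$ be the truncated tensor algebra. **Permutations.** $S_n$ is the symmetric group, $1_n$ its identity, $S_0=\{\lambda\}$. Permutations $\sigma\in S_n$ are written as words $\sigma(1)\cdots\sigma(n)$. For $\sigma\in S_n,\rho\in S_m$ set $\bar\rho(i)=n+\rho(i)$. $\sigma\ast'\rho\in\mathbb{Z}S_{n+m}$ is the sum of all shuffles of the words $\sigma$ and $\bar\rho$. For $m\ge1$, $\sigma\succ\rho\in\mathbb{Z}S_{n+m}$ is the sum of all words obtained by shuffling $\sigma$ with $\bar\rho(1)\cdots\bar\rho(m-1)$ and then appending $\bar\rho(m)$; both are extended bilinearly. $m_\succ(\rho_1,\dots,\rho_l)=(\cdots((\rho_1\succ\rho_2)\succ\rho_3)\cdots)\succ\rho_l$. $\sigma\in S_n$ acts on $V^{\otimes n}$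 by $\sigma\cdot(v_1\otimes\cdots\otimes v_n)=v_{\sigma1}\otimes\cdots\otimes v_{\sigma n}$. For $s\in T((V))$ and $\sigma\in S_n$ put $\widehat s(\sigma):=\sigma^{-1}\cdot s^n\in V^{\otimes n}$, extended linearly to $\mathbb{Z}S$ (in a basis: the coefficient of the word $w$ in $\widehat s(\sigma)$ is the coefficient of $\sigma\cdot w$ in $s$). **Group-like elements.** $G(V)$ is the group of $s\in T((V))$ with $s^0=1$ and $s^n\otimes s^m=\widehat s(1_n\ast'1_m)$ for all $n,m\ge0$; similarly $G(U)$. **Geometric rough path.** $d(a,b):=\sup_{k\ge1}\|\pi_k(a^{-1}b)\|^{1/k}$ for $a,b\in G(V)$. A control is a continuous, super-additive function $\omega:\{(s,t):0\le s\le t\le1\}\to[0,\infty)$ vanishing on the diagonal. $X:[0,1]\to G(V)$ is a geometric $p$-rough path if there is a control $\omega$ with $\|X\|^p_{p-var,[s,t]}:=\sup_D\sum_k d(X_{t_k},X_{t_{k+1}})^p\le\omega(s,t)$ for all $s\le t$ (supremum over finite partitions of $[s,t]$). $X_{s,t}:=X_s^{-1}X_t$. **Lipschitz one-form.** With $k_0$ the integer satisfying $\gamma-1\in(k_0,k_0+1]$, $\theta:V\to L(V,U)$ is $\mathrm{Lip}(\gamma-1)$ if there are $\theta^0=\theta$ and $\theta^j:V\to L(V^{\otimes j},L(V,U))$, $j=1,\dots,k_0$, with values symmetric in the $j$ arguments, and $M\ge 0$ with $\|\theta^j(x)\|\le M$ and $\theta^j(x)=\sum_{l=0}^{k_0-j}\theta^{j+l}(y)\frac{(x-y)^{\otimes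 l}}{l!}+R_j(x,y)$, $\|R_j(x,y)\|\le M\|x-y\|^{\gamma-1-j}$, for all $x,y\in V$. $\theta^j(x)$ is also viewed as an element of $L(V^{\otimes(j+1)},U)$. **Lift of a polynomial one-form.** For a polynomial one-form $q:V\to L(V,U)$ of degree at most $n$, with derivatives $(D^kq)(0)$ regarded in $L(V^{\otimes(k+1)},U)$, $$F_q(s):=1+\sum_{l=1}^\infty\ \sum_{k_1,\dots,k_l=0}^{n}\big((D^{k_1}q)(0)\otimes\cdots\otimes(D^{k_l}q)(0)\big)\,\widehat s\big(m_\succ(1_{k_1+1},\dots,1_{k_l+1})\big),$$ the $l$-th summand lying in $U^{\otimes l}$; $F_q$ takes values in $G(U)$. **Lyons' integral.** For $s\le t$ let $Y_{s,t}=(1,Y^1_{s,t},\dots,Y^{[p]}_{s,t})\in T^{([p])}(U)$ be Lyons' almost multiplicative functional $$Y^i_{s,t}=\sum_{l_1,\dots,l_i=1}^{[p]}\big(\theta^{l_1-1}(x_s)\otimes\cdots\otimes\theta^{l_i-1}(x_s)\big)\,\widehat{X_{s,t}}\big(m_\succ(1_{l_1},\dots,1_{l_i})\big).$$ By Lyons' theorem the limit $\lim_{|D|\to0}Y_{t_0,t_1}\cdots Y_{t_{n-1},t_n}$ exists in $T^{([p])}(U)$, and $\int_{r=0}^1\theta(x_r)\,dX_r$ is defined to be this limit.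
   Formalization: In the Lip(γ−1) condition, θ^j(x) and R_j(x,y) are required to define elements of L(V^{⊗(j+1)},U), and the bounds M and M‖x−y‖^{γ−1−j} are imposed on their norms there; for general admissible tensor norms the view of θ^j(x) in that space need not otherwise exist. *)

(* Defs.v *)
From HB Require Import structures.
From mathcomp Require Import all_boot all_order all_algebra all_fingroup.
From mathcomp Require Import all_classical all_reals all_analysis.

Set Implicit Arguments.
Unset Strict Implicit.
Unset Printing Implicit Defensive.

Import Order.TTheory GRing.Theory Num.Theory.
Import numFieldNormedType.Exports.

Local Open Scope classical_set_scope.
Local Open Scope ring_scope.

Section ContinuousLinear.
Context {R : realType} {E F : normedModType R}.

Definition is_clinear : {pred E -> F} :=
  [pred f | `[< linear f /\ continuous f >]].

Lemma is_clinearP (f : E -> F) :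
  reflect (linear f /\ continuous f) (f \in is_clinear).
Proof. by rewrite inE; apply: asboolP. Qed.

Record clinear := CLinear {
  clinear_fun :> E -> F;
  clinear_subproof : clinear_fun \in is_clinear }.

HB.instance Definition _ := [isSub for clinear_fun].
HB.instance Definition _ := [Choice of clinear by <:].

Lemma is_clinear_submod_closed : submod_closed is_clinear.
Proof.
split.
  apply/is_clinearP; split=> [a x y|x]; last exact: cvg_cst.
  by rewrite /= scaler0 addr0.
move=> a f g /is_clinearP[lf cf] /is_clinearP[lg cg]; apply/is_clinearP; split.
  move=> b x y; change (a *: f (b *: x + y) + g (b *: x + y) =
    b *: (a *: f x + g x) + (a *: f y + g y)).
  by rewrite lf lg !scalerDr !scalerA (mulrC a b) addrACA.
by move=> x; apply: cvgD; [apply: (cvgZl_tmp (k := a)); exact: cf|exact: cg].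
Qed.

HB.instance Definition _ := GRing.isSubmodClosed.Build R (E -> F) is_clinear
  is_clinear_submod_closed.
HB.instance Definition _ := [SubChoice_isSubLmodule of clinear by <:].

Lemma clinear_is_linear (f : clinear) : linear f.
Proof. by case: f => f /= /is_clinearP[]. Qed.

HB.instance Definition _ (f : clinear) :=
  GRing.isLinear.Build R E F *:%R (clinear_fun f) (clinear_is_linear f).

Lemma clinear_continuous (f : clinear) : continuous f.
Proof. by case: f => f /= /is_clinearP[]. Qed.

Definition opnorm (f : clinear) : R :=
  sup [set `|f x| | x in [set x : E | `|x| <= 1]].

Lemma clinear_has_sup (f : clinear) :
  has_sup [set `|f x| | x in [set x : E | `|x| <= 1]].
Proof.
split; first by exists `|f 0|; exists 0 => //=; rewrite normr0.
have /continuous_linear_bounded/bounded_funP/(_ 1)[M fM] :=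
  @clinear_continuous f 0.
by exists M => _ [x /= x1 <-]; exact: fM.
Qed.

Lemma ler_opnorm1 (f : clinear) x : `|x| <= 1 -> `|f x| <= opnorm f.
Proof.
move=> x1; apply: ub_le_sup; last by exists x.
by case: (clinear_has_sup f).
Qed.

Lemma opnorm_ge0 f : 0 <= opnorm f.
Proof. by apply: le_trans (ler_opnorm1 f (x := 0) _); rewrite ?normr0. Qed.

Lemma ler_opnorm (f : clinear) x : `|f x| <= opnorm f * `|x|.
Proof.
have [->|x0] := eqVneq x 0; first by rewrite linear0 !normr0 mulr0.
have nx : 0 < `|x| by rewrite normr_gt0.
rewrite -ler_pdivrMr // mulrC -[`|x|^-1]gtr0_norm ?invr_gt0 // -normrZ -linearZ.
by apply: ler_opnorm1; rewrite normrZ gtr0_norm ?invr_gt0 // mulVf ?gt_eqF.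
Qed.

Lemma opnorm_le (f : clinear) M :
  (forall x, `|x| <= 1 -> `|f x| <= M) -> opnorm f <= M.
Proof.
move=> fM; apply: ge_sup; first by case: (clinear_has_sup f).
by move=> _ [x /= x1 <-]; exact: fM.
Qed.

Lemma opnormD f g : opnorm (f + g) <= opnorm f + opnorm g.
Proof.
apply: opnorm_le => x x1.
rewrite [clinear_fun _](_ : _ = (f : E -> F) + g) //.
by apply: le_trans (ler_normD _ _) _; apply: lerD; exact: ler_opnorm1.
Qed.

Lemma opnormZ (a : R) f : opnorm (a *: f) = `|a| * opnorm f.
Proof.
have le (b : R) g : opnorm (b *: g) <= `|b| * opnorm g.
  apply: opnorm_le => x x1.
  rewrite [clinear_fun _](_ : _ = b *: (g : E -> F)) //.
  by rewrite [(_ *: _) x]/(b *: g x) normrZ ler_wpM2l // ler_opnorm1.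
apply/eqP; rewrite eq_le le /=.
have [->|a0] := eqVneq a 0; first by rewrite normr0 mul0r opnorm_ge0.
have := le a^-1 (a *: f); rewrite scalerA mulVf // scale1r normfV.
by rewrite ler_pdivlMl // normr_gt0.
Qed.

Lemma opnorm0_eq0 f : opnorm f = 0 -> f = 0.
Proof.
move=> f0; apply/val_inj/funext => x /=.
by apply/eqP; rewrite -normr_le0 (le_trans (ler_opnorm f x)) // f0 mul0r.
Qed.

HB.instance Definition _ :=
  Lmodule_isNormed.Build R clinear opnormD opnormZ opnorm0_eq0.

End ContinuousLinear.

Arguments clinear {R} E F.

Definition multilinear (R : realType) (V W : lmodType R) n
    (f : ('I_n -> V) -> W) :=
  forall (i : 'I_n) (v : 'I_n -> V), linear (fun x => f [eta v with i |-> x]).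

Definition fcat (T : Type) n m (v : 'I_n -> T) (w : 'I_m -> T) :
    'I_(n + m) -> T :=
  fun k => match fintype.split k with inl i => v i | inr j => w j end.

(* [tpow n] is the completion of the n-fold algebraic tensor power of V:
   [tens_universal] says that the span of the elementary tensors is that
   algebraic tensor power, and [tens_dense] that this span is dense.  All the
   remaining operations are determined by their values on elementary tensors;
   their fields assert that the norms are admissible, that V^{(x)0} is the
   normed line spanned by the empty tensor, and that V^{(x)1} is V. *)
Record tensorPowers (R : realType) (V : completeNormedModType R) :=
  TensorPowers {
  tpow :> nat -> completeNormedModType R;
  tens : forall n, ('I_n -> V) -> tpow n;
  tens_multilinear : forall n, multilinear (@tens n);
  tens_universal : forall n (W : lmodType R) (f : ('I_n -> V) -> W),
    multilinear f -> exists g : {linear tpow n -> W}, forall v, g (tens v) = f v;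
  tens_dense : forall n, dense [set y : tpow n |
    exists r : seq (R * ('I_n -> V)), y = \sum_(c <- r) c.1 *: tens c.2];
  tmul : forall n m, tpow n -> tpow m -> tpow (n + m);
  tmul_linearl : forall n m (y : tpow m), linear (fun x : tpow n => tmul x y);
  tmul_linearr : forall n m (x : tpow n), linear (fun y : tpow m => tmul x y);
  tmul_tens : forall n m (v : 'I_n -> V) (w : 'I_m -> V),
    tmul (tens v) (tens w) = tens (fcat v w);
  ler_norm_tmul : forall n m (x : tpow n) (y : tpow m),
    `|tmul x y| <= `|x| * `|y|;
  tact : forall n, 'S_n -> {linear tpow n -> tpow n};
  tact_tens : forall n (s : 'S_n) (v : 'I_n -> V),
    tact s (tens v) = tens (fun i => v (s i));
  norm_tact : forall n (s : 'S_n) (x : tpow n), `|tact s x| = `|x|;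
  norm_tens0 : forall v : 'I_0 -> V, `|tens v| = 1;
  norm_tens1 : forall v : V, `|tens (fun _ : 'I_1 => v)| = `|v|;
  untens1 : tpow 1 -> V;
  untens1K : forall x : tpow 1, tens (fun _ : 'I_1 => untens1 x) = x
}.

Section TensorSeries.
Context {R : realType} {V : completeNormedModType R} (TV : tensorPowers V).

(* T((V)); the topology is that of componentwise convergence. *)
Definition tseries := prod_topology (TV : nat -> completeNormedModType R).

HB.instance Definition _ := Uniform.on tseries.
HB.instance Definition _ := Pointed.copy tseries (forall n, TV n).

(* V^{(x)n} inside T((V)).  As n + m and m + n (say) are not convertible,
   [homog x k] is also how a tensor x of degree n is read in degree k = n. *)
Definition homog n (x : TV n) : tseries := dfwith (fun k => 0 : TV k) n x.

Definition tsone : tseries := homog (tens TV (fun _ : 'I_0 => 0)).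

Definition tsmul (s t : tseries) : tseries :=
  fun n => \sum_(i < n.+1) homog (tmul (s i) (t (n - i)%N)) n.

Definition tsinv (s : tseries) : tseries :=
  xget tsone [set t | tsmul s t = tsone /\ tsmul t s = tsone].

(* T^{(N)}(V) is the set of series vanishing in degrees > N, with product
   [ttmul N]. *)
Definition ttrunc (N : nat) (s : tseries) : tseries :=
  fun n => if (n <= N)%N then s n else 0.

Definition ttmul (N : nat) (s t : tseries) : tseries := ttrunc N (tsmul s t).

Definition vtens (v : V) : TV 1 := tens TV (fun _ : 'I_1 => v).

Definition tpower n (v : V) : TV n := tens TV (fun _ : 'I_n => v).

Definition tsnoc n (a : TV n) (v : V) : TV n.+1 := homog (tmul a (vtens v)) n.+1.

End TensorSeries.

Definition zS (n : nat) := {ffun 'S_n -> int}.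

Definition zperm n (s : 'S_n) : zS n := [ffun t => (t == s)%:R].

(* Words are written with the letters 0, ..., n - 1. *)
Definition pword n (s : 'S_n) : seq nat := [seq (s i : nat) | i <- enum 'I_n].

(* With multiplicity. *)
Fixpoint shuffles (T : Type) (u : seq T) : seq T -> seq (seq T) :=
  if u is a :: u' then
    fix shuffles_u (v : seq T) :=
      if v is b :: v' then
        [seq a :: w | w <- shuffles u' v] ++ [seq b :: w | w <- shuffles_u v']
      else [:: u]
  else fun v => [:: v].

Definition succ_shuffles (T : Type) (u v : seq T) : seq (seq T) :=
  if v is b :: v' then [seq rcons w (last b v') | w <- shuffles u (belast b v')]
  else [::].

Definition zbilin (sh : seq nat -> seq nat -> seq (seq nat)) n m
    (a : zS n) (b : zS m) : zS (n + m) :=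
  [ffun t => \sum_(s : 'S_n) \sum_(r : 'S_m) a s * b r *
     (count_mem (pword t) (sh (pword s) [seq (n + i)%N | i <- pword r]))%:Z].

Definition zstar n m (a : zS n) (b : zS m) : zS (n + m) :=
  zbilin (@shuffles nat) a b.

Definition zsucc n m (a : zS n) (b : zS m) : zS (n + m) :=
  zbilin (@succ_shuffles nat) a b.

(* The empty list, for which m_> is undefined, is sent to 0. *)
Definition msucc (bs : seq {n : nat & zS n}) : {n : nat & zS n} :=
  if bs is b :: bs' then
    foldl (fun a c => Tagged zS (zsucc (tagged a) (tagged c))) b bs'
  else Tagged zS (0 : zS 0).

Definition msucc_id l (k : 'I_l -> nat) : {n : nat & zS n} :=
  msucc [seq Tagged zS (zperm (1%g : 'S_(k i))) | i <- enum 'I_l].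

Definition hat (R : realType) (V : completeNormedModType R)
    (TV : tensorPowers V) (s : tseries TV) n (a : zS n) : TV n :=
  \sum_(sigma : 'S_n) tact TV sigma^-1%g (s n) *~ a sigma.

Definition grouplike (R : realType) (V : completeNormedModType R)
    (TV : tensorPowers V) (s : tseries TV) :=
  s 0%N = tsone TV 0%N /\
  forall n m, tmul (s n) (s m) =
    hat s (zstar (zperm (1%g : 'S_n)) (zperm (1%g : 'S_m))).

Definition tdist (R : realType) (V : completeNormedModType R)
    (TV : tensorPowers V) (a b : tseries TV) : \bar R :=
  ereal_sup [set (`|tsmul (tsinv a) b k| `^ k%:R^-1)%:E
            | k in [set k : nat | (0 < k)%N]].

(* ||X||_{p-var,[s,t]}^p; a partition s = t_0 < t_1 < ... < t_n = t is
   represented by the list [:: t_1; ...; t_n]. *)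
Definition pvar (R : realType) (V : completeNormedModType R)
    (TV : tensorPowers V) (p : R) (X : R -> tseries TV) (s t : R) : \bar R :=
  ereal_sup [set (\sum_(k < size D)
      (tdist (X (nth s (s :: D) k)) (X (nth s D k))) `^ p)%E
    | D in [set D | itv_partition s t D]].

Record control (R : realType) (omega : R -> R -> R) : Prop := Control {
  control_ge0 : forall s t, 0 <= s -> s <= t -> t <= 1 -> 0 <= omega s t;
  control_continuous :
    {within [set z : R * R | 0 <= z.1 /\ z.1 <= z.2 /\ z.2 <= 1],
     continuous (fun z : R * R => omega z.1 z.2)};
  control_superadditive : forall s u t, 0 <= s -> s <= u -> u <= t -> t <= 1 ->
    omega s u + omega u t <= omega s t;
  control_diag : forall t, 0 <= t -> t <= 1 -> omega t t = 0
}.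

(* Paths are functions on R of which only the restriction to [0, 1] matters. *)
Definition geometric_rough_path (R : realType) (V : completeNormedModType R)
    (TV : tensorPowers V) (p : R) (X : R -> tseries TV) :=
  (forall t, 0 <= t -> t <= 1 -> grouplike (X t)) /\
  exists omega : R -> R -> R, control omega /\
    forall s t, 0 <= s -> s <= t -> t <= 1 ->
      (pvar p X s t <= (omega s t)%:E)%E.

Definition trace (R : realType) (V : completeNormedModType R)
    (TV : tensorPowers V) (X : R -> tseries TV) (t : R) : V :=
  untens1 (X t 1%N).

(* [B] in L(V^{(x)j}, L(V, U)) regarded as [A] in L(V^{(x)(j+1)}, U); there is
   at most one such [A]. *)
Definition regarded_as (R : realType) (V U : completeNormedModType R)
    (TV : tensorPowers V) j (B : TV j -> clinear V U)
    (A : clinear (TV j.+1) U) :=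
  forall (a : TV j) (w : V), A (tsnoc a w) = B a w.

Definition uncurry_op (R : realType) (V U : completeNormedModType R)
    (TV : tensorPowers V) j (B : clinear (TV j) (clinear V U)) :
    clinear (TV j.+1) U :=
  xget 0 [set A | regarded_as B A].

(* phi_1 (x) ... (x) phi_l; the product in [otens_tmul] is v_1 (x) ... (x) v_l
   for v_i in V^{(x)k_i}, so that [otens phi] is determined by [phi]. *)
Record operatorTensors (R : realType) (V U : completeNormedModType R)
    (TV : tensorPowers V) (TU : tensorPowers U) := OperatorTensors {
  otens : forall l (k : 'I_l -> nat), (forall i, clinear (TV (k i)) U) ->
    clinear (TV (\sum_(i < l) k i)%N) (TU l);
  otens_tmul : forall l (k : 'I_l -> nat) (phi : forall i, clinear (TV (k i)) U)
      (v : forall i, TV (k i)),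
    otens phi ((\big[@tsmul _ _ TV/tsone TV]_(i < l) homog (v i))
                 (\sum_(i < l) k i)%N) =
    tens TU (fun i => phi i (v i));
  norm_otens : forall l (k : 'I_l -> nat) (phi : forall i, clinear (TV (k i)) U),
    `|otens phi| <= \prod_(i < l) `|phi i|
}.

(* The estimates are those of the operators theta^j(x) and R_j(x, y) regarded
   as elements of L(V^{(x)(j+1)}, U): [A] is that element and [`|A|] its norm
   there.  This norm dominates the one of L(V^{(x)j}, L(V, U)), with equality
   for the projective tensor norms; for other admissible norms an element of
   L(V^{(x)j}, L(V, U)) need not define one of L(V^{(x)(j+1)}, U). *)
Record lip_oneform (R : realType) (V U : completeNormedModType R)
    (TV : tensorPowers V) (gamma : R) (theta : V -> clinear V U)
    (th : forall j, V -> clinear (TV j) (clinear V U))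
    (k0 : nat) (M : R) : Prop := LipOneform {
  lip_degree : k0%:R < gamma - 1 /\ gamma - 1 <= k0.+1%:R;
  lip_ge0 : 0 <= M;
  lip_theta0 : forall x, th 0%N x (tens TV (fun _ : 'I_0 => 0)) = theta x;
  lip_symmetric : forall j x (s : 'S_j) (a : TV j), (j <= k0)%N ->
    th j x (tact TV s a) = th j x a;
  lip_bounded : forall j x, (j <= k0)%N ->
    exists A, regarded_as (th j x) A /\ `|A| <= M;
  lip_taylor : forall j x y, (j <= k0)%N ->
    exists A,
      regarded_as (fun a => th j x a - \sum_(l < (k0 - j).+1)
        (l`!%:R)^-1 *: th (j + l)%N y (tmul a (tpower TV l (x - y)))) A /\
      `|A| <= M * `|x - y| `^ (gamma - 1 - j%:R)
}.

Definition Lip (R : realType) (V U : completeNormedModType R)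
    (TV : tensorPowers V) (gamma : R) (theta : V -> clinear V U)
    (th : forall j, V -> clinear (TV j) (clinear V U)) :=
  exists (k0 : nat) (M : R), lip_oneform gamma theta th k0 M.

Section Lift.
Context {R : realType} {V U : completeNormedModType R}.
Context {TV : tensorPowers V} {TU : tensorPowers U}.
Variable OT : operatorTensors TV TU.

Definition iter_derive (q : V -> clinear V U) (vs : seq V) : V -> clinear V U :=
  foldr (fun v f => 'D_v f) q vs.

(* (D^k q)(x), the operator with
   v_1 (x) ... (x) v_k |-> (d_{v_1} ... d_{v_k} q)(x) *)
Definition Dop (k : nat) (q : V -> clinear V U) (x : V) :
    clinear (TV k) (clinear V U) :=
  xget 0 [set B : clinear (TV k) (clinear V U) | forall v : 'I_k -> V,
    B (tens TV v) = iter_derive q [seq v i | i <- enum 'I_k] x].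

(* (phi_1 (x) ... (x) phi_l) (s^(m_>(1_{k_1}, ..., 1_{k_l}))) *)
Definition lift_term l (k : 'I_l -> nat) (phi : forall i, clinear (TV (k i)) U)
    (s : tseries TV) : TU l :=
  otens OT phi (homog (hat s (tagged (msucc_id k))) (\sum_(i < l) k i)%N).

Definition oneform_lift (n : nat) (q : V -> clinear V U) (s : tseries TV) : tseries TU :=
  fun l => if l is 0%N then tsone TU l else
    \sum_(k : {ffun 'I_l -> 'I_n.+1})
      lift_term (k := fun i => (k i).+1)
        (fun i => uncurry_op (Dop (k i) q 0)) s.

Variables (p : R) (X : R -> tseries TV).
Variable th : forall j, V -> clinear (TV j) (clinear V U).

Definition almost_mult (s t : R) : tseries TU :=
  ttrunc (Num.truncn p) (fun i => if i is 0%N then tsone TU i else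
    \sum_(l : {ffun 'I_i -> 'I_(Num.truncn p)})
      lift_term (k := fun j => (l j).+1)
        (fun j => uncurry_op (th (l j) (trace X s)))
        (tsmul (tsinv (X s)) (X t))).

(* Partitions of [0, 1] are represented as in [pvar]. *)
Definition mesh (D : seq R) : R :=
  \big[Num.max/0]_(k < size D) `|nth 0 D k - nth 0 (0 :: D) k|.

Definition mesh_to0 : set_system (seq R) :=
  filter_from [set delta : R | 0 < delta]
    (fun delta => [set D | itv_partition 0 1 D /\ mesh D < delta]).

(* Z_{t_0,t_1} ... Z_{t_{n-1},t_n}, in T^{([p])}(U) *)
Definition partition_prod (Z : R -> R -> tseries TU) (D : seq R) : tseries TU :=
  \big[@ttmul _ _ TU (Num.truncn p)/tsone TU]_(k < size D)
    Z (nth 0 (0 :: D) k) (nth 0 D k).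

Definition lyons_integral : tseries TU :=
  lim (partition_prod almost_mult @ mesh_to0).

Definition taylor_oneform (x v : V) : clinear V U :=
  \sum_(k < Num.truncn p) (k`!%:R)^-1 *: th k x (tpower TV k (v - x)).

Definition lift_increment (s t : R) : tseries TU :=
  let F := oneform_lift (Num.truncn p).-1 (taylor_oneform (trace X s)) in
  ttrunc (Num.truncn p) (tsmul (tsinv (F (X s))) (F (X t))).

End Lift.

(* Main.v *)
Require Import Defs.
From HB Require Import structures.
From mathcomp Require Import all_boot all_order all_algebra all_fingroup.
From mathcomp Require Import all_classical all_reals all_analysis.
From mathcomp Require Import zify lra ring.

(** Write [G_phi] for the lift of the one-form with Taylor coefficients [phi] at
    [0].  If [a] is group-like and [b] is any series, then
    [G_phi (a b) = G_phi a * G_psi b], where [psi] are the coefficients of the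
    same one-form at the point [a^1].  By linearity [b] may be taken to be an
    elementary tensor; one peels off the last block of the set partitions that
    index the terms of [G_phi], and group-likeness turns the sum over all ways
    to distribute the letters of [a] over the two remaining parts into a
    product.  Applied to [a = X_s], this says that the increments of the theorem
    are exactly Lyons' almost multiplicative functional, so that only the
    convergence of its products remains.  The same identity reduces almost
    multiplicativity to the Taylor estimate for [theta], and the limit exists by
    a sewing argument, by induction on the tensor degree: in each degree a
    product of series with constant term [1] is the sum of its factors up to
    terms of lower degree. *)

Set Implicit Arguments.
Unset Strict Implicit.
Unset Printing Implicit Defensive.

Import Order.TTheory GRing.Theory Num.Theory.
Import numFieldNormedType.Exports.

Local Open Scope classical_set_scope.
Local Open Scope ring_scope.

(** * Continuous linear maps and elementary tensors *)

(** Degrees such as [n + (m + k)] and [n + m + k] are equal without being convertible, and [otens]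
    and the permutations are known only on elementary tensors. So identities are not proved on
    tensors directly: both sides are linear and continuous, elementary tensors have dense span, and
    on them every operation acts on lists of vectors. There shuffling words becomes splitting a list
    into two complementary subsequences, and in [m_succ] the last vector of the list always closes
    the last block; this is what makes an induction on the number of blocks possible. Only the
    values of [X] have to be group-like, never an increment. For the analysis, [m = om ^ (1/p)]
    measures one tensor degree. The Taylor polynomial has [[p]] coefficients, although [theta] may
    have more, so the error of coefficient [j] has order [m ^ (b - 1 - j)] with [b = min(gamma, [p]
    + 1)]. A block with this coefficient consumes [j + 1] letters of the increment, so changing a
    coefficient in any block costs [m ^ b = om ^ (b/p)], and [b/p > 1] is what sewing requires. *)

Section LinearContinuous.
Context {R : realType}.

(** Unbundled, so that a map written as a plain function can be treated according to the shape of
    its body. *)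
Definition lcont (E F : normedModType R) (f : E -> F) :=
  linear f /\ continuous f.

Implicit Types E F G : normedModType R.

Definition to_clinear E F (f : E -> F) (h : lcont f) : clinear E F :=
  CLinear (introT (is_clinearP f) h).

Lemma lcont_clinear E F (f : clinear E F) : lcont f.
Proof. by split; [exact: clinear_is_linear|exact: clinear_continuous]. Qed.

Lemma bounded_lcont E F (f : E -> F) (M : R) :
  linear f -> (forall x, `|f x| <= M * `|x|) -> lcont f.
Proof.
move=> lf fM; split=> //.
pose g : {linear E -> F} := HB.pack f (GRing.isLinear.Build R E F *:%R f lf).
apply: (linear_bounded_continuous g).1; apply/linear_boundedP.
near=> r => x; apply: le_trans (fM x) _; rewrite ler_wpM2r //.
Unshelve. all: by end_near. Qed.

Lemma lcontD E F (f : E -> F) x y : lcont f -> f (x + y) = f x + f y.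
Proof. by case=> lf _; have := lf 1 x y; rewrite !scale1r. Qed.

Lemma lcont0 E F (f : E -> F) : lcont f -> f 0 = 0.
Proof. by move=> h; apply: (addIr (f 0)); rewrite -lcontD // !add0r. Qed.

Lemma lcontZ E F (f : E -> F) a x : lcont f -> f (a *: x) = a *: f x.
Proof. by move=> h; have := h.1 a x 0; rewrite !addr0 (lcont0 h) addr0. Qed.

Lemma lcontN E F (f : E -> F) x : lcont f -> f (- x) = - f x.
Proof. by move=> h; rewrite -scaleN1r lcontZ // scaleN1r. Qed.

Lemma lcontB E F (f : E -> F) x y : lcont f -> f (x - y) = f x - f y.
Proof. by move=> h; rewrite lcontD // lcontN. Qed.

Lemma lcont_sumE E F (f : E -> F) I (r : seq I) (P : pred I) (g : I -> E) :
  lcont f -> f (\sum_(i <- r | P i) g i) = \sum_(i <- r | P i) f (g i).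
Proof.
by move=> h; apply: (big_morph f (fun x y => lcontD x y h) (lcont0 h)).
Qed.

Lemma lcont_id E : lcont (fun x : E => x).
Proof. by split => // x; exact: cvg_id. Qed.

Lemma lcont_comp E F G (f : F -> G) (g : E -> F) :
  lcont f -> lcont g -> lcont (fun x => f (g x)).
Proof.
move=> hf hg; split; first by move=> a x y; rewrite hg.1 hf.1.
by move=> x; apply: continuous_comp; [exact: hg.2|exact: hf.2].
Qed.

Lemma lcont_zero E F : lcont (fun _ : E => 0 : F).
Proof.
by split=> [a x y|x]; [rewrite scaler0 addr0|exact: cvg_cst].
Qed.

Lemma lcont_add E F (f g : E -> F) :
  lcont f -> lcont g -> lcont (fun x => f x + g x).
Proof.
move=> hf hg; split; first by move=> a x y; rewrite hf.1 hg.1 scalerDr addrACA.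
by move=> x; apply: cvgD; [exact: hf.2|exact: hg.2].
Qed.

Lemma lcont_scale E F a (f : E -> F) : lcont f -> lcont (fun x => a *: f x).
Proof.
move=> hf; split; first by move=> b x y; rewrite hf.1 scalerDr !scalerA mulrC.
by move=> x; apply: (cvgZl_tmp (k := a)); exact: hf.2.
Qed.

Lemma lcont_opp E F (f : E -> F) : lcont f -> lcont (fun x => - f x).
Proof.
by move=> hf; under eq_fun do rewrite -scaleN1r; exact: lcont_scale.
Qed.

Lemma lcont_mulz E F (a : int) (f : E -> F) :
  lcont f -> lcont (fun x => f x *~ a).
Proof.
move=> hf.
by rewrite (_ : (fun x => _) = fun x => a%:~R *: f x);
   [exact: lcont_scale|apply/funext => x; rewrite scaler_int].
Qed.

Lemma lcont_sum E F I (r : seq I) (P : pred I) (f : I -> E -> F) :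
  (forall i, lcont (f i)) -> lcont (fun x => \sum_(i <- r | P i) f i x).
Proof.
move=> hf; elim: r => [|i r IH].
  by under eq_fun do rewrite big_nil; exact: lcont_zero.
under eq_fun do rewrite big_cons; case: (P i) => //.
exact: lcont_add.
Qed.

End LinearContinuous.

Section TensorLists.
Context {R : realType} {V : completeNormedModType R} (TV : tensorPowers V).
Implicit Types (vs ws : seq V) (n m k : nat).

(** The degree [n] is kept apart from [size vs], so that a degree can be rewritten along an equation
    without touching the list. *)
Definition tlist n vs : TV n := tens TV (fun i : 'I_n => nth 0 vs i).

Lemma tlist_enum n (v : 'I_n -> V) :
  tens TV v = tlist n [seq v i | i <- enum 'I_n].
Proof.
congr tens; apply/funext => i.
by rewrite (nth_map i) ?size_enum_ord // nth_ord_enum.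
Qed.

Lemma homog_id n (x : TV n) : homog x n = x.
Proof. exact: dfwithin. Qed.

Lemma homog_neq n m (x : TV n) : n != m -> homog x m = 0.
Proof. by move=> nm; rewrite /homog dfwithout. Qed.

Lemma homog_tlist n m vs : n = m -> homog (tlist n vs) m = tlist m vs.
Proof. by move=> <-; rewrite homog_id. Qed.

Lemma ler_norm_homog n m (x : TV n) : `|homog x m| <= `|x|.
Proof.
have [<-|nm] := eqVneq n m; first by rewrite homog_id.
by rewrite homog_neq // normr0.
Qed.

Lemma lcont_homog n m : lcont (fun x : TV n => homog x m).
Proof.
have [<-|nm] := eqVneq n m.
  by under eq_fun do rewrite homog_id; exact: lcont_id.
by under eq_fun do rewrite homog_neq //; exact: lcont_zero.
Qed.

Lemma lcont_tmull n m (y : TV m) : lcont (fun x : TV n => tmul x y).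
Proof.
apply: (@bounded_lcont _ _ _ _ `|y|); first exact: tmul_linearl.
by move=> x; rewrite mulrC ler_norm_tmul.
Qed.

Lemma lcont_tmulr n m (x : TV n) : lcont (fun y : TV m => tmul x y).
Proof.
apply: (@bounded_lcont _ _ _ _ `|x|); first exact: tmul_linearr.
by move=> y; rewrite ler_norm_tmul.
Qed.

Lemma lcont_tact n (s : 'S_n) : lcont (tact TV s).
Proof.
apply: (@bounded_lcont _ _ _ _ 1); first exact: linearP.
by move=> y; rewrite norm_tact mul1r.
Qed.

End TensorLists.
Arguments tlist {R V} TV n vs.

(** Follows the structure of the expression. A product has to depend on the variable in only one
    factor, hence the two attempts for [tmul]. *)
Ltac solve_lcont :=
  lazymatch goal with
  | |- lcont (fun x => x) => exact: lcont_id
  | |- lcont (fun x => homog (@?f x) ?k) =>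
      apply: (lcont_comp (lcont_homog _ _ k) (g := f)); solve_lcont
  | |- lcont (fun x => tmul (@?f x) (@?g x)) =>
      first [apply: (lcont_comp (lcont_tmull _ _) (g := f)); solve_lcont
            |apply: (lcont_comp (lcont_tmulr _ _) (g := g)); solve_lcont]
  | |- lcont (fun x => GRing.scale ?a (@?f x)) =>
      apply: (lcont_scale a (f := f)) => /=; solve_lcont
  | |- lcont (fun x => clinear_fun ?h (@?f x)) =>
      apply: (lcont_comp (lcont_clinear h) (g := f)) => /=; solve_lcont
  | |- lcont (tmul _) => exact: lcont_tmulr
  | |- lcont (clinear_fun ?h) => exact: lcont_clinear
  | |- lcont (fun x => ?c) => exact: lcont_zero
  | |- _ => by [|assumption]
  end.

Section TensorLists.
Context {R : realType} {V : completeNormedModType R} (TV : tensorPowers V).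
Implicit Types (vs ws : seq V) (n m k : nat).

(** Where [f] and [g] differ is an open set. If it were nonempty, [tens_dense] would put a linear
    combination of elementary tensors into it, on which they agree. *)
Lemma tlist_ext n (W : normedModType R) (f g : TV n -> W) :
  lcont f -> lcont g ->
  (forall vs, size vs = n -> f (tlist TV n vs) = g (tlist TV n vs)) -> f =1 g.
Proof.
move=> hf hg fg x; apply/eqP; rewrite -subr_eq0; apply/negPn/negP => fgx.
have hfg : lcont (fun x => f x - g x).
  apply: lcont_add => //; exact: lcont_opp.
case: (@tens_dense R V TV n ((fun x => `|f x - g x|) @^-1` [set y | y != 0])).
- by exists x; rewrite /= normr_eq0.
- apply: open_comp; last exact: open_neq.
  by move=> y _; apply: cvg_norm; exact: hfg.2.
move=> y [/= + [r yE]]; rewrite yE.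
rewrite normr_eq0 (lcont_sumE r xpredT _ hfg) big1 ?eqxx // => c _.
rewrite /= (lcontZ _ _ hf) (lcontZ _ _ hg) tlist_enum fg ?subrr //.
by rewrite size_map size_enum_ord.
Qed.

Lemma tmul_tlist n m vs ws : size vs = n ->
  tmul (tlist TV n vs) (tlist TV m ws) = tlist TV (n + m) (vs ++ ws).
Proof.
move=> vsn; rewrite tmul_tens; congr tens; apply/funext => i.
by rewrite /fcat nth_cat vsn; case: splitP => j -> //; rewrite addKn.
Qed.

(** The two sides have different types; reading both in a common degree [k] makes them
    comparable. *)
Lemma tmulA n1 n2 n3 (x : TV n1) (y : TV n2) (z : TV n3) k :
  homog (tmul (tmul x y) z) k = homog (tmul x (tmul y z)) k.
Proof.
move: x; apply: tlist_ext; [solve_lcont|solve_lcont|move=> xs sxs].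
move: y; apply: tlist_ext; [solve_lcont|solve_lcont|move=> ys sys].
move: z; apply: tlist_ext; [solve_lcont|solve_lcont|].
move=> zs szs; rewrite !tmul_tlist ?size_cat ?sxs ?sys ?szs // catA.
have [<-|nk] := eqVneq (n1 + n2 + n3)%N k.
  by rewrite homog_id homog_tlist // addnA.
by rewrite !homog_neq // addnA.
Qed.

Definition tunit : TV 0 := tlist TV 0 [::].

Lemma tunitE (v : 'I_0 -> V) : tens TV v = tunit.
Proof. by congr tens; apply/funext => -[]. Qed.

Lemma norm_tunit : `|tunit| = 1.
Proof. exact: norm_tens0. Qed.

Lemma tmul1l n (x : TV n) : tmul tunit x = x.
Proof.
move: x; apply: tlist_ext; [solve_lcont|solve_lcont|].
by move=> vs svs; rewrite tmul_tlist.
Qed.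

Lemma tmul1r n m (x : TV n) : homog (tmul x tunit) m = homog x m.
Proof.
move: x; apply: tlist_ext; [solve_lcont|solve_lcont|].
move=> vs svs; rewrite tmul_tlist // cats0.
have [<-|nm] := eqVneq n m; first by rewrite homog_tlist ?addn0 // homog_id.
by rewrite !homog_neq // addn0.
Qed.

Lemma homog_tmull n n' m k (x : TV n) (y : TV m) : n = n' ->
  homog (tmul (homog x n') y) k = homog (tmul x y) k.
Proof. by move=> <-; rewrite homog_id. Qed.

Lemma homog_tmulr n m m' k (x : TV n) (y : TV m) : m = m' ->
  homog (tmul x (homog y m')) k = homog (tmul x y) k.
Proof. by move=> <-; rewrite homog_id. Qed.

Lemma tmul0l n m (y : TV m) : tmul (0 : TV n) y = 0.
Proof. exact: (lcont0 (lcont_tmull n y)). Qed.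

Lemma tmul0r n m (x : TV n) : tmul x (0 : TV m) = 0.
Proof. exact: (lcont0 (lcont_tmulr m x)). Qed.

Lemma homog0 n m : homog (0 : TV n) m = 0.
Proof. exact: (lcont0 (lcont_homog TV n m)). Qed.

End TensorLists.
Arguments tunit {R V TV}.

(** * The algebra of tensor series *)

Section TensorSeriesAlgebra.
Context {R : realType} {V : completeNormedModType R} {TV : tensorPowers V}.
Implicit Types (s t r : tseries TV) (n m k : nat).

Lemma tseries_ext s t : (forall n, s n = t n) -> s = t.
Proof. by move=> st; apply: functional_extensionality_dep. Qed.

Lemma tmul_suml n m I (l : seq I) (P : pred I) (x : I -> TV n) (y : TV m) :
  tmul (\sum_(i <- l | P i) x i) y = \sum_(i <- l | P i) tmul (x i) y.
Proof. exact: (lcont_sumE l P x (lcont_tmull n y)). Qed.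

Lemma tmul_sumr n m I (l : seq I) (P : pred I) (y : I -> TV m) (x : TV n) :
  tmul x (\sum_(i <- l | P i) y i) = \sum_(i <- l | P i) tmul x (y i).
Proof. exact: (lcont_sumE l P y (lcont_tmulr m x)). Qed.

Lemma homog_sum n m I (l : seq I) (P : pred I) (x : I -> TV n) :
  homog (\sum_(i <- l | P i) x i) m = \sum_(i <- l | P i) homog (x i) m.
Proof. exact: (lcont_sumE l P x (lcont_homog TV n m)). Qed.

Lemma homog_sub n m (x y : TV n) : homog (x - y) m = homog x m - homog y m.
Proof. exact: (lcontB x y (lcont_homog TV n m)). Qed.

Lemma tmulBl n m (x x' : TV n) (y : TV m) :
  tmul (x - x') y = tmul x y - tmul x' y.
Proof. exact: (lcontB x x' (lcont_tmull n y)). Qed.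

Lemma tmulBr n m (x : TV n) (y y' : TV m) :
  tmul x (y - y') = tmul x y - tmul x y'.
Proof. exact: (lcontB y y' (lcont_tmulr m x)). Qed.

(** A factor of degree above [k] contributes nothing in degree [k], so a bound on [k] suffices
    whatever [n] is. *)
Lemma sum_homog_tmull n m k M (x : TV n) (y : TV m) : (k < M)%N ->
  \sum_(i < M) homog (tmul (homog x i) y) k = homog (tmul x y) k.
Proof.
move=> kM; have [nM|Mn] := ltnP n M.
  rewrite (bigD1 (Ordinal nM)) //= homog_id big1 ?addr0 // => i ni.
  rewrite (@homog_neq _ _ _ n i) ?tmul0l ?homog0 //; apply: contra ni => /eqP ni.
  exact/eqP/val_inj.
rewrite homog_neq; last first.
  by rewrite gtn_eqF // (leq_trans kM) // (leq_trans Mn) // leq_addr.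
rewrite big1 // => i _; rewrite (@homog_neq _ _ _ n i) ?tmul0l ?homog0 //.
by rewrite gtn_eqF // (leq_trans (ltn_ord i)).
Qed.

Lemma sum_homog_tmulr n m k M (x : TV n) (y : TV m) : (k < M)%N ->
  \sum_(i < M) homog (tmul x (homog y i)) k = homog (tmul x y) k.
Proof.
move=> kM; have [mM|Mm] := ltnP m M.
  rewrite (bigD1 (Ordinal mM)) //= homog_id big1 ?addr0 // => i mi.
  rewrite (@homog_neq _ _ _ m i) ?tmul0r ?homog0 //; apply: contra mi => /eqP mi.
  exact/eqP/val_inj.
rewrite homog_neq; last first.
  by rewrite gtn_eqF // (leq_trans kM) // (leq_trans Mm) // leq_addl.
rewrite big1 // => i _; rewrite (@homog_neq _ _ _ m i) ?tmul0r ?homog0 //.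
by rewrite gtn_eqF // (leq_trans (ltn_ord i)).
Qed.

(** Trades the dependent index [n - i] for a second free index, since [homog] kills all terms of the
    wrong total degree. In this form associativity is an exchange of sums. *)
Lemma tsmulE s t n M : (n < M)%N ->
  tsmul s t n = \sum_(i < M) \sum_(j < M) homog (tmul (s i) (t j)) n.
Proof.
move=> nM; rewrite /tsmul.
rewrite (big_ord_widen M (fun i => homog (tmul (s i) (t (n - i)%N)) n)) //.
rewrite big_mkcond; apply: eq_bigr => i _; case: ifP => [|/negbT].
  rewrite ltnS => ni.
  have niM : (n - i < M)%N by apply: leq_ltn_trans nM; exact: leq_subr.
  rewrite (bigD1 (Ordinal niM)) //= big1 ?addr0 // => j jn.
  rewrite homog_neq //; apply: contra jn => /eqP jn; apply/eqP/val_inj => /=.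
  by rewrite -jn addKn.
rewrite -leqNgt => ni; rewrite big1 // => j _.
by rewrite homog_neq // gtn_eqF // (leq_trans ni) // leq_addr.
Qed.

Lemma tsmulA s t r : tsmul (tsmul s t) r = tsmul s (tsmul t r).
Proof.
apply: tseries_ext => n.
transitivity (\sum_(a < n.+1) \sum_(b < n.+1) \sum_(k < n.+1)
    homog (tmul (tmul (s a) (t b)) (r k)) n).
  rewrite (tsmulE _ _ (ltnSn n)).
  under eq_bigr => i _.
    under eq_bigr => k _.
      rewrite (tsmulE s t (ltn_ord i)) tmul_suml homog_sum.
      under eq_bigr do rewrite tmul_suml homog_sum.
      over.
    over.
  rewrite /= exchange_big /=.
  under eq_bigr => k _ do rewrite exchange_big /=.
  rewrite exchange_big /=; apply: eq_bigr => a _.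
  under eq_bigr => k _ do rewrite exchange_big /=.
  rewrite exchange_big /=; apply: eq_bigr => b _; apply: eq_bigr => k _.
  exact: sum_homog_tmull.
rewrite (tsmulE _ _ (ltnSn n)); apply: eq_bigr => a _.
under [RHS]eq_bigr => j _.
  rewrite (tsmulE t r (ltn_ord j)) tmul_sumr homog_sum.
  under eq_bigr do rewrite tmul_sumr homog_sum.
  over.
rewrite /= [RHS]exchange_big /=; apply: eq_bigr => b _.
rewrite [RHS]exchange_big /=; apply: eq_bigr => k _.
by rewrite sum_homog_tmulr // tmulA.
Qed.

Lemma tsone0 : tsone TV 0%N = tunit.
Proof. by rewrite /tsone homog_id tunitE. Qed.

Lemma tsoneS n : tsone TV n.+1 = 0.
Proof. by rewrite /tsone homog_neq. Qed.

Lemma tsmul1l s : tsmul (tsone TV) s = s.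
Proof.
apply: tseries_ext => n; rewrite /tsmul big_ord_recl /= big1 ?addr0.
  by rewrite tsone0 tmul1l subn0 homog_id.
by move=> i _; rewrite tsoneS tmul0l homog0.
Qed.

Lemma tsmul1r s : tsmul s (tsone TV) = s.
Proof.
apply: tseries_ext => n; rewrite /tsmul big_ord_recr /= big1 ?add0r.
  by rewrite subnn tsone0 tmul1r homog_id.
move=> i _; case E : (n - i)%N => [|k].
  by move/eqP : E; rewrite subn_eq0 leqNgt ltn_ord.
by rewrite tsoneS tmul0r homog0.
Qed.

Lemma tsmul0E s t : tsmul s t 0%N = tmul (s 0%N) (t 0%N).
Proof. by rewrite /tsmul big_ord1 homog_id. Qed.

Lemma tsmul1E s t : s 0%N = tunit -> t 0%N = tunit ->
  tsmul s t 1%N = s 1%N + t 1%N.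
Proof.
move=> s0 t0; rewrite /tsmul big_ord_recl big_ord1 /= s0 tmul1l homog_id.
by rewrite subnn t0 tmul1r homog_id addrC.
Qed.

Lemma tsmul_one0 s t : s 0%N = tunit -> t 0%N = tunit -> tsmul s t 0%N = tunit.
Proof. by move=> s0 t0; rewrite tsmul0E s0 t0 tmul1l. Qed.

Lemma norm_tsmul s t n :
  `|tsmul s t n| <= \sum_(i < n.+1) `|s i| * `|t (n - i)%N|.
Proof.
apply: le_trans (ler_norm_sum _ _ _) _; apply: ler_sum => i _.
exact: le_trans (ler_norm_homog _ _) (ler_norm_tmul _ _).
Qed.

Lemma eq_tsmul s s' t t' n :
  (forall i, (i <= n)%N -> s i = s' i) ->
  (forall i, (i <= n)%N -> t i = t' i) -> tsmul s t n = tsmul s' t' n.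
Proof.
move=> ss tt; apply: eq_bigr => i _.
by rewrite ss ?tt ?leq_subr // -ltnS.
Qed.

(* The inverse solves [t = 1 - (s - 1) t] degree by degree. *)
Definition tsinv_step s t : tseries TV := fun n =>
  tsone TV n - \sum_(i < n) homog (tmul (s i.+1) (t (n - i.+1)%N)) n.

Lemma tsinv_step_eq s t t' n : (forall i, (i < n)%N -> t i = t' i) ->
  tsinv_step s t n = tsinv_step s t' n.
Proof.
move=> tt; congr (_ - _); apply: eq_bigr => i _; rewrite tt //.
by rewrite ltn_subrL /= (leq_ltn_trans _ (ltn_ord i)).
Qed.

Lemma tsinv_exists s : s 0%N = tunit ->
  exists t, [/\ tsmul s t = tsone TV, tsmul t s = tsone TV & t 0%N = tunit].
Proof.
have rinv r : r 0%N = tunit -> exists t, tsmul r t = tsone TV /\ t 0%N = tunit.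
  (* Degree [n] of the iterates is stable from the iterate [n.+1] on, so the diagonal [t] below is a
     fixed point of the step. *)
  move=> r0; pose u k := iter k (tsinv_step r) (tsone TV).
  have stab n k : (n < k)%N -> u k n = u n.+1 n.
    elim/ltn_ind: n k => n IH [//|k] nk /=; apply: tsinv_step_eq => i iN.
    by rewrite (IH _ iN k) ?(IH _ iN n) // (leq_trans iN).
  pose t : tseries TV := fun n => u n.+1 n.
  have tE n : t n = tsinv_step r t n.
    by rewrite {1}/t /=; apply: tsinv_step_eq => i iN; rewrite stab.
  exists t; split; last by rewrite tE /tsinv_step big_ord0 subr0 tsone0.
  apply: tseries_ext => n; rewrite /tsmul big_ord_recl /= r0 tmul1l subn0.
  by rewrite homog_id tE /tsinv_step; exact: subrK.
(* A right inverse that itself has a right inverse is two-sided. *)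
move=> s0; have [t [st t0]] := rinv _ s0; have [r [tr r0]] := rinv _ t0.
exists t; split=> //; rewrite -[LHS]tsmul1r -{1}tr.
by rewrite tsmulA -(tsmulA s) st tsmul1l tr.
Qed.

Lemma tsinvP s : s 0%N = tunit ->
  tsmul s (tsinv s) = tsone TV /\ tsmul (tsinv s) s = tsone TV.
Proof.
move=> /tsinv_exists[t [st ts _]].
by apply: (xgetPex (tsone TV)
  (P := [set t | tsmul s t = tsone TV /\ tsmul t s = tsone TV])); exists t.
Qed.

Lemma tsinv_uniq s t : s 0%N = tunit -> tsmul s t = tsone TV -> tsinv s = t.
Proof.
move=> /tsinvP[_ h] st.
by rewrite -[LHS]tsmul1r -st -tsmulA h tsmul1l.
Qed.

Lemma tsinv_one0 s : s 0%N = tunit -> tsinv s 0%N = tunit.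
Proof.
by move=> s0; have [t [st _ t0]] := tsinv_exists s0; rewrite (tsinv_uniq s0 st).
Qed.

End TensorSeriesAlgebra.

(** * Words and shuffles *)

Section Words.
Implicit Types (n m : nat) (wl : seq (seq nat)).

(** Entries of [wl] that are not words of a permutation are silently dropped, hence the [perm_eq]
    hypotheses below. *)
Definition zwords n wl : zS n := [ffun t => (count_mem (pword t) wl)%:Z].

Lemma size_pword n (s : 'S_n) : size (pword s) = n.
Proof. by rewrite size_map size_enum_ord. Qed.

Lemma nth_pword n (s : 'S_n) (i : 'I_n) : nth 0%N (pword s) i = s i.
Proof. by rewrite /pword (nth_map i) ?size_enum_ord // nth_ord_enum. Qed.

Lemma pword_inj n : injective (@pword n).
Proof.
move=> s t st; apply/permP => i; apply/val_inj.
by rewrite /= -!nth_pword st.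
Qed.

Lemma pword1 n : pword (1%g : 'S_n) = iota 0 n.
Proof.
by rewrite -val_enum_ord; apply: eq_map => i; rewrite perm1.
Qed.

Lemma pword_surj n (w : seq nat) : perm_eq w (iota 0 n) -> exists s : 'S_n, w = pword s.
Proof.
move=> wP; have sw : size w = n by rewrite (perm_size wP) size_iota.
have uw : uniq w by rewrite (perm_uniq wP) iota_uniq.
have wn (i : 'I_n) : (nth 0%N w i < n)%N.
  have: nth 0%N w i \in w by rewrite mem_nth ?sw.
  by rewrite (perm_mem wP) mem_iota.
have inj : injective (fun i => Ordinal (wn i)).
  move=> i j [/eqP]; rewrite nth_uniq ?sw // => /eqP ij; exact/val_inj.
exists (perm inj); apply: (@eq_from_nth _ 0%N) => [|i].
  by rewrite size_map size_enum_ord.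
rewrite sw => iN; rewrite (nth_map (Ordinal iN)) ?size_enum_ord //.
by rewrite permE /= nth_enum_ord.
Qed.

Lemma sum_pword (W : zmodType) n wl (F : seq nat -> W) :
  all (perm_eq^~ (iota 0 n)) wl ->
  \sum_(s : 'S_n) F (pword s) *~ zwords n wl s = \sum_(w <- wl) F w.
Proof.
under eq_bigr do rewrite ffunE -pmulrn.
elim: wl => [|w wl IH] /=; first by rewrite big_nil big1.
case/andP => /pword_surj[s0 ->] /IH; rewrite big_cons => <-.
rewrite -[X in X + _](_ : \sum_(s : 'S_n) F (pword s) *+ (s == s0) = _).
  by rewrite -big_split /=; apply: eq_bigr => s _;
     rewrite mulrnDr (inj_eq (@pword_inj n)) eq_sym.
by rewrite (bigD1 s0) //= eqxx mulr1n big1 ?addr0 // => i /negbTE ->.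
Qed.

Lemma zperm1E n : zperm (1%g : 'S_n) = zwords n [:: iota 0 n].
Proof.
apply/ffunP => t; rewrite !ffunE /= addn0 -pword1 (inj_eq (@pword_inj n)).
by rewrite eq_sym natz.
Qed.

(** An identity on the right is enough: [m_succ] is nested to the left and all its arguments are
    identities. *)
Lemma zbilin_zwords sh n m wl : all (perm_eq^~ (iota 0 n)) wl ->
  zbilin sh (zwords n wl) (zperm (1%g : 'S_m)) =
  zwords (n + m) (flatten [seq sh u (iota n m) | u <- wl]).
Proof.
move=> wlP; apply/ffunP => t; rewrite !ffunE.
transitivity (\sum_(s : 'S_n) (count_mem (pword t) (sh (pword s) (iota n m)))%:Z
    *~ zwords n wl s).
  apply: eq_bigr => s _; rewrite (bigD1 1%g) //= big1 ?addr0; last first.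
    by move=> r /negbTE r1; rewrite [zperm _ _]ffunE r1 mulr0 mul0r.
  rewrite [zperm _ _]ffunE eqxx mulr1 pword1 -iotaDl addn0.
  by rewrite mulrC -mulrzr intz.
rewrite (sum_pword (fun w => (count_mem (pword t) (sh w (iota n m)))%:Z)) //.
elim: wl {wlP} => [|w wl IH] /=; first by rewrite big_nil.
by rewrite big_cons count_cat PoszD IH.
Qed.

Lemma shuffles_nil (T : Type) (u : seq T) : shuffles u [::] = [:: u].
Proof. by case: u. Qed.

Lemma shuffles_perm (T : eqType) (u v : seq T) :
  all (perm_eq^~ (u ++ v)) (shuffles u v).
Proof.
elim: u v => [|a u IHu] v /=; first by rewrite perm_refl.
elim: v => [|b v IHv] /=; first by rewrite cats0 perm_refl.
rewrite all_cat !all_map; apply/andP; split.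
  by apply: sub_all (IHu (b :: v)) => w wP /=; rewrite perm_cons.
apply: sub_all IHv => w wP /=.
rewrite -(cat1s b v) -cat_cons perm_sym perm_catCA /= perm_cons perm_sym.
exact: wP.
Qed.

Lemma succ_shuffles_rcons (T : Type) (u v : seq T) x :
  succ_shuffles u (rcons v x) = [seq rcons w x | w <- shuffles u v].
Proof.
case: v => [|b v] //=.
by rewrite belast_rcons last_rcons.
Qed.

Lemma iota_rcons n m : iota n m.+1 = rcons (iota n m) (n + m)%N.
Proof. by rewrite -addn1 iotaD cats1. Qed.

(** The unshuffle coproduct, dual to [shuffles]: all splittings of a list into two complementary
    subsequences, with multiplicity. *)
Fixpoint desh (T : Type) (s : seq T) : seq (seq T * seq T) :=
  if s is x :: s' then
    [seq (x :: p.1, p.2) | p <- desh s'] ++ [seq (p.1, x :: p.2) | p <- desh s']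
  else [:: ([::], [::])].

(** When a shuffle is written above [vs], the places filled by [u] and those filled by [v] cut [vs]
    into two subsequences, and each splitting of the right sizes arises once. The two sides list the
    same pairs in different orders, so [F] has to ignore the order. *)
Lemma shuffles_desh (K T : eqType) (W : nmodType) (F : seq (K * T) -> W)
    (u v : seq K) (vs : seq T) :
  (forall al al', perm_eq (unzip1 al) (u ++ v) -> perm_eq al al' ->
    F al = F al') ->
  size vs = (size u + size v)%N ->
  \sum_(w <- shuffles u v) F (zip w vs) =
  \sum_(p <- desh vs | (size p.1 == size u) && (size p.2 == size v))
    F (zip u p.1 ++ zip v p.2).
Proof.
elim: vs u v F => [|x vs IH] u v F FP; rewrite /=.
  by case: u FP => //; case: v => // _ _; rewrite !big_cons !big_nil /=.
rewrite big_cat !big_map /=; case: u FP => [|a u]; case: v => [|b v] //= FP.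
- move=> [sv]; rewrite big_seq1 big1 ?add0r //.
  have := IH [::] v (fun al => F ((b, x) :: al)); rewrite big_seq1 => -> //.
    by apply: eq_big => -[[|? ?] [|? ?]].
  move=> al al' alP al'P; apply: FP; last by rewrite perm_cons.
  by rewrite /= perm_cons.
- rewrite addn0 => -[sv]; rewrite big_seq1 addrC big1 ?add0r; last first.
    by move=> p; rewrite andbF.
  have := IH u [::] (fun al => F ((a, x) :: al)).
  rewrite shuffles_nil big_seq1 addn0 => -> //.
  move=> al al' alP al'P; apply: FP; last by rewrite perm_cons.
  by rewrite /= perm_cons.
move=> [svs]; rewrite big_cat !big_map /=; congr (_ + _).
  have /= -> // := IH u (b :: v) (fun al => F ((a, x) :: al)).
  move=> al al' alP al'P; apply: FP; last by rewrite perm_cons.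
  by rewrite /= perm_cons.
have /= -> // := IH (a :: u) v (fun al => F ((b, x) :: al)); first last.
- by rewrite svs addnS addSn.
- move=> al al' alP al'P; apply: FP; last by rewrite perm_cons.
  rewrite /= -(cat1s b v) -cat_cons perm_sym perm_catCA /= perm_cons perm_sym.
  exact: alP.
(* The pair [(b, x)] taken off first has to move behind the pairs that belong to [a :: u]. *)
have mid (T' : eqType) (z : T') (s1 s2 : seq T') :
    perm_eq (z :: s1 ++ s2) (s1 ++ z :: s2).
  exact: (permEl (perm_catCA [:: z] s1 s2)).
apply: eq_bigr => -[[|y A] B] /andP[] //= /eqP[s1] /eqP s2.
apply: FP; last exact: (mid _ (b, x) ((a, y) :: zip u A)).
rewrite /= /unzip1 map_cat -!/(unzip1 _) !unzip1_zip ?s1 ?s2 //.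
exact: (mid _ b (a :: u)).
Qed.

End Words.

(** * Inverse permutations acting on lists of vectors *)

Section Arrange.
Context {V : zmodType}.
Implicit Types (n m : nat) (w : seq nat) (vs ws : seq V).

(* The action of [sigma^-1] on a tensor of degree [n], [w] being the word of
   [sigma]. *)
Definition arrange n w vs : seq V := [seq nth 0 vs (index i w) | i <- iota 0 n].

Lemma size_arrange n w vs : size (arrange n w vs) = n.
Proof. by rewrite size_map size_iota. Qed.

Lemma arrange_cat n m u vs ws :
  perm_eq u (iota 0 n) -> size vs = n -> size ws = m ->
  arrange (n + m) (u ++ iota n m) (vs ++ ws) = arrange n u vs ++ ws.
Proof.
move=> uP svs sws; have su : size u = n by rewrite (perm_size uP) size_iota.
rewrite /arrange iotaD map_cat; congr cat.
  apply/eq_in_map => i iN.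
  by rewrite index_cat (perm_mem uP) iN nth_cat svs -su index_mem (perm_mem uP) iN.
apply: (@eq_from_nth _ 0) => [|i]; first by rewrite size_map size_iota.
rewrite size_map size_iota => im; rewrite (nth_map 0%N) ?size_iota // nth_iota //.
rewrite index_cat (perm_mem uP) mem_iota leq0n add0n ltnNge leq_addr /= su.
rewrite -[X in index X _](nth_iota 0%N n im) index_uniq ?size_iota ?iota_uniq //.
by rewrite nth_cat svs ltnNge leq_addr /= addKn.
Qed.

(** [arrange] read off an association list from letters to vectors. For distinct letters the value
    does not depend on the order of the pairs, as [shuffles_desh] demands. *)
Let lookup (al : seq (nat * V)) i := nth 0 (unzip2 al) (index i (unzip1 al)).

Let lookup_in al i x : uniq (unzip1 al) -> (i, x) \in al -> lookup al i = x.
Proof.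
rewrite /lookup; elim: al => [//|[j y] al IH] /= /andP[jal ual].
rewrite inE => /orP[/eqP[-> ->]|ixal]; first by rewrite eqxx.
case: eqP => [ji|_]; last exact: IH.
by case/negP: jal; rewrite ji; apply/mapP; exists (i, x).
Qed.

Let lookup_perm al al' i :
  uniq (unzip1 al) -> perm_eq al al' -> lookup al i = lookup al' i.
Proof.
move=> ual alP; have ual' : uniq (unzip1 al').
  by rewrite -(perm_uniq (perm_map fst alP)).
have [/mapP[[j x] jal /= ->]|ial] := boolP (i \in unzip1 al).
  by rewrite (lookup_in ual jal) (@lookup_in al' j x ual') // -(perm_mem alP).
have ial' : i \notin unzip1 al' by rewrite -(perm_mem (perm_map fst alP)).
by rewrite /lookup !nth_default // memNindex // size_map size_map.
Qed.

(** The second word is increasing, so the vectors that fall to it keep their order, while those that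
    fall to [u] are rearranged by [u]. *)
Lemma sum_shuffles_arrange (W : nmodType) (h : seq V -> W) n m u vs :
  perm_eq u (iota 0 n) -> size vs = (n + m)%N ->
  \sum_(w <- shuffles u (iota n m)) h (arrange (n + m) w vs) =
  \sum_(p <- desh vs | (size p.1 == n) && (size p.2 == m))
    h (arrange n u p.1 ++ p.2).
Proof.
move=> uP svs; have su : size u = n by rewrite (perm_size uP) size_iota.
have uv : perm_eq (u ++ iota n m) (iota 0 (n + m)).
  by rewrite iotaD perm_cat2r.
pose F al := h [seq lookup al i | i <- iota 0 (n + m)].
transitivity (\sum_(w <- shuffles u (iota n m)) F (zip w vs)).
  rewrite big_seq [RHS]big_seq; apply: eq_bigr => w wS; congr h.
  have /allP/(_ w wS) wP := shuffles_perm u (iota n m).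
  have sw : size w = size vs.
    by rewrite (perm_size wP) size_cat size_iota su svs.
  by apply: eq_map => i; rewrite /lookup unzip1_zip ?unzip2_zip ?sw.
rewrite (shuffles_desh (F := F)) ?su ?size_iota //; last first.
  move=> al al' alP al'P; congr h; apply: eq_map => i; apply: lookup_perm => //.
  by rewrite (perm_uniq alP) (perm_uniq uv) iota_uniq.
apply: eq_bigr => p /andP[/eqP s1 /eqP s2].
rewrite -(arrange_cat uP s1 s2); congr h; apply: eq_map => i.
rewrite /lookup /unzip1 /unzip2 !map_cat -!/(unzip1 _) -!/(unzip2 _).
by rewrite !unzip1_zip ?unzip2_zip ?su ?size_iota ?s1 ?s2.
Qed.

Lemma arrange_id n vs : size vs = n -> arrange n (iota 0 n) vs = vs.
Proof.
move=> svs; apply: (@eq_from_nth _ 0) => [|i]; first by rewrite size_arrange.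
rewrite size_arrange => iN; rewrite (nth_map 0%N) ?size_iota // nth_iota //.
by rewrite add0n -[X in index X _](nth_iota 0%N 0 iN) index_uniq ?size_iota
  ?iota_uniq.
Qed.

Lemma arrange_rcons n w vs v : perm_eq w (iota 0 n) -> size vs = n ->
  arrange n.+1 (rcons w n) (rcons vs v) = rcons (arrange n w vs) v.
Proof.
move=> wP svs; have sw : size w = n by rewrite (perm_size wP) size_iota.
rewrite /arrange iota_rcons map_rcons add0n -cats1 -[rcons w n]cats1.
rewrite -[in RHS]cats1; congr cat.
  apply/eq_in_map => i iN; rewrite index_cat (perm_mem wP) iN nth_rcons svs.
  by rewrite -sw index_mem (perm_mem wP) iN.
rewrite index_cat (perm_mem wP) mem_iota ?add0n ltnn /= eqxx addn0 nth_rcons sw svs.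
by rewrite ltnn eqxx.
Qed.

(** In a half-shuffle the last letter is fixed, so [v] always ends the second part and only the
    vectors before it are distributed. *)
Lemma sum_succ_shuffles_arrange (W : nmodType) (h : seq V -> W) n m u vs v :
  perm_eq u (iota 0 n) -> size vs = (n + m)%N ->
  \sum_(w <- succ_shuffles u (iota n m.+1))
    h (arrange (n + m.+1) w (rcons vs v)) =
  \sum_(p <- desh vs | (size p.1 == n) && (size p.2 == m))
    h (arrange n u p.1 ++ rcons p.2 v).
Proof.
move=> uP svs; rewrite iota_rcons succ_shuffles_rcons big_map addnS.
under [RHS]eq_bigr do rewrite -rcons_cat.
rewrite -(sum_shuffles_arrange (fun vs => h (rcons vs v)) uP svs).
rewrite big_seq [RHS]big_seq; apply: eq_bigr => w wS; rewrite arrange_rcons //.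
have /allP/(_ w wS) wP := shuffles_perm u (iota n m).
by rewrite iotaD (perm_trans wP) // perm_cat2r.
Qed.

End Arrange.

(** * The words of the iterated half-shuffle *)

Section SuccWords.

(** Folding from the empty word, not from the first block, makes all steps alike; the first
    component counts the letters used so far. *)
Definition succ_words (ks : seq nat) : nat * seq (seq nat) :=
  foldl (fun st k => ((st.1 + k)%N,
           flatten [seq succ_shuffles u (iota st.1 k) | u <- st.2]))
    (0%N, [:: [::]]) ks.

Lemma succ_words_rcons ks k : succ_words (rcons ks k) =
  (((succ_words ks).1 + k)%N,
   flatten [seq succ_shuffles u (iota (succ_words ks).1 k)
           | u <- (succ_words ks).2]).
Proof. by rewrite /succ_words foldl_rcons. Qed.

Lemma succ_words1 ks : (succ_words ks).1 = sumn ks.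
Proof.
elim/last_ind: ks => [//|ks k IH].
by rewrite succ_words_rcons /= IH sumn_rcons.
Qed.

Lemma succ_words_perm ks : all (leq 1) ks ->
  all (perm_eq^~ (iota 0 (succ_words ks).1)) (succ_words ks).2.
Proof.
elim/last_ind: ks => [//|ks k IH]; rewrite all_rcons => /andP[k0 /IH {}IH].
rewrite succ_words_rcons /=; apply/allP => w /flatten_mapP[u uS].
case: k k0 => // k _; rewrite iota_rcons succ_shuffles_rcons => /mapP[w' w'S ->].
have /allP/(_ w' w'S) w'P := shuffles_perm u (iota (succ_words ks).1 k).
have /allP/(_ u uS) uP := IH.
rewrite addnS iota_rcons add0n -!cats1 perm_cat2r iotaD (perm_trans w'P) //.
by rewrite perm_cat2r.
Qed.

Lemma msucc_succ_words ks : all (leq 1) ks -> ks != [::] ->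
  msucc [seq Tagged zS (zperm (1%g : 'S_k)) | k <- ks] =
  Tagged zS (zwords (succ_words ks).1 (succ_words ks).2).
Proof.
elim/last_ind: ks => [//|ks k IH]; rewrite all_rcons => /andP[k0 ksP] _.
case: ks IH ksP => [_ _|k' ks IH ksP].
  rewrite /succ_words /= zperm1E cats0; case: k k0 => // k _.
  by rewrite add0n iota_rcons succ_shuffles_rcons /= add0n.
rewrite map_rcons rcons_cons [LHS]/= foldl_rcons.
have := IH ksP isT => /= ->.
rewrite -rcons_cons succ_words_rcons /=; congr existT.
exact: zbilin_zwords (succ_words_perm ksP).
Qed.

End SuccWords.

(** * The lift on elementary tensors *)

Lemma split_blocks (T : Type) l (K : 'I_l -> nat) (vs : seq T) :
  size vs = (\sum_(i < l) K i)%N -> exists2 b : 'I_l -> seq T,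
    forall i, size (b i) = K i & vs = flatten [seq b i | i <- enum 'I_l].
Proof.
move=> svs; pose sh := [seq K i | i <- enum 'I_l].
have ssh : sumn sh = size vs by rewrite svs sumnE big_map big_enum.
exists (fun i => nth [::] (reshape sh vs) i) => [i|].
  have isz : (i < size sh)%N by rewrite size_map size_enum_ord.
  rewrite -[LHS](nth_map [::] 0%N size) ?size_reshape //.
  rewrite -/(shape _) reshapeKl ?ssh // (nth_map i) ?size_enum_ord //.
  by rewrite nth_ord_enum.
rewrite -[LHS](@reshapeKr _ sh) ?ssh //; congr flatten.
apply: (@eq_from_nth _ [::]) => [|i]; first by rewrite size_reshape !size_map.
rewrite size_reshape size_map size_enum_ord => il.
by rewrite (nth_map (Ordinal il)) ?size_enum_ord // nth_enum_ord.
Qed.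

Section HatOperator.
Context {R : realType} {V : completeNormedModType R} {TV : tensorPowers V}.
Implicit Types (n m k : nat) (vs ws : seq V).

(** [hat] as a map of a single component, so that density arguments apply to it. *)
Definition hat_op n (a : zS n) (x : TV n) : TV n :=
  \sum_(sigma : 'S_n) tact TV sigma^-1%g x *~ a sigma.

Lemma lcont_hat_op n (a : zS n) : lcont (hat_op a).
Proof.
apply: (lcont_sum _ xpredT (f := fun s x => tact TV s^-1%g x *~ a s)) => s.
exact: lcont_mulz (lcont_tact TV _).
Qed.

Lemma norm_hat_op n (a : zS n) (x : TV n) :
  `|hat_op a x| <= (\sum_(s : 'S_n) `|(a s)%:~R : R|) * `|x|.
Proof.
apply: le_trans (ler_norm_sum _ _ _) _; rewrite mulr_suml; apply: ler_sum => s _.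
by rewrite -scaler_int normrZ norm_tact.
Qed.

Lemma tact_tlist n (s : 'S_n) vs :
  tact TV s (tlist TV n vs) = tlist TV n [seq nth 0 vs i | i <- pword s].
Proof.
rewrite tact_tens; congr tens; apply/funext => i.
by rewrite (nth_map 0%N) ?size_pword // nth_pword.
Qed.

Lemma exists_permutation n (w : seq nat) : perm_eq w (iota 0 n) ->
  exists2 P : TV n -> TV n, lcont P &
    forall vs, P (tlist TV n vs) = tlist TV n [seq nth 0 vs i | i <- w].
Proof.
move=> /pword_surj[s ->]; exists (tact TV s); first exact: lcont_tact.
by move=> vs; rewrite tact_tlist.
Qed.

Lemma hat_op_zwords n wl vs : all (perm_eq^~ (iota 0 n)) wl ->
  hat_op (zwords n wl) (tlist TV n vs) =
  \sum_(w <- wl) tlist TV n (arrange n w vs).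
Proof.
move=> wlP; rewrite -(sum_pword (n := n) (fun w => tlist TV n (arrange n w vs))) //.
apply: eq_bigr => s _; congr (_ *~ _); rewrite tact_tens; congr tens.
apply/funext => i; rewrite (nth_map 0%N) ?size_iota // nth_iota // add0n.
congr (nth 0 vs _); rewrite -{2}(permKV s i).
rewrite (index_map (f := fun j : 'I_n => s j : nat)); first by rewrite index_enum_ord.
by move=> x y xy; apply: (@perm_inj _ s); exact: val_inj.
Qed.

Lemma hat_op_star n m vs : size vs = (n + m)%N ->
  hat_op (zstar (zperm (1%g : 'S_n)) (zperm (1%g : 'S_m)))
    (tlist TV (n + m) vs) =
  \sum_(p <- desh vs | (size p.1 == n) && (size p.2 == m))
    tlist TV (n + m) (p.1 ++ p.2).
Proof.
move=> svs; rewrite /zstar zperm1E zbilin_zwords ?hat_op_zwords /= ?perm_refl //.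
- rewrite cats0.
  rewrite (sum_shuffles_arrange (tlist TV (n + m))) ?perm_refl //.
  apply: eq_bigr => p /andP[/eqP s1 _]; rewrite arrange_id //.
- rewrite cats0; apply: sub_all (shuffles_perm _ _) => w wP.
  by rewrite iotaD.
Qed.

Lemma grouplikeE (a : tseries TV) n m : grouplike a ->
  hat_op (zstar (zperm (1%g : 'S_n)) (zperm (1%g : 'S_m))) (a (n + m)%N) =
  tmul (a n) (a m).
Proof. by case=> _ ->. Qed.

(** Allows results about a group-like factor to be specialised to the trivial factor, as in
    [lift_series_tslist]. *)
Lemma grouplike_tsone : grouplike (tsone TV).
Proof.
split=> // n m; rewrite /hat -/(hat_op _ _).
have [[-> ->]|nm] : (n = 0 /\ m = 0)%N \/ (0 < n + m)%N by case: n; case: m; auto.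
  by rewrite tsone0 hat_op_star //= big_cons big_nil /= addr0 tmul1l.
have z k : (0 < k)%N -> tsone TV k = 0 by case: k => // k _; rewrite tsoneS.
rewrite (z _ nm) (lcont0 (lcont_hat_op _)).
move: nm; rewrite addn_gt0 => /orP[/z->|/z->]; first by rewrite tmul0l.
by rewrite tmul0r.
Qed.

End HatOperator.

Section TensorSeriesLists.
Context {R : realType} {V : completeNormedModType R} (TV : tensorPowers V).
Implicit Types (n m k : nat) (vs ws : seq V).

Definition tslist vs : tseries TV := homog (tlist TV (size vs) vs).

Lemma tslist_nil : tslist [::] = tsone TV.
Proof. by congr homog; rewrite tunitE. Qed.

Lemma tslistE n vs : size vs = n -> homog (tlist TV n vs) = tslist vs.
Proof. by move=> <-. Qed.

Lemma tsmul_homog n m (x : TV n) (y : TV m) :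
  tsmul (homog x) (homog y) = homog (tmul x y).
Proof.
apply: tseries_ext => k; rewrite (tsmulE _ _ (ltnSn k)).
under eq_bigr do rewrite sum_homog_tmulr //.
exact: sum_homog_tmull.
Qed.

Lemma tsmul_homogr (a : tseries TV) m (z : TV m) k : tsmul a (homog z) k =
  if (m <= k)%N then homog (tmul (a (k - m)%N) z) k else 0.
Proof.
rewrite (tsmulE _ _ (ltnSn k)); under eq_bigr do rewrite sum_homog_tmulr //.
case: ifP => [mk|/negbT mk]; last first.
  apply: big1 => i _; rewrite homog_neq //; apply: contraNneq mk => <-.
  exact: leq_addl.
have kmk : (k - m < k.+1)%N by rewrite ltnS leq_subr.
rewrite (bigD1 (Ordinal kmk)) //= big1 ?addr0 // => i ikm.
rewrite homog_neq //; apply: contra ikm => /eqP ikm; apply/eqP/val_inj => /=.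
by rewrite -[LHS](addnK m) ikm.
Qed.

Lemma lcont_tsmul_homog (a : tseries TV) m k :
  lcont (fun z : TV m => tsmul a (homog z) k).
Proof.
under eq_fun do rewrite tsmul_homogr.
by case: (m <= k)%N; solve_lcont.
Qed.

Lemma tsmul_sum_homog (a b : tseries TV) k M : (k < M)%N ->
  tsmul a b k = \sum_(i < M) tsmul a (homog (b i)) k.
Proof.
move=> kM; rewrite (tsmulE _ _ kM) exchange_big; apply: eq_bigr => j _ /=.
rewrite (tsmulE _ _ kM).
by apply: eq_bigr => i _; rewrite sum_homog_tmulr.
Qed.

Lemma big_tsmul_tlist I (r : seq I) (K : I -> nat) (b : I -> seq V) :
  (forall i, size (b i) = K i) ->
  \big[@tsmul _ _ TV/tsone TV]_(i <- r) homog (tlist TV (K i) (b i)) =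
  tslist (flatten [seq b i | i <- r]).
Proof.
move=> bK; elim: r => [|i r IH]; first by rewrite big_nil tslist_nil.
rewrite big_cons IH /tslist tsmul_homog tmul_tlist //=.
by rewrite tslistE // size_cat bK.
Qed.

End TensorSeriesLists.

Section LiftOperator.
Context {R : realType} {V U : completeNormedModType R}.
Context {TV : tensorPowers V} {TU : tensorPowers U}.
Variable OT : operatorTensors TV TU.
Implicit Types (n m l : nat) (vs ws : seq V) (s : tseries TV).

Variable phi : forall k, clinear (TV k.+1) U.

(** A block with index [k i] has [(k i).+1] letters: a [j]-th derivative of a one-form takes [j + 1]
    arguments. *)
Definition ktot l (k : 'I_l -> nat) : nat := (\sum_(i < l) (k i).+1)%N.

Definition kwords l (k : 'I_l -> nat) : seq (seq nat) :=
  (succ_words [seq (k i).+1 | i <- enum 'I_l]).2.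

Definition kinit l (k : 'I_l.+1 -> nat) : 'I_l -> nat :=
  fun i => k (widen_ord (leqnSn l) i).

Definition kotens l (k : 'I_l -> nat) : clinear (TV (ktot k)) (TU l) :=
  otens OT (fun i => phi (k i)).

(** Agrees with [lift_term] for [0 < l]. For [l = 0], where [msucc] has only a default value, it
    still acts on the constant term of [s], so the induction on [l] can start there. *)
Definition lift_op l (k : 'I_l -> nat) s : TU l :=
  kotens k (hat_op (zwords (ktot k) (kwords k)) (s (ktot k))).

Lemma ktotE l (k : 'I_l -> nat) :
  (succ_words [seq (k i).+1 | i <- enum 'I_l]).1 = ktot k.
Proof. by rewrite succ_words1 sumnE big_map big_enum. Qed.

Lemma ktot_rec l (k : 'I_l.+1 -> nat) :
  ktot k = (ktot (kinit k) + (k ord_max).+1)%N.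
Proof. by rewrite /ktot big_ord_recr. Qed.

Lemma kseq_rec l (k : 'I_l.+1 -> nat) :
  [seq (k i).+1 | i <- enum 'I_l.+1] =
  rcons [seq (kinit k i).+1 | i <- enum 'I_l] (k ord_max).+1.
Proof. by rewrite enum_ordSr map_rcons -map_comp. Qed.

Lemma kwords_rec l (k : 'I_l.+1 -> nat) :
  kwords k = flatten [seq succ_shuffles u (iota (ktot (kinit k)) (k ord_max).+1)
                     | u <- kwords (kinit k)].
Proof. by rewrite /kwords kseq_rec succ_words_rcons /= ktotE. Qed.

Lemma kwords_perm l (k : 'I_l -> nat) :
  all (perm_eq^~ (iota 0 (ktot k))) (kwords k).
Proof. by rewrite -ktotE; apply: succ_words_perm; rewrite all_map; apply/allP. Qed.

Lemma lift_termE l (k : 'I_l -> nat) s : (0 < l)%N ->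
  lift_term OT (k := fun i => (k i).+1) (fun i => phi (k i)) s = lift_op k s.
Proof.
move=> l0; rewrite /lift_term /msucc_id.
have -> : [seq Tagged zS (zperm (1%g : 'S_((k i).+1))) | i <- enum 'I_l] =
  [seq Tagged zS (zperm (1%g : 'S_j)) | j <- [seq (k i).+1 | i <- enum 'I_l]].
  by rewrite -map_comp.
rewrite msucc_succ_words ?all_map; last 2 first.
- exact/allP.
- by rewrite -size_eq0 size_map size_enum_ord -lt0n.
by rewrite /lift_op /kotens /kwords /= ktotE homog_id.
Qed.

Lemma lift_op_tslist l (k : 'I_l -> nat) vs : size vs = ktot k ->
  lift_op k (tslist TV vs) =
  \sum_(w <- kwords k) kotens k (tlist TV (ktot k) (arrange (ktot k) w vs)).
Proof.
move=> svs; rewrite /lift_op -(tslistE TV svs) homog_id hat_op_zwords.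
  by rewrite (lcont_sumE _ _ _ (lcont_clinear _)).
exact: kwords_perm.
Qed.

Lemma otens_flatten l (K : 'I_l -> nat) (f : forall i, clinear (TV (K i)) U)
    (b : 'I_l -> seq V) : (forall i, size (b i) = K i) ->
  otens OT f (tlist TV (\sum_(i < l) K i)%N (flatten [seq b i | i <- enum 'I_l])) =
  tens TU (fun i => f i (tlist TV (K i) (b i))).
Proof.
move=> bK; rewrite -(otens_tmul OT f (fun i => tlist TV (K i) (b i))).
congr (otens OT f _).
rewrite big_tsmul_tlist // -(@tslistE _ _ _ (\sum_(i < l) K i)%N).
  by rewrite homog_id enumT.
rewrite size_flatten sumnE /shape -map_comp big_map.
by apply: eq_bigr => i _; rewrite /= bK.
Qed.

Lemma kotens_flatten l (k : 'I_l -> nat) (b : 'I_l -> seq V) :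
  (forall i, size (b i) = (k i).+1) ->
  kotens k (tlist TV (ktot k) (flatten [seq b i | i <- enum 'I_l])) =
  tens TU (fun i => phi (k i) (tlist TV (k i).+1 (b i))).
Proof. exact: otens_flatten. Qed.

(** [otens] is known only on products of blocks of the right lengths, so [vs] is cut into its blocks
    first. *)
Lemma kotens_cat l (k : 'I_l.+1 -> nat) vs ws :
  size vs = ktot (kinit k) -> size ws = (k ord_max).+1 ->
  kotens k (tlist TV (ktot k) (vs ++ ws)) =
  homog (tmul (kotens (kinit k) (tlist TV (ktot (kinit k)) vs))
    (vtens TU (phi (k ord_max) (tlist TV (k ord_max).+1 ws)))) l.+1.
Proof.
move=> svs sws.
have [b' sb' vsE] := split_blocks svs.
pose b (i : 'I_l.+1) := if unlift ord_max i is Some j then b' j else ws.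
have bw i : b (widen_ord (leqnSn l) i) = b' i.
  rewrite /b (_ : widen_ord _ _ = lift ord_max i) ?liftK //.
  by apply/val_inj; rewrite /= /bump leqNgt ltn_ord.
have bm : b ord_max = ws by rewrite /b unlift_none.
have bk i : size (b i) = (k i).+1.
  rewrite /b; case: unliftP => [j ->|-> //]; rewrite sb' /kinit; congr (k _).+1.
  by apply/val_inj; rewrite /= /bump leqNgt ltn_ord.
have -> : vs ++ ws = flatten [seq b i | i <- enum 'I_l.+1].
  rewrite enum_ordSr map_rcons flatten_rcons bm -map_comp vsE.
  by congr (flatten _ ++ _); apply: eq_map => i /=; rewrite bw.
rewrite vsE !kotens_flatten // /vtens tmul_tens.
transitivity (tlist TU l.+1 (rcons
    [seq phi (kinit k i) (tlist TV (kinit k i).+1 (b' i)) | i <- enum 'I_l]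
    (phi (k ord_max) (tlist TV (k ord_max).+1 ws)))).
  rewrite tlist_enum enum_ordSr map_rcons -map_comp bm; congr (tlist _ _ (rcons _ _)).
  by apply: eq_map => i /=; rewrite bw.
rewrite -tmul_tens tlist_enum tlist_enum tmul_tlist; last first.
  by rewrite size_map size_enum_ord.
rewrite homog_tlist ?addn1 //; congr tlist.
by rewrite -cats1 enum_ordSl enum_ord0.
Qed.

End LiftOperator.

Lemma big_desh_cat (T : Type) (W : nmodType) (f : seq T -> seq T -> W)
    (xs ys : seq T) :
  \sum_(p <- desh (xs ++ ys)) f p.1 p.2 =
  \sum_(p <- desh ys) \sum_(r <- desh xs) f (r.1 ++ p.1) (r.2 ++ p.2).
Proof.
elim: xs f => [|x xs IH] f /=; first by under [RHS]eq_bigr do rewrite big_seq1.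
rewrite big_cat !big_map /= (IH (fun u v => f (x :: u) v)).
rewrite (IH (fun u v => f u (x :: v))) -big_split; apply: eq_bigr => p _.
by rewrite big_cat !big_map.
Qed.

Lemma desh_size (T : eqType) (vs : seq T) p :
  p \in desh vs -> (size p.1 + size p.2)%N = size vs.
Proof.
elim: vs p => [|x vs IH] p /=; first by rewrite inE => /eqP ->.
rewrite mem_cat => /orP[] /mapP[q /IH <- ->] /=; first by [].
by rewrite addnS.
Qed.

Section LiftRecursion.
Context {R : realType} {V U : completeNormedModType R}.
Context {TV : tensorPowers V} {TU : tensorPowers U}.
Variable OT : operatorTensors TV TU.
Implicit Types (n m l : nat) (vs ws xs ys : seq V) (s a b : tseries TV).

Lemma lcont_vtens (W : completeNormedModType R) (TW : tensorPowers W) :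
  lcont (vtens TW).
Proof.
apply: (@bounded_lcont _ _ _ _ 1); last by move=> x; rewrite norm_tens1 mul1r.
have vE v : vtens TW v = tens TW [eta (fun=> 0) with ord0 |-> v].
  by congr tens; apply/funext => i /=; rewrite (ord1 i) eqxx.
move=> c x y; rewrite !vE.
exact: (@tens_multilinear _ _ TW 1 ord0 (fun=> 0)).
Qed.

Lemma lcont_lift_op_homog (phi : forall k, clinear (TV k.+1) U) l
  (k : 'I_l -> nat) n : lcont (fun x : TV n => lift_op OT phi k (homog x)).
Proof.
apply: (lcont_comp (lcont_clinear (kotens OT phi k))
  (g := fun x : TV n => hat_op _ (homog x (ktot k)))).
apply: (lcont_comp (lcont_hat_op _)); exact: lcont_homog.
Qed.

Lemma tlist_ext2 n m (W : normedModType R) (f g : TV n -> TV m -> W) :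
  (forall x, lcont (f x)) -> (forall y, lcont (f^~ y)) ->
  (forall x, lcont (g x)) -> (forall y, lcont (g^~ y)) ->
  (forall vs ws, size vs = n -> size ws = m ->
    f (tlist TV n vs) (tlist TV m ws) = g (tlist TV n vs) (tlist TV m ws)) ->
  forall x y, f x y = g x y.
Proof.
move=> fr fl gr gl fg x y; move: x; apply: tlist_ext => [//|//|vs svs].
by move: y; apply: tlist_ext => // ws sws; exact: fg.
Qed.

Section OneFamily.
Variable phi : forall k, clinear (TV k.+1) U.

(** [T] is what remains of [lift_op] once the letters have been distributed: it rearranges the
    letters of the first blocks by their words and leaves the last block in order. It therefore
    factors on products, and the sum over splittings is the only coupling between the two parts. *)
Lemma lift_op_split l (k : 'I_l.+1 -> nat) :
  exists T : TV (ktot (kinit k) + (k ord_max).+1)%N -> TU l.+1,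
  [/\ lcont T,
    forall x z, T (tmul x z) = homog (tmul (lift_op OT phi (kinit k) (homog x))
                             (vtens TU (phi (k ord_max) z))) l.+1 &
    forall vs v, size vs = (ktot (kinit k) + k ord_max)%N ->
      lift_op OT phi k (tslist TV (rcons vs v)) =
      \sum_(p <- desh vs |
          (size p.1 == ktot (kinit k)) && (size p.2 == k ord_max))
        T (tlist TV _ (p.1 ++ rcons p.2 v))].
Proof.
set n := ktot (kinit k); set m := k ord_max.
pose ws := [seq u ++ iota n m.+1 | u <- kwords (kinit k)].
have wsP : all (perm_eq^~ (iota 0 (n + m.+1))) ws.
  rewrite all_map; apply: sub_all (kwords_perm (kinit k)) => u uP /=.
  by rewrite iotaD perm_cat2r.
pose T x := kotens OT phi k (homog (hat_op (zwords (n + m.+1) ws) x) (ktot k)).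
have TE vs cs : size vs = n -> size cs = m.+1 ->
    T (tlist TV (n + m.+1) (vs ++ cs)) = \sum_(u <- kwords (kinit k))
      kotens OT phi k (tlist TV (ktot k) (arrange n u vs ++ cs)).
  move=> svs scs; rewrite /T hat_op_zwords // homog_sum.
  rewrite (lcont_sumE _ _ _ (lcont_clinear _)) big_map.
  rewrite big_seq [RHS]big_seq; apply: eq_bigr => u uk.
  rewrite homog_tlist ?ktot_rec // arrange_cat //.
  by have /allP := kwords_perm (kinit k); exact.
have Tl : lcont T.
  apply: (lcont_comp (lcont_clinear _)).
  by apply: (lcont_comp (lcont_homog _ _ _)); exact: lcont_hat_op.
exists T; split => //.
- apply: tlist_ext2.
  + by move=> x; apply: (lcont_comp Tl); exact: lcont_tmulr.
  + by move=> x; apply: (lcont_comp Tl); exact: lcont_tmull.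
  + move=> x; apply: (lcont_comp (lcont_homog _ _ _)).
    apply: (lcont_comp (lcont_tmulr _ _)); apply: (lcont_comp (lcont_vtens _)).
    exact: lcont_clinear.
  + move=> z; apply: (lcont_comp (lcont_homog _ _ _)).
    apply: (lcont_comp (lcont_tmull _ _)); exact: lcont_lift_op_homog.
  move=> vs cs svs scs; rewrite tmul_tlist // TE // tslistE // lift_op_tslist //.
  rewrite tmul_suml homog_sum; apply: eq_bigr => u _.
  by rewrite kotens_cat // size_arrange.
move=> vs v svs; rewrite lift_op_tslist; last by rewrite size_rcons svs ktot_rec addnS.
rewrite kwords_rec big_flatten big_map.
under [RHS]eq_bigr => p /andP[/eqP s1 /eqP s2].
  rewrite TE ?size_rcons ?s2 //; over.
rewrite exchange_big; rewrite big_seq [RHS]big_seq; apply: eq_bigr => u uk.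
have uP : perm_eq u (iota 0 n) by have /allP := kwords_perm (kinit k); exact.
have := sum_succ_shuffles_arrange
  (fun ws => kotens OT phi k (tlist TV (ktot k) ws)) v uP svs.
by rewrite -ktot_rec.
Qed.

(** On the right [x] and [z] are separated by [as1]. Once a permutation has brought them together,
    the expression depends on the single tensor [tmul x z], to which group-likeness applies. *)
Lemma swap_middle n1 n2 m1 m2 as1 cs (W : normedModType R)
    (T : TV (m1 + m2)%N -> W) :
  lcont T -> (n1 + size as1)%N = m1 -> (n2 + size cs)%N = m2 ->
  exists2 F : TV (n1 + n2)%N -> W, lcont F & forall x z,
    F (tmul x z) = T (tmul (homog (tmul x (tlist TV (size as1) as1)) m1)
                           (homog (tmul z (tlist TV (size cs) cs)) m2)).
Proof.
move=> Tl; set d := size as1; set e := size cs => nd ne.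
(* From the list [xs ++ zs ++ as1 ++ cs], [w] picks [xs], [as1], [zs], [cs] in this order. *)
pose w := iota 0 n1 ++ iota (n1 + n2) d ++ iota n1 n2 ++ iota (n1 + n2 + d) e.
have wP : perm_eq w (iota 0 (n1 + n2 + (d + e))).
  have -> : iota 0 (n1 + n2 + (d + e)) =
      iota 0 n1 ++ iota n1 n2 ++ iota (n1 + n2) d ++ iota (n1 + n2 + d) e.
    by rewrite !iotaD !add0n -catA.
  by rewrite perm_cat2l perm_catCA.
have [P Pl PE] := exists_permutation (TV := TV) wP.
exists (fun x => T (homog (P (tmul x (tlist TV (d + e) (as1 ++ cs)))) (m1 + m2))).
  apply: (lcont_comp Tl); apply: (lcont_comp (lcont_homog _ _ _)).
  by apply: (lcont_comp Pl); exact: lcont_tmull.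
apply: tlist_ext2.
- move=> x; apply: (lcont_comp Tl); apply: (lcont_comp (lcont_homog _ _ _)).
  by apply: (lcont_comp Pl); solve_lcont.
- move=> x; apply: (lcont_comp Tl); apply: (lcont_comp (lcont_homog _ _ _)).
  by apply: (lcont_comp Pl); solve_lcont.
- by move=> x; apply: (lcont_comp Tl); solve_lcont.
- by move=> x; apply: (lcont_comp Tl); solve_lcont.
move=> xs zs sxs szs; congr T.
rewrite !tmul_tlist ?size_cat ?sxs ?szs // PE !homog_tlist //; last first.
  by rewrite -nd -ne addnACA.
rewrite tmul_tlist ?size_cat ?sxs -?nd //; congr tlist.
rewrite /w !map_cat !map_nth_iota ?size_cat ?sxs ?szs //.
all: try by rewrite -/d -/e; lia.
rewrite drop0.
have dE (s1 s2 : seq V) n : size s1 = n -> drop n (s1 ++ s2) = s2.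
  by move=> <-; rewrite drop_size_cat.
have tE (s1 s2 : seq V) n : size s1 = n -> take n (s1 ++ s2) = s1.
  by move=> <-; rewrite take_size_cat.
rewrite -[(_ ++ _) ++ _]catA tE // [drop n1 _]dE // tE //.
rewrite [xs ++ _]catA [drop (n1 + n2) _]dE ?size_cat ?sxs ?szs // tE //.
rewrite [(xs ++ zs) ++ _]catA dE ?size_cat ?sxs ?szs // take_oversize //.
by rewrite !catA.
Qed.

End OneFamily.
End LiftRecursion.

(** * The lift at a product with a group-like factor *)

Section GrouplikeLift.
Context {R : realType} {V U : completeNormedModType R}.
Context {TV : tensorPowers V} {TU : tensorPowers U}.
Variable OT : operatorTensors TV TU.
Implicit Types (n m l : nat) (vs ws xs ys : seq V) (s a b : tseries TV).
Implicit Type phi : forall k, clinear (TV k.+1) U.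

(** For a fixed splitting [p] of [ys], the free places are filled by letters of [a], distributed
    over the two parts in all ways. This sum is a shuffle acting on one component of [a], and
    group-likeness turns it into a product of two components. Up to that last step both sides are
    linear in the component, so elementary tensors suffice ([F12]). *)
Lemma lift_op_grouplike phi l (k : 'I_l.+1 -> nat) a ys y : grouplike a ->
  lift_op OT phi k (tsmul a (tslist TV (rcons ys y))) =
  \sum_(p <- desh ys)
    homog (tmul (lift_op OT phi (kinit k) (tsmul a (tslist TV p.1)))
      (vtens TU (phi (k ord_max)
        (tsmul a (tslist TV (rcons p.2 y)) (k ord_max).+1)))) l.+1.
Proof.
move=> ga; set n := ktot (kinit k); set m := k ord_max.
have [T [Tl TE Tdesh]] := lift_op_split OT phi k.
(* The splittings that fit: the last block has [m.+1] places, one of which is reserved for [y]. *)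
pose C (p : seq V * seq V) := (size p.1 <= n)%N && (size p.2 <= m)%N.
pose G (p : seq V * seq V) (x : TV (n - size p.1)%N) (z : TV (m - size p.2)%N) :=
  T (tmul (homog (tmul x (tlist TV (size p.1) p.1)) n)
          (homog (tmul z (tlist TV (size (rcons p.2 y)) (rcons p.2 y))) m.+1)).
have rhsE p : homog (tmul (lift_op OT phi (kinit k) (tsmul a (tslist TV p.1)))
      (vtens TU (phi m (tsmul a (tslist TV (rcons p.2 y)) m.+1)))) l.+1 =
    if C p then G p (a (n - size p.1)%N) (a (m - size p.2)%N) else 0.
  rewrite /lift_op -/n !tsmul_homogr size_rcons ltnS /C.
  case: ifP => /= _; last first.
    by rewrite (lcont0 (lcont_hat_op _)) linear0 tmul0l homog0.
  case: ifP => /= _; last first.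
    by rewrite linear0 (lcont0 (lcont_vtens TU)) tmul0r homog0.
  by rewrite /G TE subSS /lift_op homog_id size_rcons.
under [RHS]eq_bigr do rewrite rhsE.
rewrite -big_mkcond /=.
(* If [ys] is too long, no splitting fits and both sides vanish; otherwise [a] enters through its
   component of degree [q]. *)
have [big|small] := ltnP (n + m) (size ys).
  rewrite /lift_op tsmul_homogr ifN; last first.
    by rewrite size_rcons -ltnNge ktot_rec -/n -/m addnS ltnS.
  rewrite (lcont0 (lcont_hat_op _)) linear0 big_seq_cond big1 // => p.
  move=> /andP[/desh_size pE /andP[p1 p2]].
  by have := leq_add p1 p2; rewrite pE leqNgt big.
set q := (n + m - size ys)%N.
(* When [p] does not fit, the differences of sizes are cut off at 0 and the degrees no longer match,
   so the map is specified only under [C p]. *)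
have exF p : exists Fp : TV ((n - size p.1) + (m - size p.2))%N -> TU l.+1,
    C p -> lcont Fp /\ forall x z, Fp (tmul x z) = G p x z.
  case: (boolP (C p)) => [/andP[p1 p2]|_]; last by exists (fun=> 0).
  have [||F Fl FE] := swap_middle (n1 := (n - size p.1)%N)
    (n2 := (m - size p.2)%N) (as1 := p.1) (cs := rcons p.2 y) Tl; last by exists F.
    by rewrite subnK.
  by rewrite size_rcons addnS subnK.
pose F p := sval (cid (exF p)).
have FP p : C p -> lcont (F p) /\ forall x z, F p (tmul x z) = G p x z :=
  svalP (cid (exF p)).
pose D (p : seq V * seq V) := zstar (zperm (1%g : 'S_(n - size p.1)%N))
  (zperm (1%g : 'S_(m - size p.2)%N)).
pose F1 (x : TV q) := lift_op OT phi k
  (homog (tmul x (tlist TV (size (rcons ys y)) (rcons ys y)))).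
pose F2 (x : TV q) := \sum_(p <- desh ys | C p && (p \in desh ys))
  F p (hat_op (D p) (homog x (n - size p.1 + (m - size p.2)%N)%N)).
have qE p : C p -> p \in desh ys -> q = (n - size p.1 + (m - size p.2)%N)%N.
  have aux i j : (i <= n -> j <= m -> n + m - (i + j) = n - i + (m - j))%N by lia.
  by move=> /andP[p1 p2] pE; rewrite /q -(desh_size pE); exact: aux.
have F12 : F1 =1 F2.
  apply: tlist_ext.
  - apply: (lcont_comp (lcont_lift_op_homog _ _ _ _)); exact: lcont_tmull.
  - rewrite /F2; under eq_fun do rewrite big_mkcond.
    apply: (lcont_sum _ xpredT (f := fun p x => if C p && (p \in desh ys) then
      F p (hat_op (D p) (homog x (n - size p.1 + (m - size p.2)%N)%N)) else 0)).
    move=> p; case: (boolP (C p && _)) => [/andP[Cp _]|_]; last exact: lcont_zero.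
    apply: (lcont_comp (FP p Cp).1); apply: (lcont_comp (lcont_hat_op _)).
    exact: lcont_homog.
  move=> xs sxs; rewrite /F1 tmul_tlist // tslistE ?size_cat ?sxs //.
  rewrite -rcons_cat Tdesh; last by rewrite size_cat sxs subnK.
  rewrite -/n -/m big_mkcond (big_desh_cat (fun p1 p2 =>
    if (size p1 == n) && (size p2 == m)
    then T (tlist TV (n + m.+1) (p1 ++ rcons p2 y)) else 0)).
  rewrite /F2 [RHS]big_mkcond big_seq [RHS]big_seq.
  apply: eq_bigr => p pys; rewrite pys andbT.
  have pE := desh_size pys.
  case: ifP => [Cp|/negbT Cp]; last first.
    apply: big1 => r _; rewrite ifN //; apply: contra Cp; rewrite !size_cat /C.
    by move=> /andP[/eqP <- /eqP <-]; rewrite !leq_addl.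
  have [Fl FE] := FP p Cp; case/andP: (Cp) => p1 p2.
  rewrite homog_tlist; last exact: qE.
  rewrite hat_op_star; last by rewrite sxs; exact: qE.
  rewrite (lcont_sumE _ _ _ Fl) [RHS]big_mkcond; apply: eq_bigr => r _.
  rewrite !size_cat -(eqn_add2r (size p.1) _ (n - _)) subnK //.
  rewrite -(eqn_add2r (size p.2) _ (m - _)) subnK //.
  case: ifP => // /andP[/eqP r1 /eqP r2].
  have r1' : size r.1 = (n - size p.1)%N by rewrite -r1 addnK.
  have r2' : size r.2 = (m - size p.2)%N by rewrite -r2 addnK.
  have -> : tlist TV (n - size p.1 + (m - size p.2)) (r.1 ++ r.2) =
      tmul (tlist TV (n - size p.1) r.1) (tlist TV (m - size p.2) r.2).
    by rewrite tmul_tlist.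
  rewrite FE /G !tmul_tlist //; congr T.
  rewrite !homog_tlist ?size_rcons ?addnS ?subnK // tmul_tlist ?size_cat //.
  by rewrite rcons_cat.
transitivity (F1 (a q)).
  congr (kotens _ _ _ (hat_op _ _)); rewrite tsmul_homogr size_rcons ktot_rec.
  by rewrite -/n -/m addnS ltnS small subSS.
rewrite F12 /F2 [RHS]big_seq_cond.
apply: eq_big => [p|p /andP[Cp pys]]; first by rewrite andbC.
have [_ FE] := FP p Cp.
rewrite -FE /D; congr (F p _).
rewrite -(grouplikeE _ _ ga); congr (hat_op _ _).
by rewrite (qE p Cp pys) homog_id.
Qed.

End GrouplikeLift.

(** * The lift as a series and its multiplicativity *)

Section LiftSeries.
Context {R : realType} {V U : completeNormedModType R}.
Context {TV : tensorPowers V} {TU : tensorPowers U}.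
Variable OT : operatorTensors TV TU.
Implicit Types (n m l N : nat) (vs ws xs ys : seq V) (s a b : tseries TV).
Implicit Type phi psi : forall k, clinear (TV k.+1) U.

(** [N] counts the coefficients, so it is one more than the degree of the one-form. In degree 0 the
    only multi-index is the empty one. *)
Definition lift_series phi N s : tseries TU := fun l =>
  \sum_(k : {ffun 'I_l -> 'I_N}) lift_op OT phi (fun i => k i : nat) s.

(** Up to [vtens], the degree-1 part of the lift. The last block sees a family only through this
    functional, so two families are compared by means of it. *)
Definition head_op phi N s : U := \sum_(k < N) phi k (s k.+1).

Lemma lift_op_eq0 phi l (k : 'I_l -> nat) s :
  s (ktot k) = 0 -> lift_op OT phi k s = 0.
Proof. by move=> s0; rewrite /lift_op s0 (lcont0 (lcont_hat_op _)) linear0. Qed.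

Lemma ktot_le l N (k : {ffun 'I_l -> 'I_N}) :
  (ktot (fun i => k i : nat) <= l * N)%N.
Proof.
rewrite -[l in (l * _)%N]card_ord -sum_nat_const; apply: leq_sum => i _.
exact: ltn_ord.
Qed.

Lemma big_ffun_rec (W : nmodType) l N
    (F : {ffun 'I_l -> 'I_N} -> 'I_N -> W) :
  \sum_(k : {ffun 'I_l.+1 -> 'I_N})
    F [ffun i => k (widen_ord (leqnSn l) i)] (k ord_max) =
  \sum_(k : {ffun 'I_l -> 'I_N}) \sum_(j < N) F k j.
Proof.
rewrite pair_bigA /=.
rewrite (reindex (fun k : {ffun 'I_l.+1 -> 'I_N} =>
  ([ffun i => k (widen_ord (leqnSn l) i)], k ord_max))) //=.
pose g (p : {ffun 'I_l -> 'I_N} * 'I_N) : {ffun 'I_l.+1 -> 'I_N} :=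
  [ffun i => if unlift ord_max i is Some j then p.1 j else p.2].
have wl (i : 'I_l) : widen_ord (leqnSn l) i = lift ord_max i.
  by apply/val_inj; rewrite /= /bump leqNgt ltn_ord.
exists g => [k _|[k j] _] /=.
  apply/ffunP => i; rewrite ffunE; case: unliftP => [j ->|-> //].
  by rewrite ffunE wl.
congr pair; last by rewrite ffunE unlift_none.
by apply/ffunP => i; rewrite !ffunE wl liftK.
Qed.

Lemma lift_series0 phi N s : s 0%N = tunit -> lift_series phi N s 0%N = tunit.
Proof.
move=> s0; pose k1 : {ffun 'I_0 -> 'I_N} :=
  [ffun i : 'I_0 => False_rect _ (notF (ltn_ord i))].
rewrite /lift_series (big_pred1 k1); last first.
  by move=> k; apply/esym/eqP/ffunP => -[].
set k := (fun i => _).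
have k0 : ktot k = 0%N by rewrite /ktot big_ord0.
have -> : lift_op OT phi k s = lift_op OT phi k (tslist TV [::]).
  rewrite /lift_op tslist_nil; congr (kotens _ _ _ (hat_op _ _)).
  by move: k0; case: (ktot k) => // _; rewrite s0 tsone0.
rewrite lift_op_tslist // /kwords (size0nil (size_enum_ord 0)) /= big_seq1.
have -> : arrange (ktot k) [::] [::] = flatten [seq [::] : seq V | i <- enum 'I_0].
  by rewrite (size0nil (size_enum_ord 0)) /= k0.
by rewrite kotens_flatten ?tunitE // => -[].
Qed.

Lemma lift_series_nil phi N s l : (forall n, s n.+1 = 0) ->
  lift_series phi N s l.+1 = 0.
Proof.
move=> s0; apply: big1 => k _; apply: lift_op_eq0.
by rewrite ktot_rec addnS s0.
Qed.

Lemma lift_series_zero phi N s : s 0%N = 0 -> lift_series phi N s 0%N = 0.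
Proof.
move=> s0; apply: big1 => k _; apply: lift_op_eq0.
by rewrite /ktot big_ord0.
Qed.

Lemma lift_series_one phi N : lift_series phi N (tsone TV) = tsone TU.
Proof.
apply: tseries_ext => -[|l].
  by rewrite lift_series0 ?tsone0.
by rewrite tsoneS lift_series_nil // => n; rewrite tsoneS.
Qed.

Lemma lift_series_grouplike phi N a ys y l : grouplike a ->
  lift_series phi N (tsmul a (tslist TV (rcons ys y))) l.+1 =
  \sum_(p <- desh ys)
    homog (tmul (lift_series phi N (tsmul a (tslist TV p.1)) l)
      (vtens TU (head_op phi N (tsmul a (tslist TV (rcons p.2 y)))))) l.+1.
Proof.
move=> ga; rewrite /lift_series.
under eq_bigr do rewrite lift_op_grouplike //.
rewrite exchange_big /=; apply: eq_bigr => p _.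
transitivity (\sum_(k : {ffun 'I_l -> 'I_N}) \sum_(j < N)
   homog (tmul (lift_op OT phi (fun i => k i : nat) (tsmul a (tslist TV p.1)))
      (vtens TU (phi j (tsmul a (tslist TV (rcons p.2 y)) j.+1)))) l.+1).
  rewrite -(big_ffun_rec (fun k (j : 'I_N) =>
    homog (tmul (lift_op OT phi (fun i => k i : nat) (tsmul a (tslist TV p.1)))
      (vtens TU (phi j (tsmul a (tslist TV (rcons p.2 y)) j.+1)))) l.+1)).
  apply: eq_bigr => k _ /=.
  rewrite [kinit _](_ : _ =
    (fun i : 'I_l => [ffun j => k (widen_ord (leqnSn l) j)] i : nat)) //.
  by apply/funext => i; rewrite ffunE.
rewrite tmul_suml homog_sum; apply: eq_bigr => k _.
rewrite -homog_sum -tmul_sumr /head_op.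
by rewrite (lcont_sumE _ _ _ (lcont_vtens TU)).
Qed.

Lemma lift_series_tslist phi N ys y l :
  lift_series phi N (tslist TV (rcons ys y)) l.+1 =
  \sum_(p <- desh ys)
    homog (tmul (lift_series phi N (tslist TV p.1) l)
      (vtens TU (head_op phi N (tslist TV (rcons p.2 y))))) l.+1.
Proof.
have := lift_series_grouplike phi N ys y l (grouplike_tsone (TV := TV)).
rewrite tsmul1l => ->; apply: eq_bigr => p _.
by rewrite !tsmul1l.
Qed.

(** Induction on the degree. On the left, peeling off the last block leaves a sum over splittings of
    [ys], in which the induction hypothesis extracts the lift of [a] from the first part and [hpsi]
    replaces the last block by one without letters of [a]. Peeling off the last block of the
    [psi]-lift of [ys] on the right gives the same sum. *)
Lemma lift_series_mul_tslist phi psi N a ys : grouplike a ->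
  (forall vs v, head_op psi N (tslist TV (rcons vs v)) =
                head_op phi N (tsmul a (tslist TV (rcons vs v)))) ->
  lift_series phi N (tsmul a (tslist TV ys)) =
  tsmul (lift_series phi N a) (lift_series psi N (tslist TV ys)).
Proof.
move=> ga hpsi; apply: tseries_ext => l; elim: l ys => [|l IH] ys.
  case/lastP: ys => [|ys y].
    by rewrite tslist_nil tsmul1r lift_series_one tsmul1r.
  have z : tslist TV (rcons ys y) 0%N = 0.
    by rewrite /tslist homog_neq // size_rcons.
  rewrite tsmul0E [X in tmul _ X]lift_series_zero // tmul0r.
  by rewrite lift_series_zero // tsmul0E z tmul0r.
case/lastP: ys => [|ys y].
  by rewrite tslist_nil tsmul1r lift_series_one tsmul1r.
have il (i : 'I_l.+1) : (i + (l - i) = l)%N by rewrite subnKC // -ltnS.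
rewrite lift_series_grouplike //.
under eq_bigr => p _.
  rewrite IH -hpsi /tsmul tmul_suml homog_sum.
  under eq_bigr => i _ do rewrite homog_tmull //.
  over.
rewrite /= exchange_big /= /tsmul [RHS]big_ord_recr /= subnn.
(* No term has its full degree in the first factor: for nonempty [ys] the lift of [ys] has no
   constant term. *)
rewrite [X in tmul _ X]lift_series_zero ?tmul0r ?homog0 ?addr0; last first.
  by rewrite /tslist homog_neq // size_rcons.
apply: eq_bigr => i _; rewrite /= subSn; last by rewrite -ltnS.
rewrite lift_series_tslist.
rewrite tmul_sumr homog_sum; apply: eq_bigr => p _.
by rewrite tmulA homog_tmulr // addn1.
Qed.

(** In degrees up to [l] the lift involves only degrees up to [l * N] of its argument, so [b] can be
    replaced by a finite sum of homogeneous tensors. *)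
Lemma lift_series_mul phi psi N a b : grouplike a ->
  (forall vs v, head_op psi N (tslist TV (rcons vs v)) =
                head_op phi N (tsmul a (tslist TV (rcons vs v)))) ->
  lift_series phi N (tsmul a b) =
  tsmul (lift_series phi N a) (lift_series psi N b).
Proof.
move=> ga hpsi; apply: tseries_ext => l; pose M := (l * N).+1.
have deg i (k : {ffun 'I_i -> 'I_N}) : (i <= l)%N ->
    (ktot (fun i => k i : nat) < M)%N.
  by move=> il; rewrite ltnS (leq_trans (ktot_le k)) // leq_mul2r il orbT.
have lift_sum theta i (s : tseries TV) (t : 'I_M -> tseries TV) : (i <= l)%N ->
    (forall j, (j < M)%N -> s j = \sum_(c < M) t c j) ->
    lift_series theta N s i = \sum_(c < M) lift_series theta N (t c) i.
  move=> il st; rewrite /lift_series exchange_big; apply: eq_bigr => k _ /=.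
  rewrite /lift_op st ?deg // (lcont_sumE _ _ _ (lcont_hat_op _)).
  by rewrite (lcont_sumE _ _ _ (lcont_clinear _)).
rewrite (lift_sum phi _ _ (fun c => tsmul a (homog (b c)))) //; last first.
  by move=> j jM; exact: tsmul_sum_homog.
have bE j : (j < M)%N -> b j = \sum_(c < M) homog (b c) j.
  move=> jM; rewrite (bigD1 (Ordinal jM)) //= homog_id big1 ?addr0 // => c cj.
  by rewrite homog_neq //; apply: contra cj => /eqP cj; apply/eqP/val_inj.
transitivity (\sum_(c < M)
   tsmul (lift_series phi N a) (lift_series psi N (homog (b c))) l).
  apply: eq_bigr => c _; move: (b c); apply: tlist_ext => [||vs svs].
  - apply: lcont_sum => k.
    apply: (lcont_comp (lcont_clinear _)).
    apply: (lcont_comp (lcont_hat_op _)); exact: lcont_tsmul_homog.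
  - apply: lcont_sum => i; apply: (lcont_comp (lcont_homog _ _ _)).
    apply: (lcont_comp (lcont_tmulr _ _)); apply: lcont_sum => k.
    exact: lcont_lift_op_homog.
  by rewrite tslistE // (lift_series_mul_tslist _ ga hpsi).
rewrite /tsmul exchange_big; apply: eq_bigr => i _ /=.
rewrite -homog_sum -tmul_sumr.
by rewrite -(lift_sum psi _ b) ?leq_subr.
Qed.

End LiftSeries.

(** * Change of base point *)

Section SymmetricLists.
Context {R : realType} {V : completeNormedModType R}.
Implicit Types (vs ls : seq V) (u w : V).

(** Symmetric multilinear maps of all arities at once. By symmetry, linearity in the first entry is
    enough. *)
Definition symlin (W : lmodType R) (F : seq V -> W) :=
  (forall ls ls', perm_eq ls ls' -> F ls = F ls') /\
  (forall ls, linear (fun u => F (u :: ls))).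

Lemma symlin_cons (W : lmodType R) (F : seq V -> W) u :
  symlin F -> symlin (fun ls => F (u :: ls)).
Proof.
move=> [FP Fl]; split=> [ls ls' lsP|ls a x y].
  by apply: FP; rewrite perm_cons.
have sw z : F [:: u, z & ls] = F [:: z, u & ls].
  by apply: FP; rewrite -[_ :: _ :: _]/([:: u] ++ [:: z] ++ ls) perm_catCA.
by rewrite !sw Fl.
Qed.

Lemma symlin_cat (W : lmodType R) (F : seq V -> W) vs :
  symlin F -> symlin (fun ls => F (ls ++ vs)).
Proof.
by move=> [FP Fl]; split=> [ls ls' lsP|ls]; [apply: FP; rewrite perm_cat2r|exact: Fl].
Qed.

Lemma symlin_scale (W : lmodType R) (F : seq V -> W) c :
  symlin F -> symlin (fun ls => c *: F ls).
Proof.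
move=> [FP Fl]; split=> [ls ls' lsP|ls a x y]; first by rewrite (FP _ _ lsP).
by rewrite Fl scalerDr !scalerA mulrC.
Qed.

Lemma symlin_sum (W : lmodType R) I (r : seq I) (P : pred I)
    (F : I -> seq V -> W) :
  (forall i, symlin (F i)) -> symlin (fun ls => \sum_(i <- r | P i) F i ls).
Proof.
move=> FP; split=> [ls ls' lsP|ls a x y].
  by apply: eq_bigr => i _; rewrite ((FP i).1 _ _ lsP).
rewrite scaler_sumr -big_split; apply: eq_bigr => i _.
exact: (FP i).2.
Qed.

Lemma symlinZ (W : lmodType R) (F : seq V -> W) h u ls :
  symlin F -> F (h *: u :: ls) = h *: F (u :: ls).
Proof.
move=> [_ Fl]; have F0 : F (0 :: ls) = 0.
  by have := Fl ls (-1) 0 0; rewrite scaler0 addr0 scaleN1r addNr.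
by have := Fl ls h u 0; rewrite addr0 F0 addr0.
Qed.

Lemma symlin_nseqZ (W : lmodType R) (F : seq V -> W) (h : R) w q ls :
  symlin F -> F (nseq q (h *: w) ++ ls) = h ^+ q *: F (nseq q w ++ ls).
Proof.
elim: q F => [|q IH] F FP; first by rewrite expr0 scale1r.
rewrite /= (IH (fun ls => F (h *: w :: ls))); last exact: symlin_cons.
by rewrite symlinZ // scalerA exprSr.
Qed.

Lemma symlin_binom (W : lmodType R) (F : seq V -> W) u w l ls : symlin F ->
  F (nseq l (u + w) ++ ls) =
  \sum_(q < l.+1) 'C(l, q)%:R *: F (nseq q w ++ nseq (l - q) u ++ ls).
Proof.
elim: l F => [|l IH] F FP.
  by rewrite big_ord1 bin0 scale1r.
have FD ls' : F (u + w :: ls') = F (u :: ls') + F (w :: ls').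
  by have := FP.2 ls' 1 u w; rewrite !scale1r.
rewrite [LHS]FD (IH (fun ls => F (u :: ls))) ?(IH (fun ls => F (w :: ls)));
  try exact: symlin_cons.
pose T q := F (nseq q w ++ nseq (l.+1 - q) u ++ ls).
rewrite [X in X + _](_ : _ = \sum_(q < l.+1) 'C(l, q)%:R *: T q); last first.
  apply: eq_bigr => q _; congr (_ *: _).
  rewrite /T subSn; last by rewrite -ltnS.
  apply: FP.1.
  exact: (permEl (perm_catCA [:: u] (nseq q w) (nseq (l - q) u ++ ls))).
rewrite [X in _ + X](_ : _ = \sum_(q < l.+1) 'C(l, q)%:R *: T q.+1); last first.
  by apply: eq_bigr => q _.
rewrite [RHS]big_ord_recl /= bin0 -[X in _ = _ + X]/(\sum_(q < l.+1) _).
under [in RHS]eq_bigr => q _ do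
  rewrite /bump /= add1n binS natrD scalerDl -/(T q.+1).
rewrite big_split /= addrA; congr (_ + _).
rewrite big_ord_recl bin0 /=; congr (_ + _).
rewrite big_ord_recr /= bin_small // scale0r addr0.
by apply: eq_bigr => q _; rewrite /bump /= add1n.
Qed.

End SymmetricLists.

Lemma desh_perm (T : eqType) (vs : seq T) p :
  p \in desh vs -> perm_eq (p.1 ++ p.2) vs.
Proof.
elim: vs p => [|x vs IH] p /=; first by rewrite inE => /eqP ->.
rewrite mem_cat => /orP[] /mapP[q /IH qP ->] /=; first by rewrite perm_cons.
rewrite -[x :: vs]cat1s -[q.1 ++ _]/(q.1 ++ [:: x] ++ q.2) perm_catCA /=.
by rewrite perm_cons.
Qed.

(** This count is the factor [r + 1] in [grouplike_sym]. *)
Lemma count_desh1 (T : eqType) (vs : seq T) :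
  count (fun p => size p.2 == 1%N) (desh vs) = size vs.
Proof.
have c0 (us : seq T) : count (fun p => size p.2 == 0%N) (desh us) = 1%N.
  elim: us => [//|x us IH] /=; rewrite count_cat !count_map.
  rewrite [X in (_ + X)%N](_ : _ = 0%N) ?addn0; first exact: IH.
  by apply/eqP; rewrite -leqn0 leqNgt -has_count; apply/hasPn.
elim: vs => [//|x vs IH] /=; rewrite count_cat !count_map.
by rewrite -[RHS]addn1; congr addn; [exact: IH|exact: c0].
Qed.

Section GrouplikePower.
Context {R : realType} {V : completeNormedModType R} (TV : tensorPowers V).

Lemma tpower_tlist n v : tpower TV n v = tlist TV n (nseq n v).
Proof. by congr tens; apply/funext => i; rewrite nth_nseq ltn_ord. Qed.

Lemma vtens_tlist v : vtens TV v = tlist TV 1 [:: v].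
Proof. by congr tens; apply/funext => i; rewrite (ord1 i). Qed.

(** On a symmetric functional, shuffling with one letter only multiplies by the number of shuffles.
    Group-likeness thus gives [(r + 1) f(a^(r+1)) = f(a^r a^1)], and the factorial accumulates by
    induction. *)
Lemma grouplike_sym (W : normedModType R) r (f : TV r -> W) (a : tseries TV) v :
  grouplike a -> a 1%N = vtens TV v -> lcont f ->
  (forall ls ls', size ls = r -> perm_eq ls ls' ->
     f (tlist TV r ls) = f (tlist TV r ls')) ->
  f (a r) = (r`!%:R)^-1 *: f (tpower TV r v).
Proof.
move=> ga a1; elim: r f => [|r IH] f fl fP.
  by rewrite fact0 invr1 scale1r ga.1 tsone0 /tpower tunitE.
pose f' (x : TV (r + 1)%N) := f (homog x r.+1).
have fl' : lcont f' by apply: (lcont_comp fl); solve_lcont.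
have desh_f x : f' (hat_op (zstar (zperm (1%g : 'S_r)) (zperm (1%g : 'S_1))) x) =
    r.+1%:R *: f' x.
  move: x; apply: tlist_ext.
  - by apply: (lcont_comp fl'); exact: lcont_hat_op.
  - exact: lcont_scale.
  move=> vs svs; rewrite hat_op_star // (lcont_sumE _ _ _ fl').
  rewrite big_seq_cond (eq_bigr (fun=> f' (tlist TV (r + 1) vs))); last first.
    move=> p /andP[pv _]; rewrite /f' !homog_tlist ?addn1 //; apply/esym/fP.
      by rewrite svs addn1.
    by rewrite perm_sym desh_perm.
  rewrite -big_seq_cond big_const_seq iter_addr_0 scaler_nat; congr (_ *+ _).
  rewrite -[r.+1]addn1 -svs -[RHS]count_desh1; apply: eq_in_count => p pv.
  have := desh_size pv; rewrite svs.
  case: eqP => [->|s1] /=; first by move/eqP; rewrite eqn_add2l.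
  by case: eqP => // s2; rewrite s2 => /eqP; rewrite eqn_add2r => /eqP.
have := desh_f (a (r + 1)%N); rewrite (grouplikeE _ _ ga).
have -> : f' (a (r + 1)%N) = f (a r.+1).
  by rewrite /f'; congr f; rewrite addn1 homog_id.
move=> E; have {E} -> : f (a r.+1) = r.+1%:R^-1 *: f' (tmul (a r) (a 1%N)).
  by rewrite E scalerA mulVf ?scale1r // pnatr_eq0.
rewrite (IH (fun x => f' (tmul x (a 1%N)))); last 2 first.
- by apply: (lcont_comp fl'); solve_lcont.
- move=> ls ls' sls lsP; rewrite a1 vtens_tlist /f'.
  have sls' : size ls' = r by rewrite -(perm_size lsP).
  rewrite !tmul_tlist // !homog_tlist ?addn1 //; apply: fP.
    by rewrite size_cat sls addn1.
  by rewrite perm_cat2r.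
rewrite scalerA factS natrM invfM; congr (_ *: _).
rewrite /f' a1 !tpower_tlist vtens_tlist.
rewrite tmul_tlist ?size_nseq // homog_tlist ?addn1 //; congr (f (tlist _ _ _)).
by rewrite -[RHS]cat1s -[[:: v]]/(nseq 1 v) -!nseqD addnC.
Qed.

End GrouplikePower.

(** * Taylor coefficients at a shifted base point *)

Section ShiftedFamily.
Context {R : realType} {V U : completeNormedModType R}.
Context {TV : tensorPowers V} {TU : tensorPowers U}.
Variable OT : operatorTensors TV TU.
Implicit Types (n m l N : nat) (vs ws ls : seq V) (s a b : tseries TV).
Implicit Type phi psi : forall k, clinear (TV k.+1) U.
Implicit Types y z v w : V.

Lemma clinear_sumE (E F : normedModType R) I (r : seq I) (P : pred I)
    (f : I -> clinear E F) (x : E) :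
  (\sum_(i <- r | P i) f i) x = \sum_(i <- r | P i) f i x.
Proof. exact: (big_morph (fun g : clinear E F => g x)). Qed.

Lemma clinear_ext (E F : normedModType R) (f g : clinear E F) :
  (forall x, f x = g x) -> f = g.
Proof. by move=> fg; apply/val_inj/funext. Qed.

Lemma lcont_tmul_pre i j r (A : clinear (TV j) U) (t : TV r) :
  lcont (fun x : TV i => A (homog (tmul t x) j)).
Proof. by solve_lcont. Qed.

Definition tmul_pre i j r (A : clinear (TV j) U) (t : TV r) : clinear (TV i) U :=
  to_clinear (lcont_tmul_pre i A t).

(** The value 0 from length [N] on lets the sums over degrees run over a fixed range. *)
Definition symbol phi N ls v : U :=
  if (size ls < N)%N then phi (size ls) (tlist TV (size ls).+1 (rcons ls v))
  else 0.

(** Symmetry concerns the directions of differentiation only; the last argument is the one of the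
    one-form. *)
Definition sym_family phi N := forall v, symlin (fun ls => symbol phi N ls v).

(* The Taylor coefficients at [y] of the polynomial one-form of degree [< N]
   whose coefficients at [0] are [phi]. *)
Definition shift_family phi N y : forall k, clinear (TV k.+1) U := fun k =>
  \sum_(r < N - k) (r`!%:R)^-1 *: tmul_pre k.+1 (phi (r + k)%N) (tpower TV r y).

Lemma symbolE phi N n ls v : size ls = n -> (n < N)%N ->
  phi n (tlist TV n.+1 (rcons ls v)) = symbol phi N ls v.
Proof. by move=> <- nN; rewrite /symbol nN. Qed.

Lemma symbol_big phi N ls v : (N <= size ls)%N -> symbol phi N ls v = 0.
Proof. by move=> h; rewrite /symbol ltnNge h. Qed.

Lemma eq_symbol phi psi N : (forall ls v, symbol phi N ls v = symbol psi N ls v) ->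
  forall k, (k < N)%N -> phi k = psi k.
Proof.
move=> pp k kN; apply: clinear_ext; apply: tlist_ext; [solve_lcont|solve_lcont|].
case/lastP => // ls v; rewrite size_rcons => -[sls].
by rewrite !(symbolE _ _ sls kN).
Qed.

Lemma eq_lift_series phi psi N s : (forall k, (k < N)%N -> phi k = psi k) ->
  lift_series OT phi N s = lift_series OT psi N s.
Proof.
move=> pp; apply: tseries_ext => l; apply: eq_bigr => k _.
rewrite /lift_op /kotens.
have -> // : (fun i => phi (k i)) = (fun i => psi (k i)).
by apply: functional_extensionality_dep => i; exact: pp.
Qed.

Lemma symbol_shift phi N y ls v : symbol (shift_family phi N y) N ls v =
  \sum_(r < N) (r`!%:R)^-1 *: symbol phi N (nseq r y ++ ls) v.
Proof.
have [big|small] := leqP N (size ls).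
  rewrite symbol_big // big1 // => r _; rewrite symbol_big ?scaler0 //.
  by rewrite size_cat (leq_trans big) // leq_addl.
rewrite {1}/symbol small clinear_sumE.
rewrite (big_ord_widen N (fun r => ((r`!%:R)^-1 *:
   tmul_pre (size ls).+1 (phi (r + size ls)%N) (tpower TV r y))
     (tlist TV (size ls).+1 (rcons ls v)))) ?leq_subr //.
rewrite big_mkcond; apply: eq_bigr => r _; case: ifP => [rN|/negbT rN].
  rewrite -(@symbolE _ _ (r + size ls)%N); last by lia.
    rewrite -[LHS]/(_ *: phi _ (homog _ _)); congr (_ *: phi _ _).
    rewrite tpower_tlist tmul_tlist ?size_nseq // homog_tlist ?addnS //.
    by rewrite rcons_cat.
  by rewrite size_cat size_nseq.
rewrite symbol_big ?scaler0 // size_cat size_nseq.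
by rewrite -leq_subLR -leqNgt in rN *; lia.
Qed.

Lemma sym_shift phi N y : sym_family phi N -> sym_family (shift_family phi N y) N.
Proof.
move=> sp v.
have -> : (fun ls => symbol (shift_family phi N y) N ls v) = fun ls =>
    \sum_(r < N) (r`!%:R)^-1 *: symbol phi N (nseq r y ++ ls) v.
  by apply/funext => ls; rewrite symbol_shift.
apply: (symlin_sum _ xpredT
  (F := fun (r : 'I_N) ls => (r`!%:R)^-1 *: symbol phi N (nseq r y ++ ls) v)) => r.
apply: (symlin_scale _ (F := fun ls => symbol phi N (nseq r y ++ ls) v)).
have -> : (fun ls => symbol phi N (nseq r y ++ ls) v) =
    fun ls => symbol phi N (ls ++ nseq r y) v.
  by apply/funext => ls; apply: (sp v).1; rewrite perm_catC.
exact: (symlin_cat _ (sp v)).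
Qed.

Lemma symbol_shift0 phi N ls v : sym_family phi N ->
  symbol (shift_family phi N 0) N ls v = symbol phi N ls v.
Proof.
move=> sp; rewrite symbol_shift; case: N sp => [|N] sp.
  by rewrite big_ord0 symbol_big.
rewrite big_ord_recl fact0 invr1 scale1r big1 ?addr0 // => r _.
rewrite -[X in nseq _ X](scale0r (0 : V)) (symlin_nseqZ _ _ _ _ (sp v)).
by rewrite /bump /= expr0n /= scale0r scaler0.
Qed.

(** With [n = q + r] the coefficients agree because [C(n, r) / n! = 1 / (q! r!)]; terms with
    [q + r >= N] vanish on both sides. *)
Lemma symbol_shiftD phi N y z ls v : sym_family phi N ->
  symbol (shift_family (shift_family phi N y) N z) N ls v =
  symbol (shift_family phi N (y + z)) N ls v.
Proof.
move=> sp; rewrite !symbol_shift.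
pose T q r := symbol phi N (nseq q y ++ nseq r z ++ ls) v.
have T0 q r : (N <= q + r)%N -> T q r = 0.
  by move=> qr; rewrite /T symbol_big // !size_cat !size_nseq; lia.
transitivity (\sum_(n < N) \sum_(r < N) \sum_(q < N) (if (q + r == n)%N then
    (r`!%:R)^-1 *: ((q`!%:R)^-1 *: T q r) else 0)).
  rewrite exchange_big; apply: eq_bigr => r _ /=.
  rewrite exchange_big symbol_shift scaler_sumr; apply: eq_bigr => q _ /=.
  have [qr|qr] := ltnP (q + r) N; last first.
    by rewrite -/(T q r) T0 // !scaler0 big1 // => n _; case: ifP.
  rewrite (bigD1 (Ordinal qr)) //= eqxx big1 ?addr0 // => n nqr.
  by rewrite ifN // eq_sym; apply: contra nqr => /eqP nqr; apply/eqP/val_inj.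
apply: eq_bigr => n _; rewrite (symlin_binom y z n ls (sp v)) scaler_sumr.
rewrite (big_ord_widen N (fun r => (n`!%:R)^-1 *: ('C(n, r)%:R *:
   symbol phi N (nseq r z ++ nseq (n - r) y ++ ls) v))) // [RHS]big_mkcond.
apply: eq_bigr => r _ /=; case: ifP => [|/negbT]; last first.
  rewrite -leqNgt => nr; apply: big1 => q _; rewrite ifN //.
  by apply/negP => /eqP qrn; move: nr; rewrite -qrn ltnNge leq_addl.
rewrite ltnS => rn.
have qN : (n - r < N)%N by apply: leq_ltn_trans (ltn_ord n); exact: leq_subr.
rewrite (bigD1 (Ordinal qN)) //= subnK // eqxx big1 ?addr0; last first.
  move=> q qnr; rewrite ifN //; apply: contra qnr => /eqP qrn.
  by apply/eqP/val_inj; rewrite /= -qrn addnK.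
have -> : symbol phi N (nseq r z ++ nseq (n - r) y ++ ls) v = T (n - r)%N r.
  apply: (sp v).1.
  exact: (permEl (perm_catCA (nseq r z) (nseq (n - r) y) ls)).
rewrite !scalerA; congr (_ *: _).
rewrite -(bin_fact rn) !natrM; field.
by rewrite !pnatr_eq0 -!lt0n !fact_gt0 bin_gt0.
Qed.

(** The letters of [a] precede those of [vs], so they fall into symmetric arguments of [phi]. By
    [grouplike_sym], [r] of them act as [y ^ r / r!], which is Taylor expansion at [y]. *)
Lemma head_op_shift phi N a y vs v : sym_family phi N -> grouplike a ->
  a 1%N = vtens TV y ->
  head_op (shift_family phi N y) N (tslist TV (rcons vs v)) =
  head_op phi N (tsmul a (tslist TV (rcons vs v))).
Proof.
move=> sp ga a1; pose k := size vs.
have -> : head_op (shift_family phi N y) N (tslist TV (rcons vs v)) =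
    symbol (shift_family phi N y) N vs v.
  rewrite /head_op /symbol; case: ifP => [kN|/negbT kN]; last first.
    apply: big1 => j _; rewrite /tslist homog_neq ?linear0 // size_rcons eqSS.
    by rewrite gtn_eqF // (leq_trans (ltn_ord j)) // leqNgt.
  rewrite (bigD1 (Ordinal kN)) //= big1 ?addr0.
    by rewrite /tslist homog_tlist // size_rcons.
  move=> j jk; rewrite /tslist homog_neq ?linear0 // size_rcons eqSS.
  by apply: contra jk => /eqP jk; apply/eqP/val_inj.
rewrite symbol_shift /head_op.
transitivity (\sum_(j < N) \sum_(r < N) if (r + k == j)%N then
   (r`!%:R)^-1 *: symbol phi N (nseq r y ++ vs) v else 0).
  rewrite exchange_big; apply: eq_bigr => r _ /=.
  have [rk|rk] := ltnP (r + k) N; last first.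
    by rewrite symbol_big ?size_cat ?size_nseq // scaler0 big1 // => j _; case: ifP.
  rewrite (bigD1 (Ordinal rk)) //= eqxx big1 ?addr0 // => j jrk.
  by rewrite ifN // eq_sym; apply: contra jrk => /eqP jrk; apply/eqP/val_inj.
apply: eq_bigr => j _; rewrite tsmul_homogr size_rcons ltnS subSS -/k.
case: ifP => [kj|/negbT kj]; last first.
  rewrite linear0 big1 // => r _; rewrite ifN //; apply: contraNneq kj => <-.
  exact: leq_addl.
have rN : (j - k < N)%N by apply: leq_ltn_trans (ltn_ord j); exact: leq_subr.
rewrite (bigD1 (Ordinal rN)) //= subnK // eqxx big1 ?addr0; last first.
  move=> r rjk; rewrite ifN //; apply: contra rjk => /eqP rjk.
  by apply/eqP/val_inj; rewrite /= -rjk addnK.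
have fE ls : size ls = (j - k)%N ->
    phi j (homog (tmul (tlist TV (j - k) ls) (tlist TV k.+1 (rcons vs v))) j.+1) =
    symbol phi N (ls ++ vs) v.
  move=> sls; rewrite tmul_tlist // homog_tlist; last by rewrite addnS subnK.
  by rewrite -rcons_cat (@symbolE _ N) // size_cat sls subnK.
rewrite (grouplike_sym (f := fun x =>
  phi j (homog (tmul x (tlist TV k.+1 (rcons vs v))) j.+1)) ga a1).
- by rewrite tpower_tlist fE // size_nseq.
- by solve_lcont.
move=> ls ls' sls lsP; rewrite !fE // -?(perm_size lsP) //.
by apply: (sp v).1; rewrite perm_cat2r.
Qed.

Lemma lift_series_shift phi N a b y : sym_family phi N -> grouplike a ->
  a 1%N = vtens TV y ->
  lift_series OT phi N (tsmul a b) =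
  tsmul (lift_series OT phi N a) (lift_series OT (shift_family phi N y) N b).
Proof.
by move=> sp ga a1; apply: lift_series_mul => // vs v; exact: head_op_shift.
Qed.

(* [phi] are the coefficients at [x], so that [shift_family phi N (- x)] are
   those at [0], which define the lift. *)
Lemma lift_series_increment phi N a b (x : V) : sym_family phi N -> grouplike a ->
  a 1%N = vtens TV x ->
  tsmul (tsinv (lift_series OT (shift_family phi N (- x)) N a))
        (lift_series OT (shift_family phi N (- x)) N b) =
  lift_series OT phi N (tsmul (tsinv a) b).
Proof.
move=> sp ga a1; have a0 : a 0%N = tunit by rewrite ga.1 tsone0.
have [aV Va] := tsinvP a0.
rewrite -[in LHS](tsmul1l b) -aV tsmulA.
rewrite (lift_series_shift _ (sym_shift _ sp) ga a1) -tsmulA.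
rewrite (tsinvP (lift_series0 _ _ _ a0)).2 tsmul1l; apply: eq_lift_series.
apply: eq_symbol => ls v; rewrite symbol_shiftD // addNr.
exact: symbol_shift0.
Qed.

(** Chen's relation is exact as long as the coefficients are transported from [x] to [y]. Using the
    coefficients of [theta] at [y] instead is the only source of error in almost
    multiplicativity. *)
Lemma lift_series_chen phi N a b c (x y : V) : sym_family phi N -> grouplike a ->
  grouplike b -> a 1%N = vtens TV x -> b 1%N = vtens TV y ->
  lift_series OT phi N (tsmul (tsinv a) c) =
  tsmul (lift_series OT phi N (tsmul (tsinv a) b))
    (lift_series OT (shift_family phi N (y - x)) N (tsmul (tsinv b) c)).
Proof.
move=> sp ga gb a1 b1.
have b0 : b 0%N = tunit by rewrite gb.1 tsone0.
rewrite -!(lift_series_increment _ sp ga a1) tsmulA; congr tsmul.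
rewrite -{1}(tsmul1l c) -(tsinvP b0).1 tsmulA.
rewrite (lift_series_shift _ (sym_shift _ sp) gb b1); congr tsmul.
apply: eq_lift_series; apply: eq_symbol => ls v.
by rewrite symbol_shiftD // addrC.
Qed.

End ShiftedFamily.

(** * Derivatives of the Taylor one-form *)

(** The difference quotient is a polynomial in [h] with constant term [c 1]; the range [n.+2]
    guarantees that this coefficient occurs. *)
Lemma derive_polynomial (R : realType) (E W : normedModType R) (f : E -> W)
    (y v : E) n (c : nat -> W) :
  (forall h : R, f (h *: v + y) = \sum_(q < n.+2) h ^+ q *: c q) ->
  'D_v f y = c 1%N.
Proof.
move=> fE.
have f0 : f y = c 0%N.
  have := fE 0; rewrite scale0r add0r => ->.
  rewrite big_ord_recl expr0 scale1r big1 ?addr0 // => q _.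
  by rewrite /bump /= expr0n /= scale0r.
apply: cvg_lim; first exact: norm_hausdorff.
pose g (h : R) := \sum_(q < n.+1) h ^+ q *: c q.+1.
have g0 : g 0 = c 1%N.
  rewrite /g big_ord_recl expr0 scale1r big1 ?addr0 // => q _.
  by rewrite /bump /= expr0n /= scale0r.
have gc : {for 0, continuous g}.
  rewrite /prop_for /continuous_at /g.
  elim: (index_enum _) => [|q r IH].
    by under eq_fun do rewrite big_nil; rewrite big_nil; exact: cvg_cst.
  under eq_fun do rewrite big_cons; rewrite big_cons.
  by apply: cvgD => //; apply: cvgZr_tmp; exact: exprn_continuous.
apply: cvg_trans (_ : g h @[h --> 0^'] --> _); last first.
  rewrite -g0; apply: cvg_trans gc; apply: cvg_app; exact: nbhs_dnbhs.
apply: near_eq_cvg; near=> h.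
have h0 : h != 0 by near: h; exact: nbhs_dnbhs_neq.
rewrite /= fE f0 big_ord_recl expr0 scale1r [c _ + _]addrC addrK.
rewrite scaler_sumr; apply: eq_bigr => q _.
by rewrite scalerA exprS mulrA mulVf // mul1r.
Unshelve. all: by end_near. Qed.

Section TaylorOneform.
Context {R : realType} {V U : completeNormedModType R}.
Context {TV : tensorPowers V} {TU : tensorPowers U}.
Variable OT : operatorTensors TV TU.
Implicit Types (n m l N : nat) (vs ls : seq V) (s : tseries TV).

Lemma tsnoc_tlist j ls (w : V) : size ls = j ->
  tsnoc (tlist TV j ls) w = tlist TV j.+1 (rcons ls w).
Proof.
move=> sls; rewrite /tsnoc vtens_tlist tmul_tlist // homog_tlist ?addn1 //.
by rewrite cats1.
Qed.

Lemma lcont_tsnoc j (w : V) : lcont (fun a : TV j => tsnoc a w).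
Proof. by rewrite /tsnoc; solve_lcont. Qed.

Lemma lcont_eval (E F : normedModType R) (x : E) :
  lcont (fun f : clinear E F => f x).
Proof.
apply: (@bounded_lcont _ _ _ _ `|x|) => [a f g //|f].
by rewrite mulrC; exact: ler_opnorm.
Qed.

(** Uniqueness identifies the operator that [xget] picks in [uncurry_op]. *)
Lemma regarded_as_uniq j (B : TV j -> clinear V U) (A A' : clinear (TV j.+1) U) :
  regarded_as B A -> regarded_as B A' -> A = A'.
Proof.
move=> BA BA'; apply: clinear_ext; apply: tlist_ext; [solve_lcont|solve_lcont|].
case/lastP => // ls w; rewrite size_rcons => -[sls].
by rewrite -tsnoc_tlist // BA BA'.
Qed.

Lemma uncurry_opP j (B : clinear (TV j) (clinear V U)) (A : clinear (TV j.+1) U) :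
  regarded_as B A -> uncurry_op B = A.
Proof.
move=> BA; apply: (regarded_as_uniq _ BA).
by apply: (xgetPex 0 (P := [set A | regarded_as B A])); exists A.
Qed.

Lemma DopP k (q : V -> clinear V U) (x : V) (B : clinear (TV k) (clinear V U)) :
  (forall vs, size vs = k -> B (tlist TV k vs) = iter_derive q vs x) ->
  Dop k q x = B.
Proof.
move=> BE; have BE' (v : 'I_k -> V) :
    B (tens TV v) = iter_derive q [seq v i | i <- enum 'I_k] x.
  by rewrite tlist_enum BE // size_map size_enum_ord.
have DE := xgetPex 0 (P := [set B : clinear (TV k) (clinear V U) |
  forall v : 'I_k -> V,
    B (tens TV v) = iter_derive q [seq v i | i <- enum 'I_k] x])
  (ex_intro _ B BE').
apply: clinear_ext; apply: tlist_ext; [solve_lcont|solve_lcont|move=> vs svs].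
by rewrite [LHS]DE [RHS]BE'.
Qed.

Lemma oneform_liftE n (q : V -> clinear V U) s : s 0%N = tunit ->
  oneform_lift OT n q s =
  lift_series OT (fun k => uncurry_op (Dop k q 0)) n.+1 s.
Proof.
move=> s0; apply: tseries_ext => -[|l]; first by rewrite /= lift_series0 // tsone0.
by apply: eq_bigr => k _; rewrite -lift_termE.
Qed.

Section SymmetricCoefficients.
Variables (N : nat) (B : forall j, clinear (TV j) (clinear V U)).
Hypothesis B_sym : forall j (s : 'S_j) (a : TV j), (j < N)%N ->
  B j (tact TV s a) = B j a.
Hypothesis B_op : forall j, (j < N)%N -> exists A, regarded_as (B j) A.

(** Cut off at [N] like [symbol], so that the range of the sums below does not depend on
    [size ls]. *)
Definition coef ls : clinear V U :=
  if (size ls < N)%N then B (size ls) (tlist TV (size ls) ls) else 0.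

Lemma coefE j ls : size ls = j -> (j < N)%N -> B j (tlist TV j ls) = coef ls.
Proof. by move=> <- h; rewrite /coef h. Qed.

Lemma coef_big ls : (N <= size ls)%N -> coef ls = 0.
Proof. by move=> h; rewrite /coef ltnNge h. Qed.

Lemma symlin_coef : symlin coef.
Proof.
split=> [ls ls' lsP|ls a x y].
  have [big|small] := leqP N (size ls).
    by rewrite !coef_big // -(perm_size lsP).
  move: lsP; rewrite perm_sym => /(perm_iotaP 0)[w wP ->].
  have [s ->] := pword_surj wP.
  rewrite -(coefE (j := size ls)) // -(coefE (j := size ls)) //.
    by rewrite -tact_tlist B_sym.
  by rewrite size_map size_pword.
rewrite /coef /=; case: ifP => _; last by rewrite scaler0 addr0.
have E u : tlist TV (size ls).+1 (u :: ls) = tmul (vtens TV u) (tlist TV (size ls) ls).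
  by rewrite vtens_tlist tmul_tlist.
have h : lcont (fun u => B (size ls).+1 (tmul (vtens TV u) (tlist TV (size ls) ls))).
  exact: (lcont_comp (lcont_clinear (B (size ls).+1))
    (lcont_comp (lcont_tmull 1 (tlist TV (size ls) ls)) (lcont_vtens TV))).
by rewrite !E h.1.
Qed.

Lemma uncurry_coef j ls v : size ls = j -> (j < N)%N ->
  uncurry_op (B j) (tlist TV j.+1 (rcons ls v)) = coef ls v.
Proof.
move=> sls jN; have [A BA] := B_op jN.
by rewrite (uncurry_opP BA) -tsnoc_tlist // BA (coefE sls jN).
Qed.

Lemma symbol_uncurry ls v :
  symbol (fun j => uncurry_op (B j)) N ls v = coef ls v.
Proof.
have [big|small] := leqP N (size ls); first by rewrite symbol_big // coef_big.
by rewrite /symbol small uncurry_coef.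
Qed.

Lemma sym_family_uncurry : sym_family (fun j => uncurry_op (B j)) N.
Proof.
move=> v; have [h1 h2] := symlin_coef; split=> [ls ls' lsP|ls a x y].
  by rewrite !symbol_uncurry (h1 _ _ lsP).
by rewrite !symbol_uncurry h2.
Qed.

Lemma sum_coefE k vs y : (k < N)%N -> size vs = k ->
  \sum_(l < N - k) (l`!%:R)^-1 *: B (k + l)%N (tmul (tlist TV k vs) (tpower TV l y)) =
  \sum_(l < N) (l`!%:R)^-1 *: coef (vs ++ nseq l y).
Proof.
move=> kN svs; rewrite (big_ord_widen N (fun l => (l`!%:R)^-1 *:
  B (k + l)%N (tmul (tlist TV k vs) (tpower TV l y)))) ?leq_subr //.
rewrite big_mkcond; apply: eq_bigr => l _; case: ifP => [lN|/negbT lN].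
  rewrite tpower_tlist tmul_tlist // (@coefE (k + l)%N) //; last by lia.
  by rewrite size_cat size_nseq svs.
by rewrite coef_big ?scaler0 // size_cat size_nseq svs; lia.
Qed.

Lemma lcont_sum_coef k y : lcont (fun a : TV k => \sum_(l < N - k)
  (l`!%:R)^-1 *: B (k + l)%N (tmul a (tpower TV l y))).
Proof.
apply: (lcont_sum _ xpredT (f := fun (l : 'I_(N - k)) (a : TV k) =>
  (l`!%:R)^-1 *: B (k + l)%N (tmul a (tpower TV l y)))) => l.
by solve_lcont.
Qed.

Lemma regarded_shift k y : (k < N)%N ->
  regarded_as (fun a => \sum_(l < N - k)
      (l`!%:R)^-1 *: B (k + l)%N (tmul a (tpower TV l y)))
    (shift_family (fun j => uncurry_op (B j)) N y k).
Proof.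
move=> kN a w; move: a; apply: tlist_ext.
- apply: (lcont_comp (lcont_clinear _)); exact: lcont_tsnoc.
- exact: (lcont_comp (@lcont_eval V U w)
    (lcont_clinear (to_clinear (lcont_sum_coef k y)))).
move=> vs svs; rewrite tsnoc_tlist // (symbolE _ _ svs kN) symbol_shift.
rewrite sum_coefE // clinear_sumE.
apply: eq_bigr => l _; rewrite symbol_uncurry.
rewrite -[RHS]/(_ *: coef _ w); congr (_ *: clinear_fun _ w).
by apply: symlin_coef.1; rewrite perm_catC.
Qed.

Variables (x : V) (q : V -> clinear V U).
Hypothesis qE : forall y,
  q y = \sum_(l < N) (l`!%:R)^-1 *: B l (tpower TV l (y - x)).

Lemma iter_derive_taylor vs y :
  iter_derive q vs y = \sum_(l < N) (l`!%:R)^-1 *: coef (vs ++ nseq l (y - x)).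
Proof.
elim: vs y => [|v vs IH] y.
  rewrite /= qE; apply: eq_bigr => l _.
  by rewrite tpower_tlist (coefE (size_nseq _ _)).  
(* The coefficient of [h ^+ i] in the expansion of [iter_derive q vs] at [h *: v + y]. *)
pose c i := \sum_(l < N) (l`!%:R)^-1 *:
  ('C(l, i)%:R *: coef (nseq i v ++ nseq (l - i) (y - x) ++ vs)).
have -> : iter_derive q (v :: vs) y = c 1%N.
  apply: (derive_polynomial (f := iter_derive q vs) (n := N)) => h.
  rewrite IH.
  under [RHS]eq_bigr do rewrite scaler_sumr.
  rewrite exchange_big; apply: eq_bigr => l _ /=.
  have -> : coef (vs ++ nseq l (h *: v + y - x)) =
      coef (nseq l ((y - x) + h *: v) ++ vs).
    rewrite -addrA [h *: v + _]addrC.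
    by apply: symlin_coef.1; rewrite perm_catC.
  rewrite (symlin_binom _ _ _ _ symlin_coef).
  rewrite scaler_sumr (big_ord_widen N.+2 (fun i => l`!%:R^-1 *:
    ('C(l, i)%:R *: coef (nseq i (h *: v) ++ nseq (l - i) (y - x) ++ vs)))).
    rewrite big_mkcond; apply: eq_bigr => i _.
    case: ifP => [_|/negbT il]; last first.
      by rewrite bin_small ?scale0r ?scaler0 // ltnNge -ltnS.
    rewrite (symlin_nseqZ _ _ _ _ symlin_coef) !scalerA; congr (_ *: _).
    by rewrite mulrC mulrA.
  by have := ltn_ord l; lia.
(* Differentiation lowers the power by one, so the index [l] is shifted; the additional term [l = N]
   vanishes by the cut-off of [coef]. *)
pose h l := (l`!%:R)^-1 *:
  ('C(l, 1)%:R *: coef (v :: nseq (l - 1) (y - x) ++ vs)).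
have hN : h N = 0.
  have [N0|N0] := posnP N; first by rewrite /h bin_small ?N0 // scale0r scaler0.
  rewrite /h coef_big ?scaler0 //= size_cat size_nseq; lia.
have hE : \sum_(l < N.+1) h l = \sum_(l < N) h l.
  by rewrite big_ord_recr /= hN addr0.
rewrite -[LHS]/(\sum_(l < N) h l) -hE big_ord_recl.
rewrite {1}/h bin_small // scale0r scaler0 add0r; apply: eq_bigr => l _.
rewrite /h lift0 bin1 subn1 scalerA; congr (_ *: _); last first.
  by apply: symlin_coef.1; rewrite perm_cons perm_catC.
by rewrite factS natrM invfM mulrAC mulVf ?mul1r // pnatr_eq0.
Qed.

(** The polynomial is centred at [x], whereas the lift uses derivatives at 0, hence the shift by
    [- x]. *)
Lemma uncurry_Dop_taylor k : (k < N)%N ->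
  uncurry_op (Dop k q 0) =
  shift_family (fun j => uncurry_op (B j)) N (- x) k.
Proof.
move=> kN; rewrite (DopP (B := to_clinear (lcont_sum_coef k (- x)))).
  by apply: uncurry_opP; exact: regarded_shift.
by move=> vs svs; rewrite iter_derive_taylor sub0r; exact: sum_coefE.
Qed.

End SymmetricCoefficients.
End TaylorOneform.

(** * Sewing *)

Section TensorSeriesNorms.
Context {R : realType} {V : completeNormedModType R} {TV : tensorPowers V}.
Implicit Types (P Q : tseries TV) (K L E : R).

Lemma norm_tsmulB P P' Q Q' i :
  `|tsmul P Q i - tsmul P' Q' i| <= \sum_(a < i.+1)
    (`|P a - P' a| * `|Q (i - a)%N| + `|P' a| * `|Q (i - a)%N - Q' (i - a)%N|).
Proof.
rewrite -sumrB; apply: le_trans (ler_norm_sum _ _ _) _; apply: ler_sum => a _.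
rewrite -homog_sub; apply: le_trans (ler_norm_homog _ _) _.
have -> : tmul (P a) (Q (i - a)%N) - tmul (P' a) (Q' (i - a)%N) =
    tmul (P a - P' a) (Q (i - a)%N) + tmul (P' a) (Q (i - a)%N - Q' (i - a)%N).
  by rewrite tmulBl tmulBr addrA subrK.
apply: le_trans (ler_normD _ _) _.
by apply: lerD; exact: ler_norm_tmul.
Qed.

Lemma tsmul_le P Q i K L : 0 <= K ->
  (forall a, (a <= i)%N -> `|P a| <= K) -> (forall a, (a <= i)%N -> `|Q a| <= L) ->
  `|tsmul P Q i| <= i.+1%:R * (K * L).
Proof.
move=> K0 PK QL; apply: le_trans (norm_tsmul _ _ _) _.
rewrite -[i.+1 in leRHS]card_ord -sum1_card natr_sum mulr_suml.
apply: ler_sum => a _; rewrite mul1r.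
apply: ler_pM => //; first by apply: PK; rewrite -ltnS.
by apply: QL; rewrite leq_subr.
Qed.

Lemma tsmulBr_le P Q Q' i K E : 0 <= K ->
  (forall a, (a <= i)%N -> `|P a| <= K) ->
  (forall a, (a <= i)%N -> `|Q a - Q' a| <= E) ->
  `|tsmul P Q i - tsmul P Q' i| <= i.+1%:R * (K * E).
Proof.
move=> K0 PK QE; apply: le_trans (norm_tsmulB _ _ _ _ _) _.
rewrite -[i.+1 in leRHS]card_ord -sum1_card natr_sum mulr_suml.
apply: ler_sum => a _; rewrite mul1r subrr normr0 mul0r add0r.
apply: ler_pM => //; first by apply: PK; rewrite -ltnS.
by apply: QE; rewrite leq_subr.
Qed.

Lemma tsmulBl_le P P' Q i K E : 0 <= E ->
  (forall a, (a <= i)%N -> `|P a - P' a| <= E) ->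
  (forall a, (a <= i)%N -> `|Q a| <= K) ->
  `|tsmul P Q i - tsmul P' Q i| <= i.+1%:R * (E * K).
Proof.
move=> E0 PE QK; apply: le_trans (norm_tsmulB _ _ _ _ _) _.
rewrite -[i.+1 in leRHS]card_ord -sum1_card natr_sum mulr_suml.
apply: ler_sum => a _; rewrite mul1r subrr normr0 mulr0 addr0.
apply: ler_pM => //; first by apply: PE; rewrite -ltnS.
by apply: QK; rewrite leq_subr.
Qed.

(* The differences of degree [i] enter with coefficient [1]; this is what makes
   the induction on the degree in [sewing_estimate] close. *)
Lemma tsmulB_top P P' Q Q' i K E : 0 <= K -> 0 <= E ->
  P 0%N = tunit -> P' 0%N = tunit -> Q 0%N = tunit -> Q' 0%N = tunit ->
  (forall a, (a < i)%N -> `|P' a| <= K) -> (forall a, (a < i)%N -> `|Q a| <= K) ->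
  (forall a, (a < i)%N -> `|P a - P' a| <= E) ->
  (forall a, (a < i)%N -> `|Q a - Q' a| <= E) ->
  `|tsmul P Q i - tsmul P' Q' i| <=
    `|P i - P' i| + `|Q i - Q' i| + i.+1%:R * (2 * (K * E)).
Proof.
move=> K0 E0 p0 p'0 q0 q'0 PK QK PE QE.
apply: le_trans (norm_tsmulB _ _ _ _ _) _.
rewrite -[i.+1 in leRHS]card_ord -sum1_card natr_sum mulr_suml.
have -> : `|P i - P' i| + `|Q i - Q' i| = \sum_(a < i.+1)
    ((if a == ord_max then `|P i - P' i| else 0) +
     (if a == ord0 then `|Q i - Q' i| else 0)).
  by rewrite big_split -!big_mkcond /= !big_pred1_eq.
rewrite -big_split; apply: ler_sum => a _ /=; rewrite mul1r.
have KE0 : 0 <= K * E by exact: mulr_ge0.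
case: eqP => [->|am] /=.
  rewrite subnn q0 q'0 norm_tunit mulr1 subrr normr0 mulr0 addr0 -addrA lerDl.
  by apply: addr_ge0; [case: ifP|rewrite mulr_ge0].
case: eqP => [->|a0] /=.
  rewrite subn0 p0 p'0 norm_tunit subrr normr0 mul0r !add0r mul1r lerDl.
  by rewrite mulr_ge0.
have a0' : (0 < a)%N by rewrite lt0n; apply/eqP => e; apply: a0; exact/val_inj.
have ai : (a < i)%N.
  rewrite ltn_neqAle -ltnS ltn_ord andbT; apply/eqP => e; apply: am.
  exact/val_inj.
have ia : (i - a < i)%N by rewrite ltn_subrL a0' (leq_ltn_trans _ ai).
rewrite !add0r mulr2n mulrDl mul1r {1}(mulrC K).
by apply: lerD; apply: ler_pM => //; [exact: PE|exact: QK|exact: PK|exact: QE].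
Qed.

End TensorSeriesNorms.

(** Constants are given degree by degree; the products mix all lower degrees and need a common
    one. *)
Lemma exists_uniform_bound (R : realType) (Q : nat -> R -> Prop) i :
  (forall j C C', C <= C' -> Q j C -> Q j C') ->
  (forall j, (j < i)%N -> exists2 C, 0 <= C & Q j C) ->
  exists2 C, 0 <= C & forall j, (j < i)%N -> Q j C.
Proof.
move=> Qm; elim: i => [_|i IH h]; first by exists 0.
have [j ji|C C0 QC] := IH; first by apply: h; rewrite ltnS ltnW.
have [C' C'0 QC'] := h i (ltnSn i).
exists (C + C'); first exact: addr_ge0.
move=> j; rewrite ltnS leq_eqVlt => /orP[/eqP ->|ji].
  by apply: Qm QC'; rewrite lerDr.
by apply: Qm (QC j ji); rewrite lerDl.
Qed.

Section Sewing.
Context {R : realType} {V : completeNormedModType R} {TV : tensorPowers V}.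
Implicit Types (s t u : R) (D : seq R).
Variables (om : R -> R -> R) (tau : R) (Z : R -> R -> tseries TV).
Hypothesis om_control : control om.
Hypothesis tau_gt1 : 1 < tau.
Hypothesis Zxx : forall s, 0 <= s -> s <= 1 -> Z s s = tsone TV.
Hypothesis Z0 : forall s t, 0 <= s -> s <= t -> t <= 1 -> Z s t 0%N = tunit.
Hypothesis Z_bounded : forall i, exists2 C : R, 0 <= C &
  forall s t, 0 <= s -> s <= t -> t <= 1 -> `|Z s t i| <= C.
Hypothesis Z_almost_mult : forall i, exists2 C : R, 0 <= C &
  forall s u t, 0 <= s -> s <= u -> u <= t -> t <= 1 ->
    `|tsmul (Z s u) (Z u t) i - Z s t i| <= C * om s t `^ tau.

Lemma control_mono s s' t' t : 0 <= s -> s <= s' -> s' <= t' -> t' <= t -> t <= 1 ->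
  om s' t' <= om s t.
Proof.
case: om_control => om0 _ omD _ s0 ss st tt t1.
have t'1 := le_trans tt t1; have s'0 := le_trans s0 ss.
have h1 := omD s' t' t s'0 st tt t1.
have h2 := omD s s' t s0 ss (le_trans st tt) t1.
have h3 := om0 t' t (le_trans s'0 st) tt t1.
have h4 := om0 s s' s0 ss (le_trans st t'1).
lra.
Qed.

Let om_ge0 := control_ge0 om_control.

Let tau_gt0 : 0 < tau. Proof. exact: lt_trans tau_gt1. Qed.

Lemma control_powR_mono s s' t' t : 0 <= s -> s <= s' -> s' <= t' -> t' <= t ->
  t <= 1 -> om s' t' `^ tau <= om s t `^ tau.
Proof.
move=> s0 ss st tt t1; apply: ge0_ler_powR; first exact: ltW.
- by rewrite nnegrE om_ge0 // ?(le_trans s0) // (le_trans tt).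
- by rewrite nnegrE om_ge0 // (le_trans ss) // (le_trans st).
exact: control_mono.
Qed.

Fixpoint path_prod s (D : seq R) : tseries TV :=
  if D is t :: D' then tsmul (Z s t) (path_prod t D') else tsone TV.

Lemma path_prod_cat s D1 D2 :
  path_prod s (D1 ++ D2) = tsmul (path_prod s D1) (path_prod (last s D1) D2).
Proof.
elim: D1 s => [|t D1 IH] s /=; first by rewrite tsmul1l.
by rewrite IH tsmulA.
Qed.

Lemma path_prod0 s t D : 0 <= s -> t <= 1 -> itv_partition s t D ->
  path_prod s D 0%N = tunit.
Proof.
elim: D s => [|u D IH] s s0 t1; first by rewrite /= tsone0.
move=> Dp; have su : s <= u by case: Dp => /= /andP[/ltW].
have ut := itv_partition_le (itv_partition_cons Dp).
rewrite /= tsmul_one0 ?Z0 // ?(le_trans ut) //.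
by apply: IH => //; [exact: le_trans su|exact: itv_partition_cons Dp].
Qed.

Lemma partition_catP s t D1 D2 : itv_partition s t (D1 ++ D2) ->
  itv_partition s (last s D1) D1 /\ itv_partition (last s D1) t D2.
Proof.
by rewrite /itv_partition cat_path last_cat => -[/andP[-> ->] ->].
Qed.

(** [u] is the first partition point with [om u t <= om s t / 2]. If a point precedes it, the bound
    fails there, and super-additivity gives the other half; otherwise [last s D1] is [s] and
    [om s s = 0]. *)
Lemma partition_halves s t D : 0 <= s -> t <= 1 -> itv_partition s t D ->
  D != [::] -> exists D1 u D2, [/\ D = D1 ++ u :: D2,
    om s (last s D1) <= om s t / 2 & om u t <= om s t / 2].
Proof.
move=> s0 t1 Dp Dn.
suff H D2 D1 : D = D1 ++ D2 -> D2 != [::] -> om s (last s D1) <= om s t / 2 ->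
    exists D1 u D2, [/\ D = D1 ++ u :: D2,
    om s (last s D1) <= om s t / 2 & om u t <= om s t / 2].
  have st := itv_partition_le Dp.
  apply: (H D [::]) => //=; rewrite (control_diag om_control) ?divr_ge0 //.
    by rewrite om_ge0.
  exact: le_trans st t1.
elim: D2 D1 => [//|u D2 IH] D1 DE _ h1.
have [Dp1 Dp2] : itv_partition s u (rcons D1 u) /\ itv_partition u t D2.
  by move: Dp; rewrite DE -cat_rcons => /partition_catP; rewrite last_rcons.
have su := itv_partition_le Dp1; have ut := itv_partition_le Dp2.
have [h|h] := leP (om u t) (om s t / 2); first by exists D1, u, D2.
have [D20|D2n] := eqVneq D2 [::].
  have ut' : u = t by apply: itv_partition_nil; rewrite -D20.
  move: h; rewrite ut' (control_diag om_control) ?(le_trans s0) //; last first.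
    by rewrite -ut'.
  by rewrite ltNge divr_ge0 // om_ge0 // (le_trans su).
apply: (IH (rcons D1 u)) => //; first by rewrite cat_rcons.
rewrite last_rcons.
have := control_superadditive om_control s0 su ut t1.
move: h; lra.
Qed.

Lemma powR_half (x : R) : 0 <= x -> (x / 2) `^ tau *+ 2 = 2 `^ (1 - tau) * x `^ tau.
Proof.
move=> x0; rewrite powRM // ?invr_ge0 // -mulr_natr -mulrA mulrC; congr (_ * _).
rewrite -powR_inv1 // -powRrM mulN1r -{2}[2]powRr1 // -powRD; last first.
  by rewrite pnatr_eq0 implybT.
by rewrite addrC.
Qed.

(** Induction on the degree and, within it, on the number of points. Around the step from [s'] to
    [u] both sides carry at most half of the control, so their errors in degree [i] add up to at
    most [rho * C] times the bound, where [rho = 2 ^ (1 - tau) < 1]. All other errors come from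
    lower degrees or from almost multiplicativity and amount to at most [B]. *)
Lemma sewing_estimate i : exists2 C : R, 0 <= C & forall s t D, 0 <= s -> t <= 1 ->
  itv_partition s t D -> `|path_prod s D i - Z s t i| <= C * om s t `^ tau.
Proof.
elim/ltn_ind: i => i IH.
pose Om := om 0 1 `^ tau.
have Om0 : 0 <= Om by exact: powR_ge0.
have [E E0 pE] : exists2 E, 0 <= E & forall j, (j < i)%N -> forall s t D,
    0 <= s -> t <= 1 -> itv_partition s t D ->
    `|path_prod s D j - Z s t j| <= E * om s t `^ tau.
  apply: exists_uniform_bound => // j C C' CC' h s t D s0 t1 Dp.
  by apply: le_trans (h s t D s0 t1 Dp) _; rewrite ler_wpM2r // powR_ge0.
have [K1 K10 ZK1] : exists2 K, 0 <= K & forall j, (j < i.+1)%N -> forall s t,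
    0 <= s -> s <= t -> t <= 1 -> `|Z s t j| <= K.
  apply: exists_uniform_bound => // j C C' CC' h s t s0 st t1.
  exact: le_trans (h s t s0 st t1) CC'.
have [A A0 ZA] : exists2 A, 0 <= A & forall j, (j < i.+1)%N -> forall s u t,
    0 <= s -> s <= u -> u <= t -> t <= 1 ->
    `|tsmul (Z s u) (Z u t) j - Z s t j| <= A * om s t `^ tau.
  apply: exists_uniform_bound => // j C C' CC' h s u t s0 su ut t1.
  by apply: le_trans (h s u t s0 su ut t1) _; rewrite ler_wpM2r // powR_ge0.
pose K := K1 + E * Om.
have EOm0 : 0 <= E * Om by exact: mulr_ge0.
have K0 : 0 <= K by exact: addr_ge0.
have K1K : K1 <= K by rewrite lerDl.
have omOm s t : 0 <= s -> s <= t -> t <= 1 -> om s t `^ tau <= Om.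
  by move=> s0 st t1; exact: control_powR_mono.
have pK j s t D : (j < i)%N -> 0 <= s -> t <= 1 -> itv_partition s t D ->
    `|path_prod s D j| <= K.
  move=> ji s0 t1 Dp; have st := itv_partition_le Dp.
  rewrite -[path_prod s D j](subrK (Z s t j)) addrC.
  apply: le_trans (ler_normD _ _) _; apply: lerD.
    by apply: ZK1 => //; exact: ltnW.
  apply: le_trans (pE j ji s t D s0 t1 Dp) _.
  by rewrite ler_wpM2l // omOm.
pose n : R := i.+1%:R.
have n0 : 0 <= n by exact: ler0n.
(* [KK] and [EE] serve as [K] and [E] for the product [Q] of the middle step with the right half.
   The four terms of [B] are the errors of [top1], [top2], [PQ'] and [PZ]. *)
pose KK := K + n * (K * K).
pose EE := E + n * (K * E).
pose B := n * (2 * (KK * EE)) + n * (2 * (K * E)) + n * (K * A) + A.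
have KK0 : 0 <= KK by rewrite addr_ge0 // !mulr_ge0.
have EE0 : 0 <= EE by rewrite addr_ge0 // !mulr_ge0.
have B0 : 0 <= B.
  by rewrite addr_ge0 // addr_ge0 ?mulr_ge0 // addr_ge0 // !mulr_ge0.
pose rho := 2 `^ (1 - tau) : R.
have rho1 : rho < 1.
  have h : rho <= 1 by rewrite /rho -[leRHS](powRr0 2) ler_powR ?ler1n // subr_le0 ltW.
  rewrite lt_neqAle h andbT powR_eq1 subr_eq0 (lt_eqF tau_gt1) orbF.
  by rewrite pnatr_eq1 /= ltNge ler0n.
exists (B / (1 - rho)); first by rewrite divr_ge0 // subr_ge0 ltW.
set C := B / (1 - rho).
have C0 : 0 <= C by rewrite divr_ge0 // subr_ge0 ltW.
(* [C] is chosen as the fixed point of this recursion. *)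
have CB : rho * C + B = C.
  rewrite /C; field; by rewrite subr_eq0 gt_eqF.
move=> s t D; have [m] := ubnP (size D); elim: m s t D => // m IHm s t D.
rewrite ltnS => Dm s0 t1 Dp; have st := itv_partition_le Dp.
have [DE|Dn] := eqVneq D [::].
  move: Dp; rewrite DE => /itv_partition_nil <- /=.
  by rewrite Zxx ?(le_trans st) // subrr normr0 mulr_ge0 // powR_ge0.
have [D1 [u [D2 [DE h1 h2]]]] := partition_halves s0 t1 Dp Dn.
set s' := last s D1 in h1 *.
move: Dp; rewrite DE => /partition_catP; rewrite -/s' => -[Dp1 Dpu].
have Dp2 := itv_partition_cons Dpu.
have ss := itv_partition_le Dp1.
have su : s' <= u by case: Dpu => /= /andP[/ltW].
have ut := itv_partition_le Dp2.
have s'0 := le_trans s0 ss; have u0 := le_trans s'0 su.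
have u1 := le_trans ut t1; have s'1 := le_trans su u1.
have st' := le_trans su ut.
have w0 := om_ge0 s0 st t1.
set w := om s t `^ tau.
have wp : 0 <= w by exact: powR_ge0.
have sizeD : size D = (size D1 + (size D2).+1)%N by rewrite DE size_cat.
rewrite path_prod_cat -/s' /=.
set P := path_prod s D1; set P' := Z s s'.
set Q := tsmul (Z s' u) (path_prod u D2); set Q' := tsmul (Z s' u) (Z u t).
have w1 : om s s' `^ tau <= w by apply: control_powR_mono.
have w2 : om u t `^ tau <= w by apply: control_powR_mono => //; exact: le_trans ss su.
have w3 : om s' t `^ tau <= w by apply: control_powR_mono.
have EwE : E * w <= EE * w by rewrite ler_wpM2r // lerDl !mulr_ge0.
have dP j : (j < i)%N -> `|P j - P' j| <= E * w.
  move=> ji; apply: le_trans (pE j ji s s' D1 s0 s'1 Dp1) _.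
  by rewrite ler_wpM2l.
have dp2 j : (j < i)%N -> `|path_prod u D2 j - Z u t j| <= E * w.
  move=> ji; apply: le_trans (pE j ji u t D2 u0 t1 Dp2) _.
  by rewrite ler_wpM2l.
have nj j : (j < i)%N -> j.+1%:R <= n by move=> ji; rewrite ler_nat ltnS ltnW.
have ZK s1 t1' j : (j < i.+1)%N -> 0 <= s1 -> s1 <= t1' -> t1' <= 1 ->
    `|Z s1 t1' j| <= K.
  by move=> ji h h' h''; exact: le_trans (ZK1 j ji s1 t1' h h' h'') K1K.
have dQ j : (j < i)%N -> `|Q j - Q' j| <= EE * w.
  move=> ji; apply: le_trans (tsmulBr_le (K := K) (E := E * w) _ _ _) _ => //.
  - by move=> a aj; apply: ZK => //; rewrite ltnS (leq_trans aj) // ltnW.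
  - by move=> a aj; apply: dp2; exact: leq_ltn_trans ji.
  rewrite mulrA mulrA; apply: ler_wpM2r => //.
  rewrite -mulrA; apply: le_trans (_ : n * (K * E) <= _); last by rewrite lerDr.
  by rewrite ler_wpM2r ?mulr_ge0 // nj.
have Qb j : (j < i)%N -> `|Q j| <= KK.
  move=> ji; apply: le_trans (tsmul_le (K := K) (L := K) _ _ _) _ => //.
  - by move=> a aj; apply: ZK => //; rewrite ltnS (leq_trans aj) // ltnW.
  - by move=> a aj; apply: (pK a u t) => //; exact: leq_ltn_trans ji.
  apply: le_trans (_ : n * (K * K) <= _); last by rewrite lerDr.
  by rewrite ler_wpM2r ?mulr_ge0 // nj.
have KKK : K <= KK by rewrite lerDl !mulr_ge0.
have top1 : `|tsmul P Q i - tsmul P' Q' i| <=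
    `|P i - P' i| + `|Q i - Q' i| + n * (2 * (KK * (EE * w))).
  apply: tsmulB_top => //.
  - exact: mulr_ge0.
  - exact: (path_prod0 s0 s'1 Dp1).
  - exact: Z0.
  - by apply: tsmul_one0; [exact: Z0|exact: (path_prod0 u0 t1 Dp2)].
  - by apply: tsmul_one0; exact: Z0.
  - move=> j ji; apply: le_trans KKK; apply: ZK => //; exact: ltnW.
  - by move=> j ji; apply: le_trans EwE; exact: dP.
have top2 : `|Q i - Q' i| <=
    `|path_prod u D2 i - Z u t i| + n * (2 * (K * (E * w))).
  have := @tsmulB_top _ _ _ (Z s' u) (Z s' u) (path_prod u D2) (Z u t) i K (E * w).
  rewrite subrr normr0 add0r; apply => //.
  - exact: mulr_ge0.
  - exact: Z0.
  - exact: Z0.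
  - exact: (path_prod0 u0 t1 Dp2).
  - exact: Z0.
  - by move=> j ji; apply: ZK => //; exact: ltnW.
  - by move=> j ji; apply: (pK j u t).
  - by move=> j ji; rewrite subrr normr0 mulr_ge0.
have PQ' : `|tsmul P' Q' i - tsmul P' (Z s' t) i| <= n * (K * (A * w)).
  apply: tsmulBr_le => // [a ai|a ai]; first by apply: ZK; rewrite ?ltnS.
  apply: le_trans (ZA a _ _ _ _ s'0 su ut t1) _; first by rewrite ltnS.
  by rewrite ler_wpM2l.
have PZ : `|tsmul P' (Z s' t) i - Z s t i| <= A * w by exact: ZA.
have IH1 : `|P i - P' i| <= C * om s s' `^ tau.
  by apply: IHm => //; rewrite (leq_trans _ Dm) // sizeD addnS ltnS leq_addr.
have IH2 : `|path_prod u D2 i - Z u t i| <= C * om u t `^ tau.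
  by apply: IHm => //; rewrite (leq_trans _ Dm) // sizeD leq_addl.
have half x : 0 <= x -> x <= om s t / 2 -> x `^ tau <= (om s t / 2) `^ tau.
  by move=> x0 xh; apply: ge0_ler_powR => //; [exact: ltW|rewrite nnegrE divr_ge0].
have hh : om s s' `^ tau + om u t `^ tau <= rho * w.
  rewrite -powR_half // mulr2n.
  by apply: lerD; apply: half => //; exact: om_ge0.
(* Both halves are first replaced by single increments; then the middle one is merged with the right
   one, and the result with the left one. *)
have -> : tsmul P Q i - Z s t i = (tsmul P Q i - tsmul P' Q' i) +
    (tsmul P' Q' i - tsmul P' (Z s' t) i) + (tsmul P' (Z s' t) i - Z s t i).
  by rewrite !addrA !subrK.
apply: le_trans (ler_normD _ _) _.
apply: le_trans (lerD (ler_normD _ _) (lexx _)) _.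
have Chh : C * om s s' `^ tau + C * om u t `^ tau <= C * (rho * w).
  by rewrite -mulrDr ler_wpM2l.
have -> : C * w = C * (rho * w) + (n * (2 * (KK * (EE * w))) +
    n * (2 * (K * (E * w))) + n * (K * (A * w)) + A * w).
  by rewrite -{1}CB /B; ring.
lra.
Qed.

End Sewing.

(** * Refinements of partitions *)

Section Refinement.
Context {R : realType}.
Implicit Types (s t u : R) (D : seq R).

(** Recursive, not defined by inclusion, in order to follow the recursion of [path_prod];
    [subset_refines] provides the link. *)
Fixpoint refines s D' D : Prop :=
  if D is u :: Dr then
    exists D1 D2, [/\ D' = D1 ++ D2, last s D1 = u & refines u D2 Dr]
  else D' = [::].

Lemma subset_refines s t D' D : itv_partition s t D' -> itv_partition s t D ->
  {subset D <= D'} -> refines s D' D.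
Proof.
elim: D s D' => [|u D IH] s D' D'p Dp sub /=.
  by move: D'p; rewrite (itv_partition_nil Dp) => /itv_partitionxx.
have uD' : u \in D' by apply: sub; rewrite mem_head.
case/path.splitP: uD' D'p sub => p1 p2 D'p sub.
exists (rcons p1 u), p2; split; rewrite ?last_rcons //.
have [p1p p2p] := partition_catP D'p; rewrite last_rcons in p1p p2p.
apply: IH => //; first exact: itv_partition_cons Dp.
move=> x xD; have ux : u < x.
  by case: Dp => /= /andP[_ /lt_path_min /allP h] _; exact: h.
have : x \in rcons p1 u ++ p2 by apply: sub; rewrite inE xD orbT.
rewrite mem_cat => /orP[|//] xp1.
have : x <= u.
  case: p1p; rewrite rcons_path mem_rcons inE in xp1 *.
  case/orP: xp1 => [/eqP -> //|xp1] /andP[p1s lu] _.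
  case/splitPr: xp1 p1s lu => q1 q2; rewrite cat_path /= => /and3P[_ _ q2p].
  rewrite last_cat /= => lu; apply: ltW; apply: le_lt_trans lu.
  exact: (itv_partition_le (conj q2p (eqxx _))).
by rewrite leNgt ux.
Qed.

Lemma itv_partition_mem s t D x : itv_partition s t D -> x \in D -> s < x <= t.
Proof.
move=> Dp xD; have [/lt_path_min/allP sD _] := Dp; rewrite sD //=.
case/splitPr: xD Dp => p1 p2 /partition_catP[_ /itv_partition_cons].
exact: itv_partition_le.
Qed.

Lemma common_refinement s t D D' : s < t -> itv_partition s t D ->
  itv_partition s t D' -> exists D'', [/\ itv_partition s t D'',
    refines s D'' D & refines s D'' D'].
Proof.
move=> st Dp D'p; pose D'' := sort <=%O (undup (D ++ D')).
have memD'' x : (x \in D'') = (x \in D) || (x \in D').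
  by rewrite mem_sort mem_undup mem_cat.
have bnd x : x \in D'' -> s < x <= t.
  by rewrite memD'' => /orP[]; exact: itv_partition_mem.
have D''s : sorted <%O D'' by rewrite sort_lt_sorted undup_uniq.
have pD'' : path <%O s D''.
  by rewrite path_min_sorted //; apply/allP => x /bnd /andP[].
have tD'' : t \in D''.
  rewrite memD''; have [DE|Dn] := eqVneq D [::].
    by move: st; move: Dp; rewrite DE => /itv_partition_nil ->; rewrite ltxx.
  case: Dp => _ /eqP <-; case: D Dn {memD'' bnd D''s pD'' D''} => //= x D _.
  by rewrite mem_last.
have lD'' : last s D'' = t.
  apply/le_anti/andP; split.
    have : last s D'' \in s :: D'' by exact: mem_last.
    by rewrite inE => /orP[/eqP ->|/bnd /andP[]//]; exact: ltW.
  case/splitPr: tD'' pD'' => p1 p2; rewrite cat_path last_cat /= => /and3P[_ _ h].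
  exact: (itv_partition_le (conj h (eqxx _))).
have D''p : itv_partition s t D'' by split; rewrite ?lD''.
exists D''; split => //; apply: (subset_refines D''p) => // x xD;
  by rewrite memD'' xD ?orbT.
Qed.

End Refinement.

(** * Convergence of the products along partitions *)

Section SewingLimit.
Context {R : realType} {V : completeNormedModType R} {TV : tensorPowers V}.
Implicit Types (s t u : R) (D : seq R).
Variables (om : R -> R -> R) (tau : R) (Z : R -> R -> tseries TV).
Hypothesis om_control : control om.
Hypothesis tau_gt1 : 1 < tau.
Hypothesis Zxx : forall s, 0 <= s -> s <= 1 -> Z s s = tsone TV.
Hypothesis Z0 : forall s t, 0 <= s -> s <= t -> t <= 1 -> Z s t 0%N = tunit.
Hypothesis Z_bounded : forall i, exists2 C : R, 0 <= C &
  forall s t, 0 <= s -> s <= t -> t <= 1 -> `|Z s t i| <= C.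
Hypothesis Z_almost_mult : forall i, exists2 C : R, 0 <= C &
  forall s u t, 0 <= s -> s <= u -> u <= t -> t <= 1 ->
    `|tsmul (Z s u) (Z u t) i - Z s t i| <= C * om s t `^ tau.

Let sewing := sewing_estimate om_control tau_gt1 Zxx Z0 Z_bounded Z_almost_mult.

Lemma path_prod_bounded i : exists2 C : R, 0 <= C & forall s t D, 0 <= s -> t <= 1 ->
  itv_partition s t D -> `|path_prod Z s D i| <= C.
Proof.
have [C C0 h] := sewing i; have [K K0 ZK] := Z_bounded i.
exists (K + C * om 0 1 `^ tau); first by rewrite addr_ge0 // mulr_ge0 // powR_ge0.
move=> s t D s0 t1 Dp; have st := itv_partition_le Dp.
rewrite -[path_prod Z s D i](subrK (Z s t i)) addrC.
apply: le_trans (ler_normD _ _) _; apply: lerD; first exact: ZK.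
apply: le_trans (h s t D s0 t1 Dp) _; rewrite ler_wpM2l //.
exact: (control_powR_mono om_control tau_gt1).
Qed.

Fixpoint control_sum s D : R :=
  if D is t :: D' then om s t `^ tau + control_sum t D' else 0.

(** Telescopes over the steps of [D]: an intermediate product follows [D] up to some point and [D']
    from there on. [D0] is the coarse prefix already passed; the factors on both sides of the
    current step are bounded by [path_prod_bounded]. *)
Lemma refinement_estimate i : exists2 C : R, 0 <= C & forall D s t D' D0,
  0 <= s -> t <= 1 -> itv_partition 0 s D0 -> itv_partition s t D' ->
  itv_partition s t D -> refines s D' D ->
  `|tsmul (path_prod Z 0 D0) (path_prod Z s D') i -
    tsmul (path_prod Z 0 D0) (path_prod Z s D) i|
    <= C * control_sum s D.
Proof.
have [K K0 pK] : exists2 K : R, 0 <= K & forall j, (j < i.+1)%N -> forall s t D,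
    0 <= s -> t <= 1 -> itv_partition s t D -> `|path_prod Z s D j| <= K.
  apply: exists_uniform_bound => [j C C' CC' h s t D s0 t1 Dp|j _].
    exact: le_trans (h s t D s0 t1 Dp) CC'.
  exact: path_prod_bounded.
have [E E0 pE] : exists2 E : R, 0 <= E & forall j, (j < i.+1)%N -> forall s t D,
    0 <= s -> t <= 1 -> itv_partition s t D ->
    `|path_prod Z s D j - Z s t j| <= E * om s t `^ tau.
  apply: exists_uniform_bound => [j C C' CC' h s t D s0 t1 Dp|j _].
    by apply: le_trans (h s t D s0 t1 Dp) _; rewrite ler_wpM2r // powR_ge0.
  exact: sewing.
pose n : R := i.+1%:R; have n0 : 0 <= n by exact: ler0n.
exists (n * (K * (n * (E * K)))); first by rewrite !mulr_ge0.
elim=> [|u D IH] s t D' D0 s0 t1 D0p D'p Dp.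
  by move=> /= ->; rewrite subrr normr0 mulr0.
move=> /= [D1 [D2 [D'E lu ref]]].
move: D'p; rewrite D'E => /partition_catP; rewrite lu => -[D1p D2p].
have su := itv_partition_le D1p; have ut := itv_partition_le D2p.
have u0 := le_trans s0 su; have u1 := le_trans ut t1.
have su' : s < u by case: Dp => /= /andP[].
rewrite path_prod_cat lu; set A := path_prod Z 0 D0; set w := om s u `^ tau.
have w0 : 0 <= w by exact: powR_ge0.
have -> : tsmul A (tsmul (path_prod Z s D1) (path_prod Z u D2)) i -
    tsmul A (tsmul (Z s u) (path_prod Z u D)) i =
    (tsmul A (tsmul (path_prod Z s D1) (path_prod Z u D2)) i -
     tsmul A (tsmul (Z s u) (path_prod Z u D2)) i) +
    (tsmul (path_prod Z 0 (rcons D0 u)) (path_prod Z u D2) i -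
     tsmul (path_prod Z 0 (rcons D0 u)) (path_prod Z u D) i).
  rewrite -cats1 path_prod_cat /= tsmul1r.
  have -> : last 0 D0 = s by case: D0p => _ /eqP.
  by rewrite !tsmulA addrA subrK.
apply: le_trans (ler_normD _ _) _; rewrite mulrDr; apply: lerD; last first.
  apply: (IH u t) => //; last exact: itv_partition_cons Dp.
  rewrite -cats1; apply: itv_partition_cat D0p _.
  exact: itv_partition1.
rewrite -!mulrA; apply: tsmulBr_le => // [a ai|a ai].
  by apply: (pK a _ 0 s) => //; exact: le_trans su u1.
apply: le_trans (tsmulBl_le (E := E * w) (K := K) _ _ _) _.
- exact: mulr_ge0.
- move=> b ba; apply: (pE b) => //.
  by rewrite ltnS (leq_trans ba).
- by move=> b ba; apply: (pK b _ u t) => //; rewrite ltnS (leq_trans ba).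
rewrite [E * (K * w)]mulrCA [_ * K]mulrC; apply: ler_wpM2r.
  by rewrite !mulr_ge0.
by rewrite ler_nat ltnS.
Qed.

(** Continuity at each diagonal point gives a local [d]; compactness of the interval makes it
    uniform. *)
Lemma control_uniform (eta : R) : 0 < eta -> exists2 d : R, 0 < d &
  forall s t, 0 <= s -> s <= t -> t <= 1 -> t - s < d -> om s t < eta.
Proof.
move=> eta0.
have cov : near_covering (`[0, 1]%classic : set R).
  by apply/compact_near_coveringP; exact: segment_compact.
pose Pd (d s : R) := forall t, 0 <= s -> s <= t -> t <= 1 -> t - s < d -> om s t < eta.
have near0 : \forall d \near (0 : R)^'+, forall s, `[0, 1]%classic s -> Pd d s.
  apply: cov => r; rewrite /= in_itv /= => /andP[r0 r1].
  have /subspace_continuousP hc := control_continuous om_control.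
  have cvgom := hc (r, r) (conj r0 (conj (lexx r) r1)).
  have /nbhs_ballP[e /= e0 eB] : nbhs (r, r) [set z : R * R |
      0 <= z.1 /\ z.1 <= z.2 /\ z.2 <= 1 -> om z.1 z.2 < eta].
    apply: (cvgom [set x | x < eta]); apply: lt_nbhsl.
    by rewrite -[ltLHS]/(om r r) (control_diag om_control).
  (* One half of [e] is for the distance from [r] to [s], the other for [t - s]. *)
  exists (ball r (e / 2), [set d | d < e / 2]) => /=.
    split; first by apply: nbhsx_ballx; rewrite divr_gt0.
    by apply: nbhs_right_lt; rewrite divr_gt0.
  move=> [s d] /= [rs de] t s0 st t1 tsd.
  apply: (eB (s, t)); last by [].
  move: rs; rewrite /ball /= => rs.
  split; rewrite /ball /=; first by apply: lt_trans rs _; lra.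
  by move: rs; rewrite !ltr_norml => /andP[h1 h2]; apply/andP; split; lra.
have : \forall d \near (0 : R)^'+, 0 < d /\ forall s, `[0, 1]%classic s -> Pd d s.
  by apply: filterS2 near0 (nbhs_right_gt 0) => d.
move=> /filter_ex[d [d0 dP]]; exists d => // s t s0 st t1.
by apply: dP => //; rewrite /= in_itv /= s0 (le_trans st).
Qed.

Lemma mesh_steps (d : R) D : mesh D < d -> path (fun x y => y - x < d) 0 D.
Proof.
rewrite /mesh => /bigmax_ltP[_ h]; apply/(pathP 0) => k kD.
by apply: le_lt_trans (ler_norm _) _; exact: (h (Ordinal kD)).
Qed.

(** On a short step [om ^ tau = om ^ (tau - 1) * om <= e * om], and the sum of the last factors is
    bounded by super-additivity. The threshold [e ^ (1 / (tau - 1))] for [om] makes the first factor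
    at most [e]. *)
Lemma control_sum_small (e : R) : 0 < e -> exists2 d : R, 0 < d & forall s t D,
  0 <= s -> t <= 1 -> itv_partition s t D -> path (fun x y => y - x < d) s D ->
  control_sum s D <= e * om s t.
Proof.
move=> e0; have tau1 : 0 < tau - 1 by rewrite subr_gt0.
have [d d0 dP] := control_uniform (powR_gt0 (tau - 1)^-1 e0).
exists d => // s t D; elim: D s => [|u D IH] s s0 t1 Dp /=.
  move=> _; rewrite -(itv_partition_nil Dp) (control_diag om_control) ?mulr0 //.
  by rewrite (itv_partition_nil Dp).
move=> /andP[us Dd]; have Dp' := itv_partition_cons Dp.
have su : s <= u by case: Dp => /= /andP[/ltW].
have ut := itv_partition_le Dp'; have u0 := le_trans s0 su.
have u1 := le_trans ut t1.
have om0 := control_ge0 om_control s0 su u1.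
have step : om s u `^ tau <= e * om s u.
  have -> : om s u `^ tau = om s u `^ (tau - 1) * om s u.
    rewrite -{3}(powRr1 om0) -powRD ?subrK //.
    by rewrite gt_eqF ?implyFb // (lt_trans _ tau_gt1).
  apply: ler_wpM2r => //.
  have -> : e = (e `^ (tau - 1)^-1) `^ (tau - 1).
    by rewrite -powRrM mulVf ?gt_eqF // powRr1 // ltW.
  apply: ge0_ler_powR; rewrite ?nnegrE ?powR_ge0 // ?(ltW tau1) //.
  by apply: ltW; exact: dP.
apply: le_trans (_ : e * (om s u + om u t) <= _); last first.
  by rewrite ler_pM2l // (control_superadditive om_control).
by rewrite mulrDr; apply: lerD => //; exact: IH.
Qed.

Lemma mesh_exists (d : R) : 0 < d -> exists2 D, itv_partition 0 1 D & mesh D < d.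
Proof.
move=> d0; pose n := Num.truncn d^-1.
have nd : n.+1%:R^-1 < d.
  by rewrite -[ltRHS]invrK ltf_pV2 ?posrE ?invr_gt0 // truncnS_gt.
pose D := [seq (k.+1%:R / n.+1%:R : R) | k <- iota 0 n.+1].
have sD : size D = n.+1 by rewrite size_map size_iota.
have DE k : (k < n.+1)%N -> nth 0 D k = k.+1%:R / n.+1%:R.
  by move=> kn; rewrite (nth_map 0%N) ?size_iota // nth_iota.
have DE' k : (k < n.+1)%N -> nth 0 (0 :: D) k = k%:R / n.+1%:R.
  by case: k => [|k] kn; [rewrite mul0r|rewrite /= DE // ltnW].
have step k : (k < n.+1)%N -> nth 0 D k - nth 0 (0 :: D) k = n.+1%:R^-1.
  by move=> kn; rewrite DE // DE' // -mulrBl -natrB // subSnn mul1r.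
exists D; first split.
- by apply/(pathP 0) => k; rewrite sD => kn; rewrite -subr_gt0 step.
- by rewrite -nth_last sD DE // divff ?eqxx // pnatr_eq0.
rewrite /mesh; apply/bigmax_ltP; split => // k _.
by rewrite step ?ger0_norm // ?invr_ge0 ?ler0n // -sD.
Qed.

Lemma mesh_to0_proper : ProperFilter (mesh_to0 (R := R)).
Proof.
apply: filter_from_proper.
  apply: filter_from_filter; first by exists 1; rewrite /= ltr01.
  move=> i j /= i0 j0; exists (Num.min i j); first by rewrite /= lt_min i0.
  by move=> D /= [Dp]; rewrite lt_min => /andP[h1 h2].
by move=> d /mesh_exists[D Dp Dd]; exists D.
Qed.

Lemma path_prod_cvg i :
  cvg ((path_prod Z 0 D i) @[D --> mesh_to0 (R := R)]).
Proof.
have FF := mesh_to0_proper; apply/cauchy_cvgP/cauchy_exP => e e0.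
have [C C0 ref] := refinement_estimate i.
have Om0 : 0 <= om 0 1 by exact: (control_ge0 om_control).
(* The summand 1 keeps [c] positive and makes [C * om 0 1 / c] strictly less than 1. *)
pose c := 1 + C * om 0 1.
have c0 : 0 < c by rewrite ltr_pwDl // mulr_ge0.
have e'0 : 0 < e / 2 / c by rewrite !divr_gt0.
have [d d0 small] := control_sum_small e'0.
have close D D' : itv_partition 0 1 D -> mesh D < d -> itv_partition 0 1 D' ->
    refines 0 D' D -> `|path_prod Z 0 D' i - path_prod Z 0 D i| < e / 2.
  move=> Dp Dd D'p D'D.
  have := ref D 0 1 D' [::]; rewrite /= !tsmul1l => /(_ _ _ _ D'p Dp D'D) h.
  apply: le_lt_trans (h _ _ _) _ => //.
  have := small 0 1 D (lexx _) (lexx _) Dp (mesh_steps Dd) => {}h.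
  apply: le_lt_trans (ler_wpM2l C0 h) _.
  rewrite mulrCA -[ltRHS](divfK (lt0r_neq0 c0)) ltr_pM2l //.
  by rewrite /c; lra.
(* One fixed fine partition is enough for the Cauchy criterion: any other fine one is compared with
   it through a common refinement. *)
have [D0 D0p D0d] := mesh_exists d0.
exists (path_prod Z 0 D0 i), d => // D /= [Dp Dd].
have [D' [D'p r1 r2]] := common_refinement ltr01 D0p Dp.
rewrite -ball_normE /= -(subrK (path_prod Z 0 D' i) (path_prod Z 0 D0 i)) -addrA.
apply: le_lt_trans (ler_normD _ _) _; rewrite [ltRHS]splitr ltrD //.
  by rewrite distrC close.
exact: close.
Qed.

End SewingLimit.

(** * Estimates *)

Section RoughPathNorms.
Context {R : realType} {V : completeNormedModType R} {TV : tensorPowers V}.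

(** The one-step partition bounds [d(X_s, X_t) ^ p] by [om s t], and [d] dominates the [1/k]-th
    power of the norm in degree [k]. *)
Lemma rough_increment_norm (p : R) (X : R -> tseries TV) (om : R -> R -> R) s t k :
  1 <= p -> X s 0%N = tunit -> X t 0%N = tunit -> s <= t -> 0 <= om s t ->
  (pvar p X s t <= (om s t)%:E)%E ->
  `|tsmul (tsinv (X s)) (X t) k| <= (om s t `^ p^-1) ^+ k.
Proof.
move=> p1 Xs0 Xt0 st om0 Xom; have p0 : 0 < p by exact: lt_le_trans p1.
have m0 : 0 <= om s t `^ p^-1 by exact: powR_ge0.
case: k => [|k]; first by rewrite tsmul_one0 ?tsinv_one0 // norm_tunit.
(* Partitions are strictly increasing, so there is no one-step partition if [s = t]. *)
move: st; rewrite le_eqVlt => /orP[/eqP ts|st].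
  by rewrite -ts (tsinvP Xs0).2 tsoneS normr0 exprn_ge0 ?powR_ge0.
set a := `|_|.
have a0 : 0 <= a by exact: normr_ge0.
have aX : ((a `^ k.+1%:R^-1)%:E <= tdist (X s) (X t))%E.
  by apply: ereal_sup_ubound; exists k.+1.
have Xp : (tdist (X s) (X t) `^ p <= (om s t)%:E)%E.
  apply: le_trans Xom; apply: ereal_sup_ubound; exists [:: t].
    exact: itv_partition1.
  by rewrite big_ord1.
have : ((a `^ k.+1%:R^-1)%:E `^ p <= tdist (X s) (X t) `^ p)%E.
  apply: gt0_ler_poweR => //; first exact: ltW.
    by rewrite in_itv /= leey lee_fin powR_ge0.
  by rewrite in_itv /= leey (le_trans _ aX) // lee_fin powR_ge0.
move=> /le_trans/(_ Xp); rewrite poweR_EFin lee_fin => aom.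
have -> : a = (((a `^ k.+1%:R^-1) `^ p) `^ p^-1) ^+ k.+1.
  rewrite -powRrM mulfV ?gt_eqF // powRr1 ?powR_ge0 //.
  by rewrite -powR_mulrn ?powR_ge0 // -powRrM mulVf ?pnatr_eq0 // powRr1.
apply: lerXn2r; rewrite ?nnegrE ?powR_ge0 //.
by apply: ge0_ler_powR; rewrite ?nnegrE ?powR_ge0 // invr_ge0 ltW.
Qed.

End RoughPathNorms.

Section OperatorNorms.
Context {R : realType} {V U : completeNormedModType R}.
Context {TV : tensorPowers V} {TU : tensorPowers U}.
Variable OT : operatorTensors TV TU.
Implicit Types phi psi : forall k, clinear (TV k.+1) U.

Lemma clinear_le (E F : normedModType R) (f : clinear E F) x :
  `|f x| <= `|f| * `|x|.
Proof. exact: ler_opnorm. Qed.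

Lemma clinear_norm_le (E F : normedModType R) (f : clinear E F) M : 0 <= M ->
  (forall x, `|f x| <= M * `|x|) -> `|f| <= M.
Proof.
move=> M0 h; apply: opnorm_le => x x1; apply: le_trans (h x) _.
by rewrite -[leRHS]mulr1 ler_wpM2l.
Qed.

Lemma norm_tpower n (v : V) : `|tpower TV n v| <= `|v| ^+ n.
Proof.
elim: n => [|n IH]; first by rewrite /tpower tunitE norm_tunit expr0.
have -> : tpower TV n.+1 v = tmul (vtens TV v) (tpower TV n v).
  by rewrite vtens_tlist !tpower_tlist tmul_tlist.
apply: le_trans (ler_norm_tmul _ _) _.
by rewrite exprS; apply: ler_pM => //; rewrite norm_tens1.
Qed.

Lemma norm_tmul_pre i j r (A : clinear (TV j) U) (t : TV r) :
  `|tmul_pre i A t| <= `|A| * `|t|.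
Proof.
apply: clinear_norm_le; first exact: mulr_ge0.
move=> x; rewrite -[tmul_pre i A t x]/(A (homog (tmul t x) j)).
apply: le_trans (clinear_le _ _) _; rewrite -mulrA.
apply: ler_wpM2l => //; exact: le_trans (ler_norm_homog _ _) (ler_norm_tmul _ _).
Qed.

(** The factors are exchanged one at a time. Since [otens] is not given as multilinear in the
    operators, the difference of neighbouring hybrids is recognised as [otens d] on elementary
    tensors. [1 <= M] allows the power [l] in place of [l - 1]. *)
Lemma otens_sub_le l (K : 'I_l -> nat) (f g : forall i, clinear (TV (K i)) U) M :
  1 <= M -> (forall i, `|f i| <= M) -> (forall i, `|g i| <= M) ->
  `|otens OT f - otens OT g| <= \sum_(b < l) M ^+ l * `|f b - g b|.
Proof.
move=> M1 fM gM; have M0 : 0 <= M by exact: le_trans M1.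
pose h (b : nat) := otens OT (fun i : 'I_l => if (i < b)%N then g i else f i).
have tele n : \sum_(b < n) (h b - h b.+1) = h 0%N - h n.
  elim: n => [|n IH]; first by rewrite big_ord0 subrr.
  by rewrite big_ord_recr /= IH addrA subrK.
have -> : otens OT g = h l.
  congr (otens OT _); apply: functional_extensionality_dep => i.
  by rewrite ltn_ord.
rewrite -[otens OT f]/(h 0%N) -tele.
apply: le_trans (ler_norm_sum _ _ _) _; apply: ler_sum => b _.
pose d (i : 'I_l) := if (i < b)%N then g i else if i == b then f i - g i else f i.
have -> : h b - h b.+1 = otens OT d.
  apply: clinear_ext; apply: tlist_ext; [solve_lcont|solve_lcont|move=> vs svs].
  have [w sw vsE] := split_blocks svs.
  rewrite vsE -[LHS]/(h b _ - h b.+1 _) /h !otens_flatten //.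
  pose v (i : 'I_l) : U := if (i < b)%N then g i (tlist TV (K i) (w i))
    else f i (tlist TV (K i) (w i)).
  pose T (x : U) := tens TU [eta v with b |-> x].
  have TE (e : forall i, clinear (TV (K i)) U) :
      (forall i : 'I_l, i != b -> e i (tlist TV (K i) (w i)) = v i) ->
      tens TU (fun i => e i (tlist TV (K i) (w i))) = T (e b (tlist TV (K b) (w b))).
    move=> ev; congr tens; apply/funext => i /=.
    by have [->//|ib] := eqVneq i b; rewrite ev.
  rewrite !TE.
  - rewrite ltnn ltnSn /d ltnn eqxx.
    have lT : linear T by exact: (@tens_multilinear _ _ TU l b v).
    have := lT (-1) (g b (tlist TV (K b) (w b))) (f b (tlist TV (K b) (w b))).
    by rewrite !scaleN1r addrC => <-; congr T; rewrite addrC.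
  - by move=> i ib; rewrite /d /v (negbTE ib); case: ifP.
  - move=> i ib; rewrite /v ltnS leq_eqVlt (negbTE (_ : i != b :> nat)) //=.
    by case: ifP.
  by move=> i ib; rewrite /v; case: ifP.
apply: le_trans (norm_otens _ _) _; rewrite (bigD1 b) //= {1}/d ltnn eqxx mulrC.
rewrite ler_wpM2r //; apply: le_trans (_ : \prod_(i < l | i != b) M <= _).
  apply: ler_prod => i ib; rewrite normr_ge0 /= /d (negbTE ib).
  by case: ifP.
rewrite prodr_const; apply: ler_weXn2l => //.
by rewrite -[leqRHS](card_ord l) max_card.
Qed.

Lemma norm_kotens phi l (k : 'I_l -> nat) M : 0 <= M ->
  (forall i, `|phi (k i)| <= M) -> `|kotens OT phi k| <= M ^+ l.
Proof.
move=> M0 fM; apply: le_trans (norm_otens _ _) _.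
rewrite -[l in M ^+ l]card_ord -prodr_const; apply: ler_prod => i _.
by rewrite normr_ge0 fM.
Qed.

End OperatorNorms.

(** Lowers an exponent at the price of a constant, as [m] stays bounded; positive exponents keep the
    power law valid at [m = 0]. *)
Lemma powR_split (R : realType) (m m1 e e' g : R) :
  0 <= m -> m <= m1 -> 1 <= m1 -> 0 < e' -> e' <= e -> e <= g ->
  m `^ e <= m1 `^ g * m `^ e'.
Proof.
move=> m0 mm1 m1_ge1 e'0 ee eg; have m10 := le_trans m0 mm1.
rewrite -{1}(subrK e' e) powRD ?subrK; last first.
  by rewrite gt_eqF ?implyFb // (lt_le_trans e'0).
apply: ler_wpM2r; first exact: powR_ge0.
apply: le_trans (_ : m1 `^ (e - e') <= _); last by apply: ler_powR => //; lra.
by apply: ge0_ler_powR; rewrite ?nnegrE // subr_ge0.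
Qed.

(** * Taylor remainders of the Lipschitz one-form *)

Section TaylorEstimate.
Context {R : realType} {V U : completeNormedModType R} {TV : tensorPowers V}.
Variables (gamma : R) (theta : V -> clinear V U).
Variables (th : forall j, V -> clinear (TV j) (clinear V U)) (k0 : nat) (M : R).
Hypothesis hth : lip_oneform gamma theta th k0 M.

Definition lip_family (x : V) : forall j, clinear (TV j.+1) U :=
  fun j => uncurry_op (th j x).

Lemma lip_sym N x j (s : 'S_j) (a : TV j) : (N <= k0.+1)%N -> (j < N)%N ->
  th j x (tact TV s a) = th j x a.
Proof. by move=> Nk jN; apply: (lip_symmetric hth); lia. Qed.

Lemma lip_op N x j : (N <= k0.+1)%N -> (j < N)%N ->
  exists A, regarded_as (th j x) A.
Proof.
move=> Nk jN; have [|A [hA _]] := lip_bounded hth x (j := j); first by lia.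
by exists A.
Qed.

Lemma lip_family_norm x j : (j <= k0)%N -> `|lip_family x j| <= M.
Proof.
move=> jk; have [A [hA AM]] := lip_bounded hth x jk.
by rewrite /lip_family (uncurry_opP hA).
Qed.

Lemma lip_family_sym N x : (N <= k0.+1)%N -> sym_family (lip_family x) N.
Proof.
move=> Nk; apply: sym_family_uncurry => [j s a jN|j jN].
  exact: (lip_sym _ _ _ Nk jN).
exact: (lip_op _ Nk jN).
Qed.

Lemma lip_family_taylor x y j : (j <= k0)%N ->
  `|lip_family x j - shift_family (lip_family y) k0.+1 (x - y) j| <=
  M * `|x - y| `^ (gamma - 1 - j%:R).
Proof.
move=> jk; have [A [hA AM]] := lip_taylor hth x y jk.
suff -> : lip_family x j - shift_family (lip_family y) k0.+1 (x - y) j = A by [].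
apply: (regarded_as_uniq _ hA) => a w.
have [B [hB _]] := lip_bounded hth x jk.
rewrite -[LHS]/(lip_family x j _ - shift_family _ _ _ j _) /lip_family.
rewrite (uncurry_opP hB) hB (regarded_shift (N := k0.+1)).
- by rewrite subSn.
- by move=> i s b ik; exact: lip_sym ik.
- by move=> i ik; exact: lip_op ik.
by rewrite ltnS.
Qed.

(** The regularity of [theta] may provide more than the [N] coefficients that Lyons' functional
    uses. Each dropped term contains at least [N - j] factors [z]. *)
Lemma shift_family_trunc N y z j : (N <= k0.+1)%N -> (j < N)%N ->
  `|shift_family (lip_family y) k0.+1 z j - shift_family (lip_family y) N z j| <=
  \sum_(r < k0.+1 - j | (N - j <= r)%N) M * `|z| ^+ r.
Proof.
move=> Nk jN; rewrite /shift_family.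
rewrite [X in _ - X](big_ord_widen (k0.+1 - j) (fun r => (r`!%:R)^-1 *:
  tmul_pre j.+1 (lip_family y (r + j)%N) (tpower TV r z))) ?leq_sub2r //.
rewrite (bigID (fun r : 'I_(k0.+1 - j) => (r < N - j)%N)) /=.
rewrite [X in X - _]addrC addrK.
under eq_bigl do rewrite -leqNgt.
apply: le_trans (ler_norm_sum _ _ _) _; apply: ler_sum => r _.
have M0 := lip_ge0 hth.
rewrite normrZ; apply: le_trans (_ : 1 * `|tmul_pre j.+1 _ _| <= _).
  apply: ler_wpM2r => //; rewrite ger0_norm ?invr_ge0 ?ler0n //.
  by rewrite invf_le1 ?ltr0n ?fact_gt0 // ler1n fact_gt0.
rewrite mul1r; apply: le_trans (norm_tmul_pre _ _ _) _.
apply: ler_pM => //; last exact: norm_tpower.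
by apply: lip_family_norm; have := ltn_ord r; lia.
Qed.

(** The remainder has exponent [gamma - 1 - j], the dropped terms at least [N - j]; the exponent in
    the statement is the minimum of the two and is positive for [j < N]. *)
Lemma lip_family_shift N (m1 : R) : (N%:R < gamma) -> (N <= k0.+1)%N -> 1 <= m1 ->
  exists2 C : R, 0 <= C & forall x y m j, (j < N)%N -> 0 <= m -> m <= m1 ->
  `|x - y| <= m ->
  `|lip_family x j - shift_family (lip_family y) N (x - y) j| <=
  C * m `^ (Num.min gamma N.+1%:R - 1 - j%:R).
Proof.
move=> Ng Nk m1_ge1; have M0 := lip_ge0 hth.
have [k0g gk0] := lip_degree hth.
pose D := M * m1 `^ gamma; have D0 : 0 <= D by rewrite mulr_ge0 // powR_ge0.
exists (D + k0.+1%:R * D); first by rewrite addr_ge0 // mulr_ge0.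
move=> x y m j jN m0 mm1 xym.
set e' := Num.min gamma N.+1%:R - 1 - j%:R.
have jN' : j.+1%:R <= N%:R :> R by rewrite ler_nat.
have NS : N.+1%:R = N%:R + 1 :> R by rewrite -natr1.
have jS : j.+1%:R = j%:R + 1 :> R by rewrite -natr1.
have j0 : 0 <= j%:R :> R by [].
have e'0 : 0 < e'.
  by rewrite /e'; case: (leP gamma N.+1%:R) => h; lra.
have e'g : e' <= gamma - 1 - j%:R.
  by rewrite /e'; case: (leP gamma N.+1%:R) => h; lra.
have e'N : e' <= N%:R - j%:R.
  by rewrite /e'; case: (leP gamma N.+1%:R) => h; lra.
have jk : (j <= k0)%N by rewrite -ltnS (leq_trans jN).
apply: le_trans (ler_distD (shift_family (lip_family y) k0.+1 (x - y) j) _ _) _.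
rewrite mulrDl; apply: lerD.
  apply: le_trans (lip_family_taylor x y jk) _.
  rewrite /D -mulrA; apply: ler_wpM2l => //.
  apply: le_trans (_ : m `^ (gamma - 1 - j%:R) <= _).
    by apply: ge0_ler_powR; rewrite ?nnegrE //; lra.
  by apply: powR_split => //; lra.
apply: le_trans (shift_family_trunc _ _ Nk jN) _.
apply: le_trans (_ : \sum_(r < k0.+1 - j | (N - j <= r)%N) D * m `^ e' <= _).
  apply: ler_sum => r Nr; rewrite /D -mulrA; apply: ler_wpM2l => //.
  apply: le_trans (_ : m ^+ r <= _); first by apply: lerXn2r; rewrite ?nnegrE.
  have Nr' : N%:R <= r%:R + j%:R :> R by rewrite -natrD ler_nat addnC -leq_subLR.
  have rk : r%:R <= k0%:R :> R.
    by rewrite ler_nat -ltnS (leq_trans (ltn_ord r)) // leq_subr.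
  by rewrite -powR_mulrn //; apply: powR_split => //; lra.
have De0 : 0 <= D * m `^ e' by rewrite mulr_ge0 // powR_ge0.
apply: le_trans (_ : \sum_(r < k0.+1 - j) D * m `^ e' <= _).
  by rewrite big_mkcond; apply: ler_sum => r _; case: ifP.
rewrite sumr_const card_ord -mulrA -[leLHS]mulr_natl; apply: ler_wpM2r => //.
by rewrite ler_nat leq_subr.
Qed.

End TaylorEstimate.

Lemma cvg_tseries (R : realType) (V : completeNormedModType R)
    (TV : tensorPowers V) (T : Type) (F : set_system T) (f : T -> tseries TV)
    (L : tseries TV) : Filter F ->
  (forall i, f D i @[D --> F] --> L i) -> f D @[D --> F] --> L.
Proof.
move=> FF h; apply/cvg_sup => i A.
move=> -[B' [ [B oB <-] BL sub ] ].
apply: (@filterS _ F FF (fun D => B (f D i))) => [D fD|]; first exact: sub.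
by apply: (h i B); exact: open_nbhs_nbhs.
Qed.

Section PartitionProducts.
Context {R : realType} {V U : completeNormedModType R}.
Context {TV : tensorPowers V} {TU : tensorPowers U}.

Fixpoint trunc_prod N (W : R -> R -> tseries TU) s (D : seq R) : tseries TU :=
  if D is t :: D' then ttmul N (W s t) (trunc_prod N W t D') else tsone TU.

Lemma partition_prodE p (W : R -> R -> tseries TU) D :
  partition_prod p W D = trunc_prod (Num.truncn p) W 0 D.
Proof.
suff H s : \big[@ttmul _ _ TU (Num.truncn p)/tsone TU]_(k < size D)
    W (nth 0 (s :: D) k) (nth 0 D k) = trunc_prod (Num.truncn p) W s D by exact: H.
elim: D s => [|t D IH] s; first by rewrite big_ord0.
by rewrite /= big_ord_recl -IH.
Qed.

(** Truncating after each multiplication is harmless: degree [i] of a product involves only degrees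
    at most [i] of its factors. *)
Lemma trunc_prod_low N (W Z : R -> R -> tseries TU) s t D i :
  (forall s' t', s <= s' -> s' < t' -> t' <= t -> W s' t' = ttrunc N (Z s' t')) ->
  itv_partition s t D -> (i <= N)%N -> trunc_prod N W s D i = path_prod Z s D i.
Proof.
elim: D s i => [//|u D IH] s i WZ Dp iN; rewrite /= /ttmul /ttrunc iN.
have Dp' := itv_partition_cons Dp; have ut := itv_partition_le Dp'.
have su : s < u by case: Dp => /= /andP[].
apply: eq_tsmul => j ji.
  by rewrite WZ // /ttrunc (leq_trans ji iN).
apply: IH => //; last exact: leq_trans ji iN.
by move=> s' t' us st tt; apply: WZ => //; exact: le_trans (ltW su) us.
Qed.

Lemma eq_trunc_prod N (W W' : R -> R -> tseries TU) s t D :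
  (forall s' t', s <= s' -> s' < t' -> t' <= t -> W s' t' = W' s' t') ->
  itv_partition s t D -> trunc_prod N W s D = trunc_prod N W' s D.
Proof.
elim: D s => [//|u D IH] s WW Dp /=.
have Dp' := itv_partition_cons Dp; have ut := itv_partition_le Dp'.
have su : s < u by case: Dp => /= /andP[].
rewrite WW // (IH u) // => s' t' us st tt.
by apply: WW => //; exact: le_trans (ltW su) us.
Qed.

Lemma trunc_prod_high N (W : R -> R -> tseries TU) s D i :
  D != [::] -> (N < i)%N -> trunc_prod N W s D i = 0.
Proof. by case: D => // t D _ Ni; rewrite /= /ttmul /ttrunc leqNgt Ni. Qed.

End PartitionProducts.

(** * Bounds for the lift and its dependence on the coefficients *)

Section LiftBounds.
Context {R : realType} {V U : completeNormedModType R}.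
Context {TV : tensorPowers V} {TU : tensorPowers U}.
Variable OT : operatorTensors TV TU.
Implicit Types phi psi : forall k, clinear (TV k.+1) U.
Implicit Types s : tseries TV.

Definition hat_bound n (a : zS n) : R := \sum_(s : 'S_n) `|(a s)%:~R : R|.

Lemma hat_bound_ge0 n (a : zS n) : 0 <= hat_bound a.
Proof. by apply: sumr_ge0. Qed.

Lemma norm_lift_series N (M m1 : R) l : 0 <= M -> 1 <= m1 ->
  exists2 C : R, 0 <= C & forall phi s m, (forall j, (j < N)%N -> `|phi j| <= M) ->
    0 <= m -> m <= m1 -> (forall k, `|s k| <= m ^+ k) ->
    `|lift_series OT phi N s l| <= C.
Proof.
move=> M0 m1_ge1; have m10 : 0 <= m1 by exact: le_trans m1_ge1.
exists (\sum_(k : {ffun 'I_l -> 'I_N}) M ^+ l *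
   (hat_bound (zwords (ktot (fun i => k i : nat)) (kwords (fun i => k i : nat)))
    * m1 ^+ (l * N))).
  apply: sumr_ge0 => k _.
  by rewrite mulr_ge0 ?exprn_ge0 // mulr_ge0 ?exprn_ge0 // hat_bound_ge0.
move=> phi s m phiM m0 mm1 sm.
apply: le_trans (ler_norm_sum _ _ _) _; apply: ler_sum => k _.
apply: le_trans (clinear_le _ _) _; apply: ler_pM => //.
  by apply: norm_kotens => // i; apply: phiM.
apply: le_trans (norm_hat_op _ _) _; apply: ler_wpM2l.
  exact: hat_bound_ge0.
apply: le_trans (sm _) _; apply: le_trans (_ : m1 ^+ _ <= _).
  by apply: lerXn2r; rewrite ?nnegrE.
by rewrite ler_weXn2l // ktot_le.
Qed.

(** Exchanging the coefficient of block [c] gains [m ^ (b - 1 - k c)], and the [k c + 1] letters of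
    that block give [m ^ (k c + 1)]. The product is [m ^ b] for every block; the remaining letters
    are bounded through [m1]. *)
Lemma norm_lift_series_sub N (M m1 C0 b : R) l : 1 <= M -> 1 <= m1 -> 0 <= C0 ->
  N%:R < b ->
  exists2 C : R, 0 <= C & forall phi psi s m,
    (forall j, (j < N)%N -> `|phi j| <= M) -> (forall j, (j < N)%N -> `|psi j| <= M) ->
    (forall j, (j < N)%N -> `|phi j - psi j| <= C0 * m `^ (b - 1 - j%:R)) ->
    0 <= m -> m <= m1 -> (forall k, `|s k| <= m ^+ k) ->
    `|lift_series OT phi N s l - lift_series OT psi N s l| <= C * m `^ b.
Proof.
move=> M1 m1_ge1 C00 Nb; have m10 : 0 <= m1 by exact: le_trans m1_ge1.
have M0 : 0 <= M by exact: le_trans M1.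
pose H (k : {ffun 'I_l -> 'I_N}) :=
  hat_bound (zwords (ktot (fun i => k i : nat)) (kwords (fun i => k i : nat))).
have H0 k : 0 <= H k by exact: hat_bound_ge0.
exists (\sum_(k : {ffun 'I_l -> 'I_N}) \sum_(c < l)
   M ^+ l * C0 * (H k * m1 ^+ (l * N))).
  apply: sumr_ge0 => k _; apply: sumr_ge0 => c _.
  by rewrite !mulr_ge0 ?exprn_ge0.
move=> phi psi s m phiM psiM phipsi m0 mm1 sm.
rewrite -sumrB mulr_suml.
apply: le_trans (ler_norm_sum _ _ _) _; apply: ler_sum => k _.
set kk := fun i => k i : nat.
rewrite /lift_op -[_ - _]/((kotens OT phi kk - kotens OT psi kk) _).
apply: le_trans (clinear_le _ _) _.
apply: le_trans (_ : (\sum_(c < l) M ^+ l * `|phi (kk c) - psi (kk c)|) *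
    (H k * m ^+ ktot kk) <= _).
  apply: ler_pM => //.
    by apply: otens_sub_le => // i; [apply: phiM|apply: psiM]; exact: ltn_ord.
  by apply: le_trans (norm_hat_op _ _) _; apply: ler_wpM2l; [exact: H0|exact: sm].
rewrite [leLHS]mulr_suml [leRHS]mulr_suml; apply: ler_sum => c _.
rewrite -!mulrA; apply: ler_wpM2l; first exact: exprn_ge0.
have kc : (kk c < N)%N by exact: ltn_ord.
have kctot : ((kk c).+1 <= ktot kk)%N by rewrite /ktot (bigD1 c) //= leq_addr.
have mk : m ^+ ktot kk <= m ^+ (kk c).+1 * m1 ^+ (l * N).
  rewrite -(subnKC kctot) exprD; apply: ler_wpM2l; first exact: exprn_ge0.
  apply: le_trans (_ : m1 ^+ (ktot kk - (kk c).+1) <= _).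
    by apply: lerXn2r; rewrite ?nnegrE.
  by rewrite ler_weXn2l // (leq_trans (leq_subr _ _)) // ktot_le.
have mb : m `^ (b - 1 - (kk c)%:R) * m ^+ (kk c).+1 = m `^ b.
  rewrite -powR_mulrn // -powRD; last first.
    rewrite -natr1; apply/implyP => /eqP h; exfalso.
    have : (kk c).+1%:R <= N%:R :> R by rewrite ler_nat.
    rewrite -natr1; have : 0 <= N%:R :> R by []; lra.
  by congr (_ `^ _); rewrite -natr1; ring.
apply: le_trans (_ : (C0 * m `^ (b - 1 - (kk c)%:R)) *
    (H k * (m ^+ (kk c).+1 * m1 ^+ (l * N))) <= _).
  apply: ler_pM => //.
  - by apply: (mulr_ge0 (H0 k)); exact: exprn_ge0.
  - exact: phipsi.
  - by apply: ler_wpM2l; [exact: H0|exact: mk].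
by rewrite -mb le_eqVlt; apply/orP; left; apply/eqP; ring.
Qed.

End LiftBounds.

(** * The rough integral *)

Section RoughIntegral.
Context {R : realType} {V U : completeNormedModType R}.
Context {TV : tensorPowers V} {TU : tensorPowers U}.
Variable OT : operatorTensors TV TU.
Variables (p gamma : R) (X : R -> tseries TV) (om : R -> R -> R).
Variables (theta : V -> clinear V U).
Variables (th : forall j : nat, V -> clinear (TV j) (clinear V U)) (k0 : nat) (M : R).
Hypotheses (hp : 1 <= p) (hgamma : p < gamma) (om_control : control om).
Hypothesis X_grouplike : forall t, 0 <= t -> t <= 1 -> grouplike (X t).
Hypothesis X_pvar : forall s t, 0 <= s -> s <= t -> t <= 1 ->
  (pvar p X s t <= (om s t)%:E)%E.
Hypothesis hth : lip_oneform gamma theta th k0 M.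

Let N := Num.truncn p.
Let phi s := lip_family th (trace X s).
Let incr s t := tsmul (tsinv (X s)) (X t).

Definition lift_path (s t : R) : tseries TU := lift_series OT (phi s) N (incr s t).

Lemma truncn_bounds : (0 < N)%N /\ N%:R <= p < N.+1%:R.
Proof.
have h := truncn_itv (le_trans ler01 hp); split=> //.
by rewrite -ltnS -(ltr_nat R); apply: le_lt_trans hp _; case/andP: h.
Qed.

Let N_gamma : N%:R < gamma.
Proof. by have [_ /andP[h _]] := truncn_bounds; exact: le_lt_trans hgamma. Qed.

Let N_k0 : (N <= k0.+1)%N.
Proof.
rewrite -ltnS -(ltr_nat R); have [_ h] := lip_degree hth.
rewrite -natr1; move: N_gamma h; lra.
Qed.

Let phi_sym s : sym_family (phi s) N.
Proof. exact: (lip_family_sym hth). Qed.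

Let X0 s : 0 <= s -> s <= 1 -> X s 0%N = tunit.
Proof. by move=> s0 s1; rewrite (X_grouplike s0 s1).1 tsone0. Qed.

Let X1 s : X s 1%N = vtens TV (trace X s).
Proof. by rewrite /vtens untens1K. Qed.

Lemma almost_mult_lift s t : 0 <= s -> s <= 1 -> 0 <= t -> t <= 1 ->
  almost_mult OT p X th s t = ttrunc N (lift_path s t).
Proof.
move=> s0 s1 t0 t1; congr ttrunc; apply: tseries_ext => -[|i].
  by rewrite /lift_path lift_series0 ?tsone0 // /incr tsmul_one0 ?tsinv_one0 ?X0.
by apply: eq_bigr => l _; rewrite -lift_termE.
Qed.

Lemma lift_increment_lift s t : 0 <= s -> s <= 1 -> 0 <= t -> t <= 1 ->
  lift_increment OT p X th s t = ttrunc N (lift_path s t).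
Proof.
move=> s0 s1 t0 t1; congr ttrunc; set q := taylor_oneform _ _ _.
have NE : (Num.truncn p).-1.+1 = N by rewrite prednK //; case: truncn_bounds.
have FE r : 0 <= r -> r <= 1 -> oneform_lift OT (Num.truncn p).-1 q (X r) =
    lift_series OT (shift_family (phi s) N (- trace X s)) N (X r).
  move=> r0 r1; rewrite oneform_liftE ?X0 // NE; apply: eq_lift_series => k kN.
  apply: uncurry_Dop_taylor => // [j u a jN|j jN].
    exact: (lip_sym hth _ _ _ N_k0 jN).
  exact: (lip_op hth _ N_k0 jN).
rewrite !FE // /lift_path /incr.
exact: (lift_series_increment _ _ (phi_sym s) (X_grouplike s0 s1)).
Qed.

Let m s t := om s t `^ p^-1.
(** An upper bound for all [m s t], raised by 1 so that its powers increase with the exponent. *)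
Let m1 := 1 + m 0 1.
Let b := Num.min gamma N.+1%:R.

Let p0 : 0 < p. Proof. exact: lt_le_trans hp. Qed.
Let m_ge0 s t : 0 <= m s t. Proof. exact: powR_ge0. Qed.
Let m1_ge1 : 1 <= m1. Proof. by rewrite lerDl. Qed.

Let m_mono s s' t' t : 0 <= s -> s <= s' -> s' <= t' -> t' <= t -> t <= 1 ->
  m s' t' <= m s t.
Proof.
move=> s0 ss st tt t1; have h := control_mono om_control s0 ss st tt t1.
have h0 : 0 <= om s' t'.
  by apply: (control_ge0 om_control) => //; [exact: le_trans ss|exact: le_trans t1].
by apply: ge0_ler_powR; rewrite ?nnegrE ?invr_ge0 ?(ltW p0) // (le_trans h0).
Qed.

Let m_le_m1 s t : 0 <= s -> s <= t -> t <= 1 -> m s t <= m1.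
Proof.
move=> s0 st t1; apply: le_trans (m_mono (lexx _) s0 st t1 (lexx _)) _.
by rewrite lerDr.
Qed.

Let incr_norm s t k : 0 <= s -> s <= t -> t <= 1 -> `|incr s t k| <= m s t ^+ k.
Proof.
move=> s0 st t1; apply: rough_increment_norm => //.
- by rewrite X0 // (le_trans st).
- by rewrite X0 // (le_trans s0).
- exact: (control_ge0 om_control).
exact: X_pvar.
Qed.

Let trace_norm s t : 0 <= s -> s <= t -> t <= 1 ->
  `|trace X t - trace X s| <= m s t.
Proof.
move=> s0 st t1; have s1 := le_trans st t1; have t0 := le_trans s0 st.
have Xs := X0 s0 s1; have Xt := X0 t0 t1.
have XE : X t = tsmul (X s) (incr s t).
  by rewrite /incr -tsmulA (tsinvP Xs).1 tsmul1l.
have : vtens TV (trace X t - trace X s) = incr s t 1%N.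
  rewrite (lcontB _ _ (lcont_vtens TV)) -!X1 {1}XE tsmul1E //.
    by rewrite addrAC subrr add0r.
  by rewrite /incr tsmul_one0 // tsinv_one0.
move=> vE; rewrite -(norm_tens1 TV) -[tens _ _]/(vtens TV _) vE.
by have := incr_norm 1 s0 st t1; rewrite expr1.
Qed.

Let b_gt : p < b.
Proof. by rewrite lt_min hgamma; have [_ /andP[]] := truncn_bounds. Qed.

Let N_b : N%:R < b.
Proof. by have [_ /andP[h _]] := truncn_bounds; exact: le_lt_trans b_gt. Qed.

Lemma lift_path_xx s : 0 <= s -> s <= 1 -> lift_path s s = tsone TU.
Proof.
by move=> s0 s1; rewrite /lift_path /incr (tsinvP (X0 s0 s1)).2 lift_series_one.
Qed.

Lemma lift_path0 s t : 0 <= s -> s <= t -> t <= 1 -> lift_path s t 0%N = tunit.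
Proof.
move=> s0 st t1; rewrite /lift_path lift_series0 // /incr tsmul_one0 ?tsinv_one0 //.
  by rewrite X0 // (le_trans st).
by rewrite X0 // (le_trans s0).
Qed.

Let M_ge0 : 0 <= M. Proof. exact: (lip_ge0 hth). Qed.

Let phi_norm s j : (j < N)%N -> `|phi s j| <= M.
Proof. by move=> jN; apply: (lip_family_norm hth); rewrite -ltnS (leq_trans jN). Qed.

Lemma lift_path_bounded i : exists2 C : R, 0 <= C &
  forall s t, 0 <= s -> s <= t -> t <= 1 -> `|lift_path s t i| <= C.
Proof.
have [C C0 h] := norm_lift_series OT N i M_ge0 m1_ge1; exists C => // s t s0 st t1.
apply: (h _ _ (m s t)) => //; first by move=> j; exact: phi_norm.
- exact: m_le_m1.
by move=> k; exact: incr_norm.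
Qed.

Lemma lift_path_sub i : exists2 C : R, 0 <= C &
  forall s u t, 0 <= s -> s <= u -> u <= t -> t <= 1 ->
    `|lift_path u t i - lift_series OT
        (shift_family (phi s) N (trace X u - trace X s)) N (incr u t) i| <=
    C * om s t `^ (b / p).
Proof.
have [C0 C00 hC0] := lip_family_shift hth N_gamma N_k0 m1_ge1.
(* The last summand covers the transported coefficients, which differ from those at [u] by at most
   that much; the summand 1 yields [1 <= M']. *)
pose M' := 1 + M + C0 * m1 `^ b.
have Cm0 : 0 <= C0 * m1 `^ b by rewrite mulr_ge0 // powR_ge0.
have M'1 : 1 <= M' by rewrite /M' -addrA lerDl addr_ge0.
have [C CC0 hC] := norm_lift_series_sub OT i M'1 m1_ge1 C00 N_b.
exists C => // s u t s0 su ut t1.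
have u1 := le_trans ut t1; have u0 := le_trans s0 su; have st := le_trans su ut.
have mu : m s u <= m s t by exact: m_mono.
have mt : m u t <= m s t by exact: m_mono.
have diff j : (j < N)%N ->
    `|phi u j - shift_family (phi s) N (trace X u - trace X s) j| <=
    C0 * m s t `^ (b - 1 - j%:R).
  move=> jN; apply: hC0 => //; first exact: m_le_m1.
  by apply: le_trans mu; exact: trace_norm.
have -> : om s t `^ (b / p) = m s t `^ b by rewrite /m -powRrM mulrC.
apply: hC => //.
- move=> j jN; apply: le_trans (phi_norm _ jN) _.
  by rewrite /M' -addrA addrCA lerDl addr_ge0.
- move=> j jN; set psi := shift_family _ _ _.
  have -> : psi j = phi u j - (phi u j - psi j) by rewrite opprB addrC subrK.
  apply: le_trans (ler_normB _ _) _; rewrite /M' -addrA addrCA.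
  apply: lerD; first exact: phi_norm.
  apply: le_trans (diff j jN) _; apply: le_trans (_ : C0 * m1 `^ b <= _).
    apply: ler_wpM2l => //.
    have e0 : 0 <= b - 1 - j%:R.
      have : j.+1%:R <= N%:R :> R by rewrite ler_nat.
      rewrite -natr1; move: N_b; lra.
    apply: le_trans (_ : m1 `^ (b - 1 - j%:R) <= _).
      apply: ge0_ler_powR; rewrite ?nnegrE //; last exact: m_le_m1.
      exact: le_trans m1_ge1.
    by apply: ler_powR => //; have : 0 <= j%:R :> R by []; lra.
  by rewrite lerDr.
- exact: m_le_m1.
move=> k; apply: le_trans (incr_norm k u0 ut t1) _.
by apply: lerXn2r; rewrite ?nnegrE.
Qed.

Lemma lift_path_almost_mult i : exists2 C : R, 0 <= C &
  forall s u t, 0 <= s -> s <= u -> u <= t -> t <= 1 ->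
    `|tsmul (lift_path s u) (lift_path u t) i - lift_path s t i| <=
    C * om s t `^ (b / p).
Proof.
have [K K0 hK] : exists2 K : R, 0 <= K & forall j, (j < i.+1)%N -> forall s t,
    0 <= s -> s <= t -> t <= 1 -> `|lift_path s t j| <= K.
  apply: exists_uniform_bound => [j C C' CC' h s t s0 st t1|j _].
    exact: le_trans (h s t s0 st t1) CC'.
  exact: lift_path_bounded.
have [E E0 hE] : exists2 E : R, 0 <= E & forall j, (j < i.+1)%N ->
    forall s u t, 0 <= s -> s <= u -> u <= t -> t <= 1 ->
    `|lift_path u t j - lift_series OT
        (shift_family (phi s) N (trace X u - trace X s)) N (incr u t) j| <=
    E * om s t `^ (b / p).
  apply: exists_uniform_bound => [j C C' CC' h s u t s0 su ut t1|j _].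
    by apply: le_trans (h s u t s0 su ut t1) _; rewrite ler_wpM2r // powR_ge0.
  exact: lift_path_sub.
exists (i.+1%:R * (K * E)); first by rewrite !mulr_ge0.
move=> s u t s0 su ut t1.
have u1 := le_trans ut t1; have u0 := le_trans s0 su.
have s1 := le_trans su u1.
rewrite /(lift_path s t) /incr (lift_series_chen OT (X t) (phi_sym s)
  (X_grouplike s0 s1) (X_grouplike u0 u1) (X1 s) (X1 u)).
rewrite -!mulrA; apply: tsmulBr_le => // j ji.
  by apply: hK.
exact: hE.
Qed.

Let tau_gt1 : 1 < b / p.
Proof. by rewrite ltr_pdivlMr // mul1r. Qed.

Lemma almost_mult_prod D : itv_partition 0 1 D ->
  partition_prod p (almost_mult OT p X th) D =
  ttrunc N (path_prod lift_path 0 D).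
Proof.
move=> Dp; rewrite partition_prodE; apply: tseries_ext => i.
rewrite /ttrunc; case: ifP => [iN|/negbT iN].
  apply: (trunc_prod_low _ Dp) => // s t s0 st t1.
  have st' := ltW st.
  by apply: almost_mult_lift => //; [exact: le_trans t1|exact: le_trans st'].
apply: trunc_prod_high; last by rewrite ltnNge.
apply/eqP => DE; move: Dp; rewrite DE => /itv_partition_nil /eqP.
by rewrite eq_sym oner_eq0.
Qed.

Lemma lift_increment_prod D : itv_partition 0 1 D ->
  partition_prod p (lift_increment OT p X th) D =
  partition_prod p (almost_mult OT p X th) D.
Proof.
move=> Dp; rewrite !partition_prodE; apply: eq_trunc_prod Dp => s t s0 st t1.
have st' := ltW st; have s1 := le_trans st' t1; have t0 := le_trans s0 st'.
by rewrite lift_increment_lift // almost_mult_lift.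
Qed.

Lemma near_partition (P : seq R -> Prop) : (forall D, itv_partition 0 1 D -> P D) ->
  \forall D \near mesh_to0 (R := R), P D.
Proof. by move=> h; exists 1 => [|D [Dp _]] /=; [exact: ltr01|exact: h]. Qed.

Lemma almost_mult_cvg :
  cvg (partition_prod p (almost_mult OT p X th) @ mesh_to0 (R := R)).
Proof.
have FF := @mesh_to0_proper R.
pose L : tseries TU := fun i =>
  if (i <= N)%N then lim (path_prod lift_path 0 D i @[D --> mesh_to0 (R := R)])
  else 0.
apply/cvg_ex; exists L; apply: cvg_tseries => i.
apply: cvg_trans (_ : ttrunc N (path_prod lift_path 0 D) i
    @[D --> mesh_to0 (R := R)] --> _); last first.
  rewrite /ttrunc /L; case: ifP => _; last exact: cvg_cst.
  apply: (path_prod_cvg om_control tau_gt1 lift_path_xx lift_path0).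
    exact: lift_path_bounded.
  exact: lift_path_almost_mult.
apply: near_eq_cvg; apply: near_partition => D Dp.
by rewrite -(almost_mult_prod Dp).
Qed.

End RoughIntegral.

Theorem theorem18 (R : realType) (V U : completeNormedModType R)
    (TV : tensorPowers V) (TU : tensorPowers U) (OT : operatorTensors TV TU)
    (p gamma : R) (hp : 1 <= p) (hgamma : p < gamma)
    (X : R -> tseries TV) (hX : geometric_rough_path p X)
    (theta : V -> clinear V U)
    (th : forall j : nat, V -> clinear (TV j) (clinear V U))
    (hth : Lip gamma theta th) :
  cvg (partition_prod p (almost_mult OT p X th) @ mesh_to0 (R := R)) /\
  partition_prod p (lift_increment OT p X th) D @[D --> mesh_to0 (R := R)] -->
    lyons_integral OT p X th.
Proof.
have [Xg [om [om_control Xom]]] := hX; have [k0 [M hlip]] := hth.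
have FF := @mesh_to0_proper R.
have cv := almost_mult_cvg (OT := OT) hp hgamma om_control Xg Xom hlip.
split => //; apply: cvg_trans cv; apply: near_eq_cvg.
apply: near_partition => D Dp.
by rewrite (lift_increment_prod OT hp hgamma Xg hlip Dp).
Qed.
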